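(* Let $N\ge 2$, let $\Omega\subset\mathbb{R}^{N}$ be a bounded open set containing the origin, let $\widetilde{R}=\sup_{x\in\Omega}|x|$ and let $R\ge\widetilde{R}$. Then there exists a constant $C=C(N,R,\widetilde{R})>0$ (depending only on $N,R,\widetilde{R}$) such that $$\int_{\Omega}|\nabla u(x)|^{N}\,dx-\left(\frac{N-1}{N}\right)^{N}\int_{\Omega}\frac{|u(x)|^{N}}{|x|^{N}\left(1+\log\frac{R}{|x|}\right)^{N}}\,dx\;\ge\;\left(\frac{N-1}{N}\right)^{N}\left(\int_{\Omega}\frac{|u(x)|^{N}}{|x|^{N}\left(1+\log\frac{R}{|x|}\right)^{N}}\,dx\right)\bigl(\widetilde{\mathcal{D}}_{N,R,C}(u)\bigr)^{N}$$ for every $u\in W^{1,N}_{0}(\Omega)$, where the right-hand side is understood to be $0$ when $u=0$ a.e.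
   Context: Functions are real-valued. $W^{1,N}_{0}(\Omega)$ is the completion of $C_c^\infty(\Omega)$ with respect to the $W^{1,N}(\Omega)$ norm. Functions in $W^{1,N}_0(\Omega)$ are extended by zero to the ball $B_{\widetilde{R}}(0)$. Rearrangements: the decreasing rearrangement of $u$ is $u^{*}(t)=\inf\{s\ge 0:\,|\{x\in\Omega:|u(x)|>s\}|\le t\}$ for $t\ge 0$, and the Schwarz symmetrization of $u$ is $u^{\#}(x)=u^{*}(|B_1|\,|x|^{N})$, where $|B_1|$ is the Lebesgue measure of the unit ball of $\mathbb{R}^N$. Define $$\|u\|_{\mathcal{L}^{N,R}(\Omega)}=\left(\int_{B_{\widetilde{R}}(0)}\frac{|u^{\#}(x)|^{N}}{|x|^{N}\left(1+\log\frac{R}{|x|}\right)^{N}}\,dx\right)^{\frac1N}.$$ Virtual extremizer: $\widetilde{\omega}_{R}(x)=\left(1+\log\frac{R}{|x|}\right)^{\frac{N-1}{N}}$ for $x\in\Omega\setminus\{0\}$. Distance function: for $C>0$ and $u$ not a.e. zero, $$\widetilde{\mathcal{D}}_{N,R,C}(u)=\inf_{a\in\mathbb{R}}\int_{\Omega}\left[\exp\left(\frac{C\,|u(x)-a\,\widetilde{\omega}_{R}(x)|^{\frac{N}{N-1}}}{\|u\|^{\frac{N}{N-1}}_{\mathcal{L}^{N,R}(\Omega)}}\right)-1\right]dx.$$ *)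

(* Defs.v *)
From HB Require Import structures.
From mathcomp Require Import all_boot all_order all_algebra.
From mathcomp Require Import all_classical all_reals all_analysis.

Set Implicit Arguments.
Unset Strict Implicit.
Unset Printing Implicit Defensive.
Import Order.TTheory GRing.Theory Num.Theory.
Import numFieldNormedType.Exports.

Local Open Scope classical_set_scope.
Local Open Scope ring_scope.

Definition measure_rV_display : measure_display.
Proof. exact: default_measure_display. Qed.

(* The sigma-algebra generated by the coordinates, i.e. the Borel one. *)
Section measurable_rV.
Context {K : realType} (n : nat).

Let coords (i : 'I_n) (x : 'rV[K]_n) : K := x ord0 i.

Let rV_set0 : g_sigma_preimage coords set0.
Proof. exact: sigma_algebra0. Qed.

Let rV_setC A : g_sigma_preimage coords A -> g_sigma_preimage coords (~` A).
Proof. exact: sigma_algebraC. Qed.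

Let rV_bigcup (F : _^nat) : (forall i, g_sigma_preimage coords (F i)) ->
  g_sigma_preimage coords (\bigcup_i (F i)).
Proof. exact: sigma_algebra_bigcup. Qed.

HB.instance Definition _ := @isMeasurable.Build measure_rV_display
  'rV[K]_n (g_sigma_preimage coords) rV_set0 rV_setC rV_bigcup.

End measurable_rV.

Section lebesgue_rV_construction.
Context {K : realType}.

Lemma measurable_fun_rVP d (T : measurableType d) n (f : T -> 'rV[K]_n) :
  measurable_fun [set: T] f <->
  forall i, measurable_fun [set: T] (fun t => f t ord0 i).
Proof.
pose coords (i : 'I_n) (x : 'rV[K]_n) : K := x ord0 i.
apply: (@iff_trans _ (g_sigma_preimage (fun i => coords i \o f) `<=` measurable)).
  rewrite g_sigma_preimage_comp; split=> [mf A [/= C preC <-]|prefS].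
    exact: mf.
  by move=> _ A mA; apply: prefS; exists A.
split=> [cfS i|mf].
- move=> _ A mA; apply: cfS; apply: sub_sigma_algebra.
  case: n i => [[] []//|n i] in f coords *.
  rewrite -bigcup_mkord_ord.
  exists i; first exact: ltn_ord.
  by exists A => //; rewrite inord_val.
- apply: smallest_sub; first exact: sigma_algebra_measurable.
  case: n => [|n] in f coords mf *; first by rewrite big_ord0.
  rewrite -bigcup_mkord_ord; apply: bigcup_sub => i Ii.
  by move=> A [B mB <-]; exact: mf.
Qed.

Lemma measurable_coord n (i : 'I_n) :
  measurable_fun [set: 'rV[K]_n] (fun x : 'rV[K]_n => x ord0 i).
Proof. by move: i; apply/measurable_fun_rVP. Qed.

Definition cons_rV n (z : K * 'rV[K]_n) : 'rV[K]_n.+1 := row_mx z.1%:M z.2.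

Lemma cons_rV0 n (z : K * 'rV[K]_n) : cons_rV z ord0 ord0 = z.1.
Proof.
transitivity (row_mx z.1%:M z.2 ord0 (lshift n (ord0 : 'I_1))).
  by congr (row_mx _ _ _ _); exact/val_inj.
by rewrite row_mxEl mxE.
Qed.

Lemma cons_rVS n (z : K * 'rV[K]_n) (i : 'I_n) :
  cons_rV z ord0 (lift ord0 i) = z.2 ord0 i.
Proof.
transitivity (row_mx z.1%:M z.2 ord0 (rshift 1 i)); last by rewrite row_mxEr.
by congr (row_mx _ _ _ _); exact/val_inj.
Qed.

Lemma measurable_cons_rV n :
  measurable_fun [set: measurableTypeR K * 'rV[K]_n] (@cons_rV n).
Proof.
apply/measurable_fun_rVP => i; case: (unliftP ord0 i) => [j ->|->].
- under eq_fun do rewrite cons_rVS.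
  exact: (measurableT_comp (measurable_coord j)).
- by under eq_fun do rewrite cons_rV0; exact: measurable_fst.
Qed.

Section step.
Variables (n : nat) (mu : {sigma_finite_measure set 'rV[K]_n -> \bar K}).

Definition lebesgue_rV_step : set 'rV[K]_n.+1 -> \bar K :=
  pushforward (lebesgue_measure \x mu)%E (@cons_rV n).

Let mcons_preimage (A : set 'rV[K]_n.+1) :
  measurable A -> measurable (@cons_rV n @^-1` A : set (measurableTypeR K * 'rV[K]_n)).
Proof. by move=> mA; rewrite -[X in measurable X]setTI; exact: measurable_cons_rV. Qed.

Let step0 : lebesgue_rV_step set0 = 0%E.
Proof. by rewrite /lebesgue_rV_step /pushforward preimage_set0 measure0. Qed.

Let step_ge0 A : (0 <= lebesgue_rV_step A)%E.
Proof. exact: (measure_ge0 (lebesgue_measure \x mu)%E). Qed.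

Let step_sigma_additive : semi_sigma_additive lebesgue_rV_step.
Proof.
move=> F mF tF mUF; rewrite /lebesgue_rV_step /pushforward preimage_bigcup.
apply: measure_semi_sigma_additive.
- by move=> k; exact: mcons_preimage.
- apply/trivIsetP => /= i j _ _ ij; rewrite -preimage_setI.
  by move/trivIsetP : tF => /(_ _ _ _ _ ij) ->//; rewrite preimage_set0.
- by rewrite -preimage_bigcup; exact: mcons_preimage.
Qed.

HB.instance Definition _ := isMeasure.Build _ _ _
  lebesgue_rV_step step0 step_ge0 step_sigma_additive.

Let step_sigma_finite : sigma_finite [set: 'rV[K]_n.+1] lebesgue_rV_step.
Proof.
have /sigma_finiteP[F [TF ndF Foo]] := sigma_finiteT (@lebesgue_measure K).
have /sigma_finiteP[G [TG ndG Goo]] := sigma_finiteT mu.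
pose g (x : 'rV[K]_n.+1) : measurableTypeR K * 'rV[K]_n :=
  (x ord0 ord0, \row_i x ord0 (lift ord0 i)).
have mg : measurable_fun [set: 'rV[K]_n.+1] g.
  apply/measurable_fun_pairP; split; first exact: measurable_coord.
  apply/measurable_fun_rVP => i /=.
  under eq_fun do rewrite mxE.
  exact: measurable_coord.
have gK : cancel (@cons_rV n) g.
  move=> [x y]; rewrite /g cons_rV0; congr pair.
  by apply/rowP => i; rewrite mxE cons_rVS.
exists (fun k => g @^-1` (F k `*` G k)).
  rewrite -preimage_bigcup (_ : \bigcup_k _ = setT) ?preimage_setT//.
  rewrite -setXTT TF TG predeqE => -[x y]; split.
    by move=> [k _ []/= ? ?]; split; exists k.
  move=> [/= [k _ Fkx] [l _ Gly]]; exists (maxn k l) => //; split.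
  - by move: x Fkx; exact/subsetPset/ndF/leq_maxl.
  - by move: y Gly; exact/subsetPset/ndG/leq_maxr.
move=> k; have [mFk Fkoo] := Foo k; have [mGk Gkoo] := Goo k; split.
  by rewrite -[X in measurable X]setTI; apply: mg => //; exact: measurableX.
rewrite /lebesgue_rV_step /pushforward -comp_preimage.
rewrite (_ : g \o @cons_rV n = id); last by apply/funext => z; exact: gK.
by rewrite preimage_id product_measure1E// lte_mul_pinfty// ge0_fin_numE.
Qed.

HB.instance Definition _ := @Measure_isSigmaFinite.Build _ _ _
  lebesgue_rV_step step_sigma_finite.

End step.

(* Iterated product of the one-dimensional Lebesgue measure; its values on boxes
   are given by [lebesgue_rV_box]. *)
Fixpoint lebesgue_rV n : {sigma_finite_measure set 'rV[K]_n -> \bar K} :=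
  if n is m.+1 then lebesgue_rV_step (lebesgue_rV m) else \d_(0 : 'rV[K]_0).

Lemma measurable_box n (a b : 'I_n -> K) :
  measurable [set x : 'rV[K]_n | forall i, x ord0 i \in `[a i, b i]].
Proof.
rewrite (_ : mkset _ = \bigcap_(i in [set: 'I_n])
    ((fun x : 'rV[K]_n => x ord0 i) @^-1` `[a i, b i]%classic)); last first.
  by apply/seteqP; split=> x /= h i => [_|]; exact: h.
apply: fin_bigcap_measurable; first exact: finite_finset.
by move=> i _; rewrite -[X in measurable X]setTI; exact: measurable_coord.
Qed.

Lemma lebesgue_rV_box n (a b : 'I_n -> K) : (forall i, a i <= b i) ->
  lebesgue_rV n [set x | forall i, x ord0 i \in `[a i, b i]] =
  (\prod_(i < n) (b i - a i))%:E.
Proof.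
elim: n a b => [|n IH] a b ab.
  by rewrite /= diracE big_ord0 mem_set// => -[].
rewrite /= /lebesgue_rV_step /pushforward.
set B := [set x : 'rV[K]_n |
  forall i, x ord0 i \in `[a (lift ord0 i), b (lift ord0 i)]].
rewrite (_ : _ @^-1` _ = `[a ord0, b ord0]%classic `*` B); last first.
  apply/seteqP; split=> [z /= h|z /= [h0 h] i].
    split; first by have := h ord0; rewrite cons_rV0.
    by move=> i; have := h (lift ord0 i); rewrite cons_rVS.
  by case: (unliftP ord0 i) => [j ->|->]; rewrite ?cons_rV0 ?cons_rVS.
rewrite product_measure1E//; last exact: measurable_box.
rewrite IH// big_ord_recl EFinM; congr (_ * _)%E.
rewrite [LHS]lebesgue_measure_itv/= lte_fin.
by have := ab ord0; rewrite le_eqVlt => /predU1P[->|->]; rewrite ?ltxx ?subrr.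
Qed.

End lebesgue_rV_construction.

Section euclidean_space.
Context {K : realType} {N : nat}.
Implicit Types (f phi u : 'rV[K]_N -> K) (g : 'rV[K]_N -> 'rV[K]_N).
Implicit Types (x : 'rV[K]_N) (Om : set 'rV[K]_N).

(* The library norm on ['rV[K]_N] is the sup norm; it has the same open sets
   and bounded sets as the Euclidean one. *)
Definition enorm x : K := Num.sqrt (\sum_i x ord0 i ^+ 2).

Definition eball (r : K) : set 'rV[K]_N := [set x | enorm x < r].

Definition outer_radius Om : K := sup [set enorm x | x in Om].

Definition partial (i : 'I_N) f : 'rV[K]_N -> K :=
  fun x => 'D_(delta_mx ord0 i) f x.

Definition iter_partial (s : seq 'I_N) f : 'rV[K]_N -> K := foldr partial f s.

Definition smooth f : Prop := forall s : seq 'I_N,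
  continuous (iter_partial s f) /\
  forall i x, derivable (iter_partial s f) x (delta_mx ord0 i).

Definition grad f : 'rV[K]_N -> 'rV[K]_N := fun x => \row_i partial i f x.

Definition support f : set 'rV[K]_N := closure [set x | f x != 0].

Definition test_fun Om phi : Prop :=
  [/\ smooth phi, compact (support phi) & support phi `<=` Om].

End euclidean_space.

Section sobolev.
Context {K : realType} {N : nat}.
Local Notation mu := (lebesgue_rV (K := K) N).
Implicit Types (phi u : 'rV[K]_N -> K) (g : 'rV[K]_N -> 'rV[K]_N).
Implicit Types (Om : set 'rV[K]_N) (p : nat).

Definition weak_gradient Om u g : Prop := forall phi (i : 'I_N),
  test_fun Om phi ->
  (\int[mu]_(x in Om) (u x * partial i phi x)%:E =
   - \int[mu]_(x in Om) (g x ord0 i * phi x)%:E)%E.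

(* [g] stands for the gradient of [u]. *)
Definition sobolev_norm Om p u g : \bar K :=
  ((\int[mu]_(x in Om) (`|u x| ^+ p)%:E +
    \int[mu]_(x in Om) (enorm (g x) ^+ p)%:E) `^ p%:R^-1)%E.

Definition sobolev Om p u g : Prop :=
  [/\ measurable_fun Om u, measurable_fun Om g,
      weak_gradient Om u g & (sobolev_norm Om p u g < +oo)%E].

(* The completion of the test functions for the Sobolev norm, realized inside
   the Sobolev space: [sobolev0 Om p u g] says that [u] belongs to it and that
   [g] is (a representative of) the weak gradient of [u].  Only the values of
   [u] and [g] on [Om] matter here and below. *)
Definition sobolev0 Om p u g : Prop :=
  sobolev Om p u g /\
  exists phi : nat -> 'rV[K]_N -> K,
    (forall k, test_fun Om (phi k)) /\
    (fun k => sobolev_norm Om p (fun x => phi k x - u x)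
                                (fun x => grad (phi k) x - g x)) @ \oo --> 0%E.

End sobolev.

Section hardy.
Context {K : realType} {N : nat}.
Local Notation mu := (lebesgue_rV (K := K) N).
Implicit Types (u : 'rV[K]_N -> K) (x : 'rV[K]_N) (Om : set 'rV[K]_N).
Implicit Types (R C a s : K) (t : \bar K).

(* Like [virtual_extremizer], this takes a meaningless value at the origin,
   which is a null set. *)
Definition hardy_weight R x : K :=
  enorm x ^+ N * (1 + ln (R / enorm x)) ^+ N.

Definition hardy_integral Om R u : \bar K :=
  (\int[mu]_(x in Om) (`|u x| ^+ N / hardy_weight R x)%:E)%E.

(* Extended-real valued, because it is [+oo] at [t = 0] when [u] is
   essentially unbounded. *)
Definition decreasing_rearrangement Om u t : \bar K :=
  ereal_inf [set (s : K)%:E | s in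
    [set s : K | 0 <= s /\ (mu (Om `&` [set x | (s < `|u x|)%R]) <= t)%E]].

Definition schwarz_symmetrization Om u x : \bar K :=
  decreasing_rearrangement Om u (mu (eball 1) * (enorm x ^+ N)%:E)%E.

Definition log_lorentz_norm Om R u : \bar K :=
  ((\int[mu]_(x in eball (outer_radius Om))
      (`|schwarz_symmetrization Om u x| ^+ N * (hardy_weight R x)^-1%:E))
   `^ N%:R^-1)%E.

Definition virtual_extremizer R x : K :=
  (1 + ln (R / enorm x)) `^ ((N%:R - 1) / N%:R).

(* Meaningful when [u] is not a.e. zero and its norm is finite.  When [u] is
   a.e. zero, [hardy_integral Om R u] is zero, and so is its product with any
   extended real. *)
Definition extremizer_dist Om R C u : \bar K :=
  ereal_inf [set
    (\int[mu]_(x in Om)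
      (expR (C * `|u x - a * virtual_extremizer R x| `^ (N%:R / (N%:R - 1)) /
             fine (log_lorentz_norm Om R u) `^ (N%:R / (N%:R - 1))) - 1)%:E)%E
    | a in [set: K]].

End hardy.

(* Main.v *)
Require Import Defs.
From mathcomp Require Import all_boot all_order all_algebra.
From mathcomp Require Import all_classical all_reals all_analysis.
From mathcomp Require Import measurable_realfun ring lra.
Set Implicit Arguments.
Unset Strict Implicit.
Unset Printing Implicit Defensive.
Import Order.TTheory GRing.Theory Num.Theory.
Import numFieldNormedType.Exports.
Local Open Scope classical_set_scope.
Local Open Scope ring_scope.

(** Write t = 1 + log (R / |x|), V = |x|^(-N) t^(-N), c = ((N-1)/N)^N and
    H = \int V |u|^N, and let L be the Lorentz norm of u.  Since the distance is
    an infimum over the multiples a of the virtual extremizer, it is at most its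
    value at a = 0, so it suffices to find C with

      c H (\int (exp (C (|u|/L)^(N/(N-1))) - 1))^N
         <= \int |Du|^N - c H.

    Three facts give this.

    (1) The Hardy inequality has an L^N remainder ([improved_hardy]):
    c H + kap \int |u|^N <= \int |Du|^N with kap > 0 depending on N and R only.
    For a vector field F = b(t)^(N-1) x / |x|^N, integrating div F against
    |u|^N and applying Young's inequality to |u|^(N-1) |F| |Du| yields
    \int (div F - (N-1) b^N / |x|^N) |u|^N <= \int |Du|^N.  As x / |x|^N is
    divergence-free, the bracket is
    (N-1) |x|^(-N) (b^(N-2) (-b') - b^N).  The choice b = (N-1)/(N t), the
    logarithmic derivative of the virtual extremizer t^((N-1)/N), makes it
    exactly c V.  Adding the lower order term 1/(N t^2) to b makes it at least
    c V (1 + 1/((N-1) t)), and V / t is bounded below on |x| <= R.  The field is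
    singular at 0, so |x|^2 is first replaced by |x|^2 + q; the inequality
    passes from test functions to the Sobolev space by density
    ([hardy_reg_sobolev0]), and then q tends to 0 by Fatou's lemma.

    (2) The Lorentz norm dominates the Hardy integral, H <= 2 L^N
    ([hardy_le_lorentz]), because V decreases with |x|: the
    integral of V over a level set of |u| is at most twice its integral over the
    centred ball of the same measure ([level_hardy]), and the layer cake formula
    sums this over the levels.

    (3) The level sets decay exponentially ([level_decay]).  If the level set
    {|u| > s} has the measure of the ball of radius rho, then L^N is at least
    s^N times the integral of V over this ball, which is at least a multiple of
    (1 + log (R / rho))^(1-N) ([hardy_ball_ge]).  Solving for rho bounds the
    measure of {|u| > s} by a multiple of exp (- be (s/L)^(N/(N-1))).  Hence
    exp (th (|u|/L)^(N/(N-1))) has integral at most a constant K2 for a small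
    th > 0 ([exp_level_bound]).

    With y = |u|/L and z = y^(N/(N-1)), the elementary bound
    exp (C z) - 1 <= C K3 y exp (2 eta z) and Hoelder's inequality turn (3) into
    (\int (exp (C z) - 1))^N <= (C K4)^N \int |u|^N / L^N ([exp_dist_bound]).
    Multiplying by c H <= 2 c L^N leaves 2 c (C K4)^N \int |u|^N, which is at
    most the remainder kap \int |u|^N of (1) when C is small. *)

(** * Lebesgue measure and the Euclidean norm on row vectors *)

Section basics.
Context {K : realType}.

(** The sigma-algebra is generated by the coordinates; an open set belongs to it
    because it is the union of the countably many open boxes with rational
    corners that it contains. *)
Lemma open_measurable_rV n (A : set 'rV[K]_n) : open A -> measurable A.
Proof.
move=> oA.
pose B (p : 'rV[rat]_n * 'rV[rat]_n) := [set y : 'rV[K]_n | forall i,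
  y ord0 i \in `](ratr (p.1 ord0 i)), (ratr (p.2 ord0 i))[].
have mB p : measurable (B p).
  rewrite (_ : B p = \bigcap_(i in [set: 'I_n])
    ((fun x : 'rV[K]_n => x ord0 i) @^-1`
      `](ratr (p.1 ord0 i)), (ratr (p.2 ord0 i))[%classic)).
    apply: fin_bigcap_measurable; first exact: finite_finset.
    by move=> i _; rewrite -[X in measurable X]setTI; exact: measurable_coord.
  by apply/seteqP; split=> x /= h i => [_|]; exact: h.
rewrite (_ : A = \bigcup_p (if `[< B p `<=` A >] then B p else set0)).
  apply: countable_bigcupT_measurable; first exact: countableP.
  by move=> p; case: ifP.
apply/seteqP; split; last by move=> x [p _]; case: ifPn => // /asboolP; apply.
move=> x Ax; have /nbhs_ballP[e /= e0 xeA] := open_nbhs_nbhs (conj oA Ax).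
have Ha i : {q : rat | x ord0 i - e < ratr q < x ord0 i}.
  apply: cid; have [|q] := @rat_in_itvoo K (x ord0 i - e) (x ord0 i).
    by rewrite ltrBlDr ltrDl.
  by rewrite in_itv /=; exists q.
have Hb i : {q : rat | x ord0 i < ratr q < x ord0 i + e}.
  apply: cid; have [|q] := @rat_in_itvoo K (x ord0 i) (x ord0 i + e).
    by rewrite ltrDl.
  by rewrite in_itv /=; exists q.
pose p := (\row_i sval (Ha i), \row_i sval (Hb i)).
exists p => //; case: asboolP => [_|].
  move=> i; rewrite in_itv /= !mxE.
  by have /andP[_ ->] := svalP (Ha i); have /andP[-> _] := svalP (Hb i).
case=> y By; apply: xeA; split=> // i0 i; rewrite (ord1 i0) /ball /=.
have := By i; rewrite in_itv /= !mxE => /andP[ya yb].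
have /andP[qa1 qa2] := svalP (Ha i); have /andP[qb1 qb2] := svalP (Hb i).
rewrite ltr_distl; apply/andP; split; lra.
Qed.

Lemma continuous_measurable_rV n (f : 'rV[K]_n -> K) :
  continuous f -> measurable_fun [set: 'rV[K]_n] f.
Proof.
move=> cf; apply: (measurability _ (measurable_realfun.RGenOpens.measurableE K)) => // _ [_ [a [b ->]] <-].
rewrite setTI; apply: open_measurable_rV.
by move/continuousP: cf; apply; exact: interval_open.
Qed.

Lemma enorm_continuous n : continuous (@enorm K n).
Proof.
move=> x; rewrite /enorm.
apply: (@continuous_comp _ _ _ (fun x : 'rV[K]_n => \sum_i x ord0 i ^+ 2) Num.sqrt).
  apply: continuous_big => [|i _]; first exact: add_continuous.
  move=> {}x; apply: (@continuous_comp _ _ _ (fun x : 'rV[K]_n => x ord0 i) (fun t => t ^+ 2)).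
    exact: coord_continuous.
  exact: exprn_continuous.
exact: sqrt_continuous.
Qed.

Lemma measurable_enorm n : measurable_fun [set: 'rV[K]_n] (@enorm K n).
Proof. by apply: continuous_measurable_rV; exact: enorm_continuous. Qed.

Lemma enorm_ge0 n (x : 'rV[K]_n) : 0 <= enorm x.
Proof. exact: sqrtr_ge0. Qed.

Lemma sqr_enorm n (x : 'rV[K]_n) : enorm x ^+ 2 = \sum_i x ord0 i ^+ 2.
Proof. by rewrite sqr_sqrtr// sumr_ge0// => i _; exact: sqr_ge0. Qed.

Lemma enormZ n (l : K) (x : 'rV[K]_n) : 0 <= l -> enorm (l *: x) = l * enorm x.
Proof.
move=> l0; rewrite /enorm (_ : \sum_i _ = l ^+ 2 * \sum_i x ord0 i ^+ 2).
  by rewrite sqrtrM ?sqr_ge0// sqrtr_sqr ger0_norm.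
by rewrite mulr_sumr; apply: eq_bigr => i _; rewrite !mxE exprMn.
Qed.

Lemma coord_le_enorm n (x : 'rV[K]_n) i : `|x ord0 i| <= enorm x.
Proof.
rewrite -(@ler_pXn2r _ 2)// ?nnegrE ?enorm_ge0// sqr_enorm (bigD1 i)//= real_normK ?num_real//.
by rewrite lerDl sumr_ge0// => j _; exact: sqr_ge0.
Qed.

Lemma enorm_eq0 n (x : 'rV[K]_n) : (enorm x == 0) = (x == 0).
Proof.
apply/eqP/eqP => [x0|->]; last first.
  by rewrite /enorm big1 ?sqrtr0// => i _; rewrite mxE expr0n.
apply/rowP => i; rewrite mxE; apply/eqP; rewrite -normr_le0.
by have := coord_le_enorm x i; rewrite x0.
Qed.

Lemma enorm_le_sum n (x : 'rV[K]_n) : enorm x <= \sum_i `|x ord0 i|.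
Proof.
rewrite -(@ler_pXn2r _ 2)// ?nnegrE ?enorm_ge0// ?sumr_ge0// sqr_enorm.
rewrite expr2 mulr_suml; apply: ler_sum => i _.
rewrite -real_normK ?num_real// expr2 ler_wpM2l// (bigD1 i)//= lerDl.
exact: sumr_ge0.
Qed.

Lemma measurable_eball n (r : K) : measurable (eball r : set 'rV[K]_n).
Proof.
rewrite -[X in measurable X]setTI.
by have := measurable_fun_ltr (@measurable_enorm n) (@measurable_cst _ _ _ _ setT r)
  => /(_ measurableT [set true] I).
Qed.

Lemma lebesgue_scale (l : K) (B : set (measurableTypeR K)) : 0 < l -> measurable B ->
  (lebesgue_measure (( *%R l) @^-1` B) = l^-1%:E * lebesgue_measure B)%E.
Proof.
move=> l0 mB.
have ml : measurable_fun [set: measurableTypeR K] (( *%R l) : measurableTypeR K -> measurableTypeR K).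
  exact: mulrl_measurable.
have H : forall A : set (measurableTypeR K), measurable A ->
  lebesgue_measure A = mscale (NngNum (ltW l0)) (pushforward lebesgue_measure ( *%R l : measurableTypeR K -> measurableTypeR K)) A.
  move=> A mA; apply: lebesgue_measure_unique => //= _ [[a b]] _ <-.
  rewrite /mscale /= /pushforward.
  rewrite (_ : _ @^-1` _ = `]l^-1 * a, l^-1 * b]%classic); last first.
    by apply/seteqP; split=> x /=; rewrite !in_itv/= !ltr_pdivrMl// !ler_pdivlMl.
  rewrite !lebesgue_measure_itv/= !lte_fin ltr_pM2l ?invr_gt0//; case: ifP => _; last by rewrite mule0.
  by rewrite -EFinD -EFinM; congr EFin; field; rewrite gt_eqF.
rewrite (H ml _ mB) /mscale /= /pushforward muleA -EFinM mulVf ?gt_eqF// mul1e//.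
Qed.

Lemma ge0_integral_scale (l : K) (f : K -> \bar K) : 0 < l ->
  measurable_fun [set: measurableTypeR K] f -> (forall x, 0 <= f x)%E ->
  (\int[lebesgue_measure]_x f (l * x)%R = l^-1%:E * \int[lebesgue_measure]_x f x)%E.
Proof.
move=> l0 mf f0.
have ml : measurable_fun [set: measurableTypeR K] (( *%R l) : measurableTypeR K -> measurableTypeR K).
  exact: mulrl_measurable.
have li0 : 0 <= l^-1 by rewrite invr_ge0 ltW.
rewrite -(ge0_integral_mscale _ measurableT (NngNum li0))//.
have /= <- := @ge0_integral_pushforward _ _ _ _ K _ ml lebesgue_measure setT f measurableT mf
  (fun x _ => f0 x).
apply: eq_measure_integral => A mA _.
by rewrite -[LHS]/(lebesgue_measure (( *%R l) @^-1` A)) lebesgue_scale.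
Qed.

Lemma scale_cons_rV n (l : K) (z : K * 'rV[K]_n) :
  l *: cons_rV z = cons_rV (l * z.1, l *: z.2).
Proof.
apply/rowP => i; rewrite mxE; case: (unliftP ord0 i) => [j ->|->].
  by rewrite !cons_rVS mxE.
by rewrite !cons_rV0.
Qed.

(** Induction along the iterated product: the first coordinate contributes one
    factor 1 / l and each section contributes the others. *)
Lemma lebesgue_rV_scale n (l : K) (A : set 'rV[K]_n) : 0 < l -> measurable A ->
  (lebesgue_rV n (( *:%R l) @^-1` A) = (l^-1 ^+ n)%:E * lebesgue_rV n A)%E.
Proof.
move=> l0; elim: n A => [|n IH] A mA.
  by rewrite /= !diracE expr0 mul1e (_ : (0 \in _) = (0 \in A))//; apply/idP/idP;
     rewrite !inE /= scaler0.
rewrite /= /lebesgue_rV_step /pushforward.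
pose A' := @cons_rV K n @^-1` A.
have mA' : measurable (A' : set (measurableTypeR K * 'rV[K]_n)).
  by rewrite -[X in measurable X]setTI; exact: measurable_cons_rV.
rewrite -!/(product_measure1 _ _ _) -/A'.
rewrite -[LHS]/(\int[lebesgue_measure]_x lebesgue_rV n (xsection (@cons_rV K n @^-1` ( *:%R l @^-1` A)) x))%E.
rewrite -[X in (_ * X)%E]/(\int[lebesgue_measure]_x lebesgue_rV n (xsection A' x))%E.
have mf := measurable_fun_xsection (lebesgue_rV n) mA'.
transitivity (\int[@lebesgue_measure K]_x ((l^-1 ^+ n)%:E * lebesgue_rV n (xsection A' (l * x)%R)))%E.
  apply: eq_integral => x _; rewrite -IH; last exact: measurable_xsection.
  congr (lebesgue_rV n _); by apply/seteqP; split=> y; rewrite /xsection /= !inE /A' /= scale_cons_rV.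
rewrite ge0_integralZl//.
- rewrite (ge0_integral_scale l0 mf)// muleA exprSr EFinM//.
- apply: (measurableT_comp mf); exact: mulrl_measurable.
- by rewrite lee_fin exprn_ge0// invr_ge0 ltW.
Qed.

Lemma lebesgue_rV_eball n (r : K) : 0 < r ->
  (lebesgue_rV n (eball r) = (r ^+ n)%:E * lebesgue_rV n (eball 1))%E.
Proof.
move=> r0; rewrite -[in RHS](invrK r) -lebesgue_rV_scale ?invr_gt0//; last exact: measurable_eball.
congr (lebesgue_rV n _); apply/seteqP; split=> x; rewrite /eball /=;
  by rewrite enormZ ?invr_ge0 1?ltW// ltr_pdivrMl// mulr1.
Qed.

Lemma lebesgue_rV_eball_fin n (r : K) : (lebesgue_rV n (eball r) < +oo)%E.
Proof.
have [r0|r0] := leP r 0.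
  rewrite (_ : eball r = set0) ?measure0 ?ltry//.
  by apply/seteqP; split=> x //=; rewrite /eball/= ltNge (le_trans r0) ?enorm_ge0.
pose Q := [set x : 'rV[K]_n | forall i, x ord0 i \in `[-r, r]].
apply: (@le_lt_trans _ _ (lebesgue_rV n Q)).
  apply: le_measure; rewrite ?inE; [exact: measurable_eball|exact: measurable_box|].
  move=> x xr i; rewrite /= in_itv /= -ler_norml.
  by rewrite (le_trans (coord_le_enorm x i))// ltW.
by rewrite /Q (@lebesgue_rV_box K n (fun=> -r) (fun=> r)) ?ltry// => i; lra.
Qed.

Lemma lebesgue_rV_eball1_gt0 n : (0 < lebesgue_rV n (eball (1 : K)))%E.
Proof.
pose a : K := (n.+1%:R)^-1.
have a0 : 0 < a by rewrite invr_gt0 ltr0n.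
pose Q := [set x : 'rV[K]_n | forall i, x ord0 i \in `[-a, a]].
apply: (@lt_le_trans _ _ (lebesgue_rV n Q)).
  rewrite /Q (@lebesgue_rV_box K n (fun=> -a) (fun=> a)); last by move=> i; lra.
  by rewrite lte_fin prodr_gt0// => i _; lra.
apply: le_measure; rewrite ?inE; [exact: measurable_box|exact: measurable_eball|].
move=> x /= xa; rewrite /eball /=; apply: le_lt_trans (enorm_le_sum x) _.
apply: le_lt_trans (_ : _ <= \sum_(i < n) a) _.
  by apply: ler_sum => i _; rewrite ler_norml; have := xa i; rewrite in_itv.
by rewrite sumr_const card_ord -mulr_natr /a ltr_pdivrMl// ?ltr0n// mulr1 ltr_nat.
Qed.

Lemma measurable_origin n : measurable [set (0 : 'rV[K]_n)].
Proof.
rewrite (_ : [set 0] = [set x : 'rV[K]_n | forall i, x ord0 i \in `[(0:K), 0]]).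
  exact: measurable_box.
apply/seteqP; split=> x /=.
  by move=> -> i; rewrite mxE in_itv/= lexx.
by move=> h; apply/rowP => i; rewrite mxE; apply/eqP; have := h i; rewrite in_itv/= -eq_le eq_sym.
Qed.

Lemma lebesgue_rV_origin n : (0 < n)%N -> lebesgue_rV n [set (0 : 'rV[K]_n)] = 0%E.
Proof.
move=> n0; have := @lebesgue_rV_box K n (fun=> 0) (fun=> 0) (fun _ => lexx _).
rewrite subrr prodr_const card_ord expr0n eqn0Ngt n0 /= => H; rewrite -[RHS]H.
congr (lebesgue_rV n _); apply/seteqP; split=> x /=.
  by move=> -> i; rewrite mxE in_itv/= lexx.
by move=> h; apply/rowP => i; rewrite mxE; apply/eqP; have := h i; rewrite in_itv/= -eq_le eq_sym.
Qed.

Lemma coord_le_norm n (x : 'rV[K]_n) i : `|x ord0 i| <= `|x|.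
Proof.
rewrite [leRHS]/Num.norm /= mx_normrE; apply/bigmax_geP.
by right => /=; exists (ord0, i).
Qed.

Lemma cvg_line n (v x : 'rV[K]_n) : (fun t : K => t *: v + x) @ 0 --> x.
Proof.
have E : 0 *: v + x = x by rewrite scale0r add0r.
rewrite -[X in _ --> X]E.
by apply: cvgD; [exact: scalel_continuous|exact: cvg_cst].
Qed.

End basics.

(** * The integral of a partial derivative of compact support *)

Section ibp.
Context {K : realType}.

Lemma continuous_cons_rVr n (x : K) : continuous (fun y : 'rV[K]_n => cons_rV (x, y)).
Proof.
move=> y; apply/(@cvg_ballP _ _ _ (nbhs y) (nbhs_filter y)) => e e0; apply: (@filterS _ (nbhs y) (nbhs_filter y) (ball y e) _ _ (nbhsx_ballx y e e0)) => w yw.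
split=> // i0 i; rewrite (ord1 i0); case: (unliftP ord0 i) => [j ->|->].
  by rewrite !cons_rVS; case: yw => _; apply.
by rewrite !cons_rV0; exact: ballxx.
Qed.

Lemma continuous_cons_rVl n (y : 'rV[K]_n) : continuous (fun x : K => cons_rV (x, y)).
Proof.
move=> x; apply/cvg_ballP => e e0; apply: (@filterS _ (nbhs x) (nbhs_filter x) (ball x e) _ _ (nbhsx_ballx x e e0)) => w xw.
split=> // i0 i; rewrite (ord1 i0); case: (unliftP ord0 i) => [j ->|->].
  by rewrite !cons_rVS; exact: ballxx.
by rewrite !cons_rV0.
Qed.

Lemma bounded_bounded_support n (f : 'rV[K]_n -> K) (M : K) : continuous f ->
  (forall x, f x != 0 -> forall j, `|x ord0 j| <= M) ->
  exists C, forall x, `|f x| <= C.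
Proof.
move=> cf sf; pose B := [set x : 'rV[K]_n | forall i, `[-M, M]%classic (x ord0 i)].
have cB : compact B := @rV_compact K n (fun=> `[-M, M]%classic) (fun=> @segment_compact K _ _).
have /compact_bounded [C [_ CB]] : compact (f @` B).
  by apply: continuous_compact => //; exact: continuous_subspaceT.
exists (`|C| + 1) => x; have [->|fx0] := eqVneq (f x) 0.
  by rewrite normr0 addr_ge0.
apply: (CB (`|C| + 1)); first by rewrite ltr_pwDr// ler_norm.
by exists x => // i /=; rewrite in_itv/= -ler_norml; exact: sf.
Qed.

Lemma integrable_bounded_support n (f : 'rV[K]_n -> K) (M : K) : continuous f ->
  (forall x, f x != 0 -> forall j, `|x ord0 j| <= M) ->
  (lebesgue_rV n).-integrable setT (EFin \o f).
Proof.
move=> cf sf; have [C fC] := bounded_bounded_support cf sf.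
pose B := [set x : 'rV[K]_n | forall i, x ord0 i \in `[-`|M|, `|M|]].
have mB : measurable B by exact: measurable_box.
apply: (@le_integrable _ _ _ _ _ measurableT _ (EFin \o (fun x => C * \1_B x))).
- by apply/measurable_EFinP; exact: continuous_measurable_rV.
- move=> x _ /=; rewrite lee_fin indicE.
  have [->|fx0] := eqVneq (f x) 0; first by rewrite normr0.
  rewrite mem_set ?mulr1.
    by rewrite (le_trans (fC x))// ler_norm.
  by move=> i; rewrite in_itv/= -ler_norml (le_trans (sf _ fx0 i))// ler_norm.
rewrite (_ : _ \o _ = (fun x => C%:E * (\1_B x)%:E)%E)//.
apply: integrableZl => //; apply/integrableP; split.
  by apply/measurable_EFinP.
under eq_integral do rewrite /= ger0_norm//.
rewrite integral_indic// setIT.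
by rewrite [X in (X < _)%E]lebesgue_rV_box ?ltry// => i; rewrite ge0_cp.
Qed.

Lemma partial_eq0 n (psi : 'rV[K]_n -> K) (i : 'I_n) x :
  (\forall y \near x, psi y = 0) -> partial i psi x = 0.
Proof.
move=> nx; rewrite /partial /derive; apply/cvg_lim => //.
apply: (cvg_trans (near_eq_cvg _)); last exact: cvg_cst.
near=> h => /=.
have -> : psi x = 0 by exact: nbhs_singleton nx.
rewrite subr0 (_ : psi _ = 0) ?scaler0//.
near: h; apply: nbhs_dnbhs.
exact: (cvg_line _ nx).
Unshelve. all: by end_near. Qed.

Lemma derive_cons_rVS n (psi : 'rV[K]_n.+1 -> K) (x : K) (y : 'rV[K]_n) (j : 'I_n) :
  (fun h : K => h^-1 *: (psi (cons_rV (x, h *: delta_mx ord0 j + y)) - psi (cons_rV (x, y)))) =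
  (fun h : K => h^-1 *: (psi (h *: delta_mx ord0 (lift ord0 j) + cons_rV (x, y)) - psi (cons_rV (x, y)))).
Proof.
apply/funext => h; congr (_ *: (psi _ - _)).
apply/rowP => i; rewrite [RHS]mxE; case: (unliftP ord0 i) => [k ->|->].
  by rewrite !cons_rVS /= !mxE (inj_eq (@lift_inj _ ord0)).
by rewrite !cons_rV0 /= !mxE eqxx/= mulr0 add0r.
Qed.

Lemma derive_cons_rV0 n (psi : 'rV[K]_n.+1 -> K) (x : K) (y : 'rV[K]_n) :
  (fun h : K => h^-1 *: (psi (cons_rV (h *: 1 + x, y)) - psi (cons_rV (x, y)))) =
  (fun h : K => h^-1 *: (psi (h *: delta_mx ord0 ord0 + cons_rV (x, y)) - psi (cons_rV (x, y)))).
Proof.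
apply/funext => h; congr (_ *: (psi _ - _)).
apply/rowP => i; rewrite [RHS]mxE; case: (unliftP ord0 i) => [k ->|->].
  by rewrite !cons_rVS /= !mxE /= mulr0 add0r.
by rewrite !cons_rV0 /= !mxE eqxx/=.
Qed.

(** The fundamental theorem of calculus on an interval beyond the support. *)
Lemma integral_derive1_eq0 (g : K -> K) (M : K) :
  (forall x, derivable g x 1) -> continuous (derive1 g) ->
  (forall x, g x != 0 -> `|x| <= M) ->
  (\int[lebesgue_measure]_x (derive1 g x)%:E = 0)%E.
Proof.
move=> dg cg sg.
pose A : K := `|M| + 1.
have A0 : 0 < A by rewrite ltr_wpDl.
have g0 x : A <= `|x| -> g x = 0.
  move=> Ax; apply: contraTeq Ax => /sg xM; rewrite -ltNge.
  by rewrite (le_lt_trans xM)// (le_lt_trans (ler_norm _))// ltrDl.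
have g'0 x : x \notin `[- A, A]%R -> derive1 g x = 0.
  move=> Ax; rewrite derive1E /derive; apply/cvg_lim => //.
  apply: (cvg_trans (near_eq_cvg _)); last exact: cvg_cst.
  have xA : A < `|x| by rewrite ltNge ler_norml; apply: contra Ax; rewrite in_itv.
  have d0 : 0 < `|x| - A by rewrite subr_gt0.
  near=> h => /=.
  rewrite !g0 ?subr0 ?scaler0 ?ltW//.
  have hd : `|h| < `|x| - A.
    by near: h; exact: dnbhs0_lt.
  have := ler_normB (h *: 1 + x) (h *: 1).
  rewrite [h *: 1 + x]addrC addrK /GRing.scale /= mulr1 => ?; lra.
have AA : - A < A by lra.
transitivity (\int[lebesgue_measure]_(x in [set` `[- A, A]%R]) (derive1 g x)%:E)%E.
  rewrite [RHS]integral_mkcond; apply: eq_integral => x _.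
  rewrite patchE; case: ifPn => //; rewrite notin_setE => /negP /g'0 ->//.
rewrite (@continuous_FTC2 K (derive1 g) g)//.
- by rewrite !g0 ?normrN ?ger0_norm ?subee// ltW.
- exact: continuous_subspaceT.
have cgg x : {for x, continuous g}.
  exact/differentiable_continuous/derivable1_diffP.
split.
- by move=> x _; exact: dg.
- by apply: cvg_at_right_filter; exact: cgg.
- by apply: cvg_at_left_filter; exact: cgg.
Unshelve. all: by end_near. Qed.

(** By Fubini, the variable along which psi is differentiated can be integrated
    first, which gives 0.  The measure splits off the first coordinate, so this is
    the case of the first variable; the other ones are the induction
    hypothesis applied to the sections of psi. *)
Lemma integral_partial n (psi : 'rV[K]_n -> K) (i : 'I_n) (M : K) :
  (forall x, derivable psi x (delta_mx ord0 i)) -> continuous (partial i psi) ->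
  (forall x, psi x != 0 -> forall j, `|x ord0 j| <= M) ->
  (\int[lebesgue_rV n]_x (partial i psi x)%:E = 0)%E.
Proof.
elim: n psi i => [|n IH] psi i dpsi cpsi spsi; first by case: (i) => [[]].
have sp x : partial i psi x != 0 -> forall j, `|x ord0 j| <= M.
  apply: contraPP => /existsNP[j /negP]; rewrite -ltNge => xjM /eqP; apply.
  apply: partial_eq0.
  have cj : {for x, continuous (fun y : 'rV[K]_n.+1 => `|y ord0 j|)}.
    apply: (@continuous_comp _ _ _ (fun y : 'rV[K]_n.+1 => y ord0 j) Num.norm).
      exact: coord_continuous.
    exact: norm_continuous.
  have Mn : nbhs x (fun y : 'rV[K]_n.+1 => M < `|y ord0 j|) := cvgr_gt _ cj _ xjM.
  near=> y; apply/eqP; apply: contraT => /spsi/(_ j); rewrite leNgt => /negP; case.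
  near: y; exact: Mn.
pose f := partial i psi.
have intf : (lebesgue_measure \x lebesgue_rV n)%E.-integrable setT
    ((EFin \o f) \o @cons_rV K n).
  have := integrable_bounded_support cpsi sp => /integrableP[mf]; rewrite /= /lebesgue_rV_step.
  rewrite ge0_integral_pushforward //.
    move=> oof; apply/integrableP; split => //.
    by apply: (measurableT_comp mf); exact: measurable_cons_rV.
  - exact: measurable_cons_rV.
  - exact: (measurableT_comp (@abse_measurable K setT) mf).
rewrite -[LHS]/(\int[pushforward (lebesgue_measure \x lebesgue_rV n)%E (@cons_rV K n)]_(y in setT) (EFin \o f) y)%E.
rewrite (integral_pushforward (@measurable_cons_rV K n) _ _)//=; last by apply/measurable_EFinP; exact: continuous_measurable_rV.
case: (unliftP ord0 i) => [j ij|i0].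
- rewrite -integral12_prod_meas1//.
  apply: integral0_eq => x _; rewrite /fubini_F /=.
  pose psix := fun y => psi (cons_rV (x, y)).
  transitivity (\int[lebesgue_rV n]_y (partial j psix y)%:E)%E.
    apply: eq_integral => y _; congr EFin.
    by rewrite /f /partial /derive /psix derive_cons_rVS -ij.
  apply: IH.
  - move=> y; rewrite /derivable /psix derive_cons_rVS -ij; exact: dpsi.
  - rewrite (_ : partial j psix = fun y => f (cons_rV (x, y))).
      move=> y; apply: (@continuous_comp _ _ _ (fun y => cons_rV (x, y)) f); last exact: cpsi.
      exact: continuous_cons_rVr.
    by apply/funext => y; rewrite /f /partial /derive /psix derive_cons_rVS -ij.
  - by move=> y /spsi yM k; have := yM (lift ord0 k); rewrite cons_rVS.
- rewrite -integral21_prod_meas1//.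
  apply: integral0_eq => y _; rewrite /fubini_G /=.
  pose g := fun x => psi (cons_rV (x, y)).
  have gE : derive1 g = fun x => f (cons_rV (x, y)).
    by apply/funext => x; rewrite derive1E /f /partial /derive /g derive_cons_rV0 -i0.
  transitivity (\int[lebesgue_measure]_x (derive1 g x)%:E)%E.
    by apply: eq_integral => x _; rewrite gE.
  apply: (@integral_derive1_eq0 _ M).
  - move=> x; rewrite /derivable /g derive_cons_rV0 -i0; exact: dpsi.
  - rewrite gE => x; apply: (@continuous_comp _ _ _ (fun x => cons_rV (x, y)) f); last exact: cpsi.
    exact: continuous_cons_rVl.
  - by move=> x /spsi xM; have := xM ord0; rewrite cons_rV0.
Unshelve. all: by end_near. Qed.

End ibp.

(** * Directional derivatives and integration by parts *)

Section derive_tools.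
Context {K : realType}.

(** Directional derivatives are derivatives of restrictions to lines, which
    gives access to the chain rule in one variable. *)
Lemma is_derive_line (V : normedModType K) (f : V -> K) (x v : V) (d : K) :
  is_derive x v f d <-> is_derive (0 : K) 1 (fun h : K => f (h *: v + x)) d.
Proof.
have E : (fun h : K => h^-1 *: ((f \o shift x) (h *: v) - f x)) =
  (fun h : K => h^-1 *: (((fun h : K => f (h *: v + x)) \o shift 0) (h *: 1) -
     (fun h : K => f (h *: v + x)) 0)).
  by apply/funext => h /=; rewrite scale0r add0r addr0 /GRing.scale /= mulr1.
split=> -[ex de]; split; move: ex de; rewrite /derivable /derive E//.
Qed.

Lemma is_derive_comp (V : normedModType K) (f : V -> K) (g : K -> K) (x v : V) (a d : K) :
  is_derive (f x) 1 g a -> is_derive x v f d -> is_derive x v (g \o f) (a * d).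
Proof.
move=> dg /is_derive_line df; apply/is_derive_line.
apply: (@is_derive1_comp _ g (fun h : K => f (h *: v + x))) => //.
by rewrite scale0r add0r.
Qed.

Lemma is_deriveXfun n (V : normedModType K) (f : V -> K) (x v : V) (d : K) :
  is_derive x v f d -> is_derive x v (fun y => f y ^+ n.+1) (n.+1%:R * f x ^+ n * d).
Proof.
move=> df; have -> : (fun y => f y ^+ n.+1) = f ^+ n.+1.
  by apply/funext => y; rewrite fctE.
exact: is_deriveX.
Qed.

Lemma is_deriveMfun (V : normedModType K) (f g : V -> K) (x v : V) (a b : K) :
  is_derive x v f a -> is_derive x v g b ->
  is_derive x v (fun y => f y * g y) (a * g x + f x * b).
Proof.
move=> df dg; have := is_deriveM df dg.
by rewrite /GRing.scale /= addrC (mulrC (g x)).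
Qed.

Lemma is_deriveDfun (V : normedModType K) (f g : V -> K) (x v : V) (a b : K) :
  is_derive x v f a -> is_derive x v g b ->
  is_derive x v (fun y => f y + g y) (a + b).
Proof. exact: is_deriveD. Qed.

Lemma is_deriveZfun (V : normedModType K) (f : V -> K) (k : K) (x v : V) (a : K) :
  is_derive x v f a -> is_derive x v (fun y => k * f y) (k * a).
Proof. exact: is_deriveZ. Qed.

(** The exponent is at least 2, which makes the power of the absolute value
    differentiable at 0 too. *)
Lemma is_derive_norm_exp n (y : K) :
  is_derive y 1 (fun y : K => `|y| ^+ n.+2) (n.+2%:R * `|y| ^+ n * y).
Proof.
have [y0|y0|->] := ltgtP y 0.
- apply: (@near_eq_is_derive _ _ _ (fun z : K => (- z) ^+ n.+2)).
    near=> z; rewrite ltr0_norm//; near: z; exact: lt_nbhsl.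
  apply: is_derive_eq (is_deriveXfun n.+1 (is_deriveN (is_derive_id y 1))) _.
  by rewrite ltr0_norm// (_ : (- id) y = - y)// exprS; ring.
- apply: (@near_eq_is_derive _ _ _ (fun z : K => z ^+ n.+2)).
    near=> z; rewrite gtr0_norm//; near: z; exact: lt_nbhsr.
  apply: is_derive_eq (is_deriveXfun n.+1 (is_derive_id y 1)) _.
  by rewrite gtr0_norm// exprS; ring.
- have H : (fun h : K => h^-1 *: (((fun z : K => `|z| ^+ n.+2) \o shift 0) (h *: 1) -
     `|0 : K| ^+ n.+2)) @ 0^' --> (0 : K).
    have c0 : (fun h : K => h * `|h| ^+ n) @ 0^' --> (0 : K).
      apply: cvg_within_filter.
      have c1 : {for 0, continuous (fun h : K => h * `|h| ^+ n)}.
        have cn : {for 0, continuous (fun h : K => `|h| ^+ n)}.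
          apply: (@continuous_comp K K K Num.norm (fun z : K => z ^+ n)).
            exact: norm_continuous.
          exact: exprn_continuous.
        by apply: continuousM => //; exact: cvg_id.
      by move: c1; rewrite /prop_for /continuous_at /= mul0r.
    apply: cvg_trans c0; apply: near_eq_cvg; near=> h => /=.
    have h0 : h != 0 by near: h; exact: nbhs_dnbhs_neq.
    rewrite normr0 expr0n subr0 addr0 /GRing.scale /= mulr1.
    rewrite (_ : `|h| ^+ n.+2 = h * (h * `|h| ^+ n)) ?mulKf//.
    by rewrite -addn2 exprD real_normK ?num_real//; ring.
  split; first by apply/cvg_ex; exists 0.
  by rewrite mulr0; exact/cvg_lim.
Unshelve. all: by end_near. Qed.

(** The domain is an abstract topological space so that unification does not
    unfold the topology of the space of row vectors to which these apply. *)

Section pointwise_continuity.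
Context {T : topologicalType}.
Implicit Types (f g : T -> K) (x : T).

Lemma cont_cst (a : K) x : {for x, continuous (fun _ : T => a)}.
Proof. exact: cvg_cst. Qed.

Lemma cont_add f g x : {for x, continuous f} -> {for x, continuous g} ->
  {for x, continuous (fun y => f y + g y)}.
Proof. exact: continuousD. Qed.

Lemma cont_mul f g x : {for x, continuous f} -> {for x, continuous g} ->
  {for x, continuous (fun y => f y * g y)}.
Proof. exact: continuousM. Qed.

Lemma cont_comp f (h : K -> K) x : {for x, continuous f} -> {for f x, continuous h} ->
  {for x, continuous (fun y => h (f y))}.
Proof. exact: continuous_comp. Qed.

Lemma cont_exp f n x : {for x, continuous f} -> {for x, continuous (fun y => f y ^+ n)}.
Proof. by move=> cf; apply: (@cont_comp f (fun z => z ^+ n)) => //; exact: exprn_continuous. Qed.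

Lemma cont_normr f x : {for x, continuous f} -> {for x, continuous (fun y => `|f y|)}.
Proof. by move=> cf; apply: (@cont_comp f Num.norm) => //; exact: norm_continuous. Qed.

Lemma cont_inv f x : f x != 0 -> {for x, continuous f} ->
  {for x, continuous (fun y => (f y)^-1)}.
Proof. by move=> fx cf; exact: continuousV. Qed.

Lemma near0_continuous f x : (\forall y \near x, f y = 0) -> {for x, continuous f}.
Proof.
move=> fx; have fx0 : f x = 0 := nbhs_singleton fx.
rewrite /prop_for /continuous_at fx0; apply: (cvg_trans _ (@cvg_cst _ (0 : K) _ (nbhs x) _)).
by apply: near_eq_cvg; apply: filterS fx => y ->.
Qed.

End pointwise_continuity.

Lemma near_notin_support m (phi : 'rV[K]_m -> K) x :
  ~ Defs.support phi x -> \forall y \near x, phi y = 0.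
Proof.
move=> nx; have oC : open (~` Defs.support phi) by apply: closed_openC; exact: closed_closure.
have nxC : nbhs x (~` Defs.support phi) by apply: open_nbhs_nbhs; split.
apply: filterS nxC => y ny; apply/eqP; apply: contrapT => /negP py.
by apply: ny; exact: subset_closure.
Qed.

Lemma support_box m (phi : 'rV[K]_m -> K) : compact (Defs.support phi) ->
  exists M : K, forall x, Defs.support phi x -> forall j, `|x ord0 j| <= M.
Proof.
move=> /compact_bounded[M [_ HM]]; exists (`|M| + 1) => x sx j.
have xM : `|x| <= `|M| + 1 by apply: HM => //; rewrite ltr_pwDr// ler_norm.
exact: le_trans (coord_le_norm x j) xM.
Qed.

(** Integration by parts of |phi|^N against one component F of a vector
    field: f is the partial derivative of |phi|^N F.  The field has to be
    regular on the support of phi only, since the product vanishes near any other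
    point. *)
Lemma integral_weighted_divergence n m (phi F dF : 'rV[K]_m -> K) (i : 'I_m) :
  smooth phi -> compact (Defs.support phi) ->
  (forall x, Defs.support phi x -> [/\ is_derive x (delta_mx ord0 i) F (dF x),
     {for x, continuous F} & {for x, continuous dF}]) ->
  let f x := n.+2%:R * `|phi x| ^+ n * phi x * partial i phi x * F x +
     `|phi x| ^+ n.+2 * dF x in
  (lebesgue_rV m).-integrable setT (EFin \o f) /\
  (\int[lebesgue_rV m]_x (f x)%:E = 0)%E.
Proof.
move=> sphi cphi hF f.
have [M HM] := support_box cphi.
have cp : continuous phi by have [] := sphi [::].
have dp x : derivable phi x (delta_mx ord0 i) by have [_] := sphi [::]; apply.
have cdp : continuous (partial i phi) by have [] := sphi [:: i].
have f0 x : phi x = 0 -> f x = 0.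
  by move=> p0; rewrite /f p0 normr0 [0 ^+ n.+2]exprS !(mulr0, mul0r) addr0.
pose psi x := `|phi x| ^+ n.+2 * F x.
have dpsi x : is_derive x (delta_mx ord0 i) psi (f x).
  have [/hF[dF' _ _]|/near_notin_support nx] := pselect (Defs.support phi x).
    apply: is_deriveMfun => //.
    apply: (is_derive_comp (f := phi) (is_derive_norm_exp n (phi x))).
    by split.
  rewrite f0; last exact: nbhs_singleton nx.
  have d0 : is_derive x (delta_mx ord0 i : 'rV[K]_m) (cst (0 : K)) 0 by exact: is_derive_cst.
  apply: near_eq_is_derive d0.
  by apply: filterS nx => y py; rewrite /psi py normr0 exprS !mul0r.
have pf : partial i psi = f.
  by apply/funext => x; rewrite /partial; have [] := dpsi x.
pose T : topologicalType := 'rV[K]_m.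
have cf : continuous f.
  move=> x; have [/hF[_ cF cdF]|/near_notin_support nx] := pselect (Defs.support phi x).
    have cn k : {for x, continuous (fun y => `|phi y| ^+ k)}.
      by apply: cont_exp; apply: cont_normr; exact: cp.
    apply: (@cont_add T); last by apply: (@cont_mul T); [exact: cn|exact: cdF].
    apply: (@cont_mul T); last exact: cF.
    apply: (@cont_mul T); last exact: cdp.
    apply: (@cont_mul T); last exact: cp.
    by apply: (@cont_mul T); [exact: cont_cst|exact: cn].
  by apply: near0_continuous; apply: filterS nx => y py; exact: f0.
have supp0 x : phi x != 0 -> Defs.support phi x by move=> px; exact: subset_closure.
have fM x : f x != 0 -> forall j, `|x ord0 j| <= M.
  move=> fx; apply: HM; apply: supp0; apply: contra fx => /eqP px; exact/eqP/f0.
split; first exact: integrable_bounded_support fM.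
rewrite -pf; apply: (@integral_partial _ _ _ _ M).
- by move=> x; have [] := dpsi x.
- by rewrite pf.
- move=> x px; apply: HM; apply: supp0; apply: contra px => /eqP px.
  by rewrite /psi px normr0 exprS !mul0r.
Qed.

End derive_tools.

(** * The radial profile of the vector field *)

Section profile.
Context {K : realType}.
Variables (n : nat) (R q : K).
Hypotheses (R0 : 0 < R) (q0 : 0 < q).

(** The dimension N is n + 2.  Everything is expressed in the variable s = |x|^2
    and regularized by q > 0: with
    t = 1 + log (R^2 + q) / 2 - log (s + q) / 2, which is 1 + log (R / |x|) at
    q = 0, [reg_invlog] is 1/t, [reg_invrad] is 1/|x| regularized, and [slope] is
    the logarithmic derivative in t of the perturbed virtual extremizer
    t^((N-1)/N) exp (- 1/(N t)).  The vector field is x times [field_coef]. *)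
Definition hardy_ratio : K := n.+1%:R / n.+2%:R.
Definition reg_invlog (s : K) : K := (1 + ln (R ^+ 2 + q) / 2 - ln (s + q) / 2)^-1.
Definition reg_invrad (s : K) : K := expR (- (ln (s + q) / 2)).
Definition slope (s : K) : K := hardy_ratio * (reg_invlog s + reg_invlog s ^+ 2 / n.+1%:R).
(** The derivative of [slope] with respect to -t. *)
Definition dslope (s : K) : K := hardy_ratio * (1 + 2 * reg_invlog s / n.+1%:R) * reg_invlog s ^+ 2.
Definition field_coef (s : K) : K := slope s ^+ n.+1 * reg_invrad s ^+ n.+2.
(** The derivative of [field_coef] with respect to s. *)
Definition dfield_coef (s : K) : K := (2 * (s + q))^-1 * reg_invrad s ^+ n.+2 *
  (n.+1%:R * slope s ^+ n * dslope s - n.+2%:R * slope s ^+ n.+1).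

Let den_ge1 (s : K) : 0 <= s -> s <= R ^+ 2 -> 1 <= 1 + ln (R ^+ 2 + q) / 2 - ln (s + q) / 2.
Proof.
move=> s0 sR; have : ln (s + q) <= ln (R ^+ 2 + q).
  by rewrite ler_ln ?posrE ?lerD2r// ltr_wpDl// sqr_ge0.
lra.
Qed.

Lemma reg_invlog_itv (s : K) : 0 <= s -> s <= R ^+ 2 -> 0 < reg_invlog s <= 1.
Proof.
move=> s0 sR; have d1 := den_ge1 s0 sR.
have d0 := lt_le_trans ltr01 d1.
by rewrite invr_gt0 d0 /= invf_le1.
Qed.

Lemma hardy_ratio_gt0 : 0 < hardy_ratio.
Proof. by rewrite divr_gt0 ?ltr0n. Qed.

Lemma is_derive_lnq (s : K) : 0 < s + q -> is_derive s 1 (fun s : K => ln (s + q)) (s + q)^-1.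
Proof.
move=> sq.
have d1 : is_derive s (1 : K) (fun s : K => s + q) (1 + 0).
  exact: (is_deriveDfun (is_derive_id s (1 : K)) (is_derive_cst q s (1 : K))).
have : is_derive s 1 ((@ln K) \o (fun s : K => s + q)) ((s + q)^-1 * (1 + 0)).
  by apply: is_derive1_comp; first exact: is_derive1_ln.
by rewrite addr0 mulr1.
Qed.

Lemma is_derive_reg_invrad (s : K) : 0 < s + q -> is_derive s 1 reg_invrad (- (2 * (s + q))^-1 * reg_invrad s).
Proof.
move=> sq.
have d1 : is_derive s 1 (fun s : K => (- 2^-1) * ln (s + q)) ((- 2^-1) * (s + q)^-1).
  by apply: (is_deriveZfun (- 2^-1)); exact: is_derive_lnq.
have := is_derive1_comp (is_derive_expR _) d1.
rewrite (_ : expR \o _ = reg_invrad).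
  move=> d2; apply: is_derive_eq d2 _.
  rewrite /reg_invrad mulNr (mulrC 2^-1); field; lra.
by apply/funext => t; rewrite /= /reg_invrad mulNr mulrC.
Qed.

Lemma is_derive_reg_invlog (s : K) : 0 < s + q -> reg_invlog s != 0 ->
  is_derive s 1 reg_invlog (reg_invlog s ^+ 2 / (2 * (s + q))).
Proof.
move=> sq t0.
have d1 : is_derive s 1 (fun s : K => 1 + ln (R ^+ 2 + q) / 2 + (- 2^-1) * ln (s + q)) (0 + (- 2^-1) * (s + q)^-1).
  apply: is_deriveDfun.
  by apply: (is_deriveZfun (- 2^-1)); exact: is_derive_lnq.
have E t : 1 + ln (R ^+ 2 + q) / 2 + (- 2^-1) * ln (t + q) = (reg_invlog t)^-1.
  by rewrite /reg_invlog invrK mulNr (mulrC 2^-1).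
have f0 : 1 + ln (R ^+ 2 + q) / 2 + (- 2^-1) * ln (s + q) != 0 by rewrite E invr_eq0.
have := @is_deriveV K (fun s => 1 + ln (R ^+ 2 + q) / 2 + - 2^-1 * ln (s + q)) s _ 1 f0 d1.
rewrite (_ : (fun y => _ ^-1) = reg_invlog); last by apply/funext => t; rewrite E invrK.
rewrite E => d2; apply: is_derive_eq d2 _.
rewrite /GRing.scale /=; field; apply/andP; split; lra.
Qed.

Lemma is_derive_slope (s : K) : 0 < s + q -> reg_invlog s != 0 ->
  is_derive s 1 slope (dslope s / (2 * (s + q))).
Proof.
move=> sq t0; have dt := is_derive_reg_invlog sq t0.
have d1 : is_derive s 1 (fun s => hardy_ratio * (reg_invlog s + n.+1%:R^-1 * reg_invlog s ^+ 2))
    (hardy_ratio * (reg_invlog s ^+ 2 / (2 * (s + q)) + n.+1%:R^-1 * (2%:R * reg_invlog s ^+ 1 * (reg_invlog s ^+ 2 / (2 * (s + q)))))).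
  apply: (is_deriveZfun hardy_ratio); apply: is_deriveDfun => //.
  by apply: (is_deriveZfun n.+1%:R^-1); exact: is_deriveXfun.
rewrite (_ : slope = (fun s => hardy_ratio * (reg_invlog s + n.+1%:R^-1 * reg_invlog s ^+ 2))).
  apply: is_derive_eq d1 _; rewrite /dslope expr1.
  have : 0 < n.+1%:R :> K by rewrite ltr0n.
  by move: (n.+1%:R) => m m0; field; apply/andP; split; lra.
by apply/funext => t; rewrite /slope (mulrC n.+1%:R^-1).
Qed.

Lemma is_derive_field_coef (s : K) : 0 < s + q -> reg_invlog s != 0 -> is_derive s 1 field_coef (dfield_coef s).
Proof.
move=> sq t0.
have := is_deriveMfun (is_deriveXfun n (is_derive_slope sq t0))
  (is_deriveXfun n.+1 (is_derive_reg_invrad sq)).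
move=> d; apply: is_derive_eq d _; rewrite /dfield_coef (exprS (reg_invrad s)) (exprS (slope s)).
field; lra.
Qed.

Lemma derive_cont (f : K -> K) (x d : K) : is_derive x 1 f d -> {for x, continuous f}.
Proof. by case=> df _; exact/differentiable_continuous/derivable1_diffP. Qed.

Lemma continuous_dfield_coef (s : K) : 0 < s + q -> reg_invlog s != 0 -> {for s, continuous dfield_coef}.
Proof.
move=> sq t0.
have cr := derive_cont (is_derive_reg_invrad sq).
have ct := derive_cont (is_derive_reg_invlog sq t0).
have cp := derive_cont (is_derive_slope sq t0).
rewrite /dfield_coef; apply: cont_mul.
  apply: cont_mul; last exact: cont_exp.
  apply: cont_inv; first by rewrite mulf_neq0//; lra.
  by apply: cont_mul; [exact: cont_cst|apply: cont_add; [exact: cvg_id|exact: cont_cst]].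
apply: cont_add; last first.
  rewrite (_ : (fun y => - _) = (fun y => (- n.+2%:R) * slope y ^+ n.+1)); last first.
    by apply/funext => y; rewrite mulNr.
  by apply: cont_mul; [exact: cont_cst|exact: cont_exp].
apply: cont_mul.
  by apply: cont_mul; [exact: cont_cst|exact: cont_exp].
rewrite /dslope; apply: cont_mul; last exact: cont_exp.
apply: cont_mul; first exact: cont_cst.
apply: cont_add; first exact: cont_cst.
apply: cont_mul; last exact: cont_cst.
by apply: cont_mul; first exact: cont_cst.
Qed.

(** The right-hand side is the divergence of x times [field_coef].  Without
    regularization it would be the left-hand side, x / |x|^N being
    divergence-free; the regularization adds q / (s + q) times a quantity which is
    nonnegative because t >= 1 on the ball of radius R. *)
Lemma field_div_ge (s : K) : 0 <= s -> s <= R ^+ 2 ->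
  reg_invrad s ^+ n.+2 * (n.+1%:R * slope s ^+ n * dslope s) <= n.+2%:R * field_coef s + 2 * s * dfield_coef s.
Proof.
move=> s0 sR; have /andP[t0 t1] := reg_invlog_itv s0 sR.
have sq : 0 < s + q by rewrite ltr_wpDl.
have N1 : 0 < n.+1%:R :> K by rewrite ltr0n.
have N1' : 1 <= n.+1%:R :> K by rewrite ler1n.
have E : n.+2%:R = n.+1%:R + 1 :> K by rewrite -natr1.
have p0 : 0 <= slope s.
  by rewrite mulr_ge0 ?ltW ?hardy_ratio_gt0// addr_gt0// divr_gt0// exprn_gt0.
have H : n.+1%:R * dslope s <= n.+2%:R * slope s.
  rewrite /dslope /slope E; move: (reg_invlog s) (n.+1%:R) hardy_ratio (hardy_ratio_gt0) t0 t1 N1 N1' => t m g g0 t0 t1 m0 m1.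
  rewrite (_ : m * _ = g * t * (m * t + 2 * t ^+ 2)); last by field; lra.
  rewrite (_ : (m + 1) * _ = g * t * (m + 1 + t + t / m)); last by field; lra.
  rewrite ler_pM2l ?mulr_gt0//; have : 0 <= t / m by rewrite divr_ge0// ltW.
  have : m * t <= m by rewrite ler_piMr// ltW.
  have : t ^+ 2 <= t by rewrite expr2 ler_piMr// ltW.
  lra.
have th : s / (s + q) <= 1 by rewrite ler_pdivrMr// mul1r lerDl ltW.
rewrite -subr_ge0 (_ : _ - _ = (1 - s / (s + q)) * (reg_invrad s ^+ n.+2 * slope s ^+ n) *
   (n.+2%:R * slope s - n.+1%:R * dslope s)); last first.
  rewrite /field_coef /dfield_coef (exprS (slope s)); field; lra.
rewrite mulr_ge0//; last by rewrite subr_ge0.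
rewrite mulr_ge0// ?subr_ge0// mulr_ge0// exprn_ge0// expR_ge0//.
Qed.

(** With b = (N-1)/N (1/t + 1/((N-1) t^2)) for [slope] and y = 1/((N-1) t), the
    right-hand side is ((N-1)/N)^N t^(-N) (1 + y)^(N-2) (1 + 2 y - y / t).  The
    first order term 1/t of b alone would give ((N-1)/N)^N t^(-N); the second
    order term produces the gain y. *)
Lemma slope_riccati (s : K) : 0 <= s -> s <= R ^+ 2 ->
  hardy_ratio ^+ n.+2 * reg_invlog s ^+ n.+2 * (1 + reg_invlog s / n.+1%:R) <=
  n.+1%:R * slope s ^+ n * dslope s - n.+1%:R * slope s ^+ n.+2.
Proof.
move=> s0 sR; have /andP[t0 t1] := reg_invlog_itv s0 sR.
have N1 : 0 < n.+1%:R :> K by rewrite ltr0n.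
have E : n.+2%:R = n.+1%:R + 1 :> K by rewrite -natr1.
set t := reg_invlog s in t0 t1 *; set y := t / n.+1%:R.
have y0 : 0 <= y by rewrite divr_ge0// ltW.
have pE : slope s = hardy_ratio * t * (1 + y) by rewrite /slope -/t /y; field; lra.
have sE : dslope s = hardy_ratio * (1 + 2 * y) * t ^+ 2.
  by rewrite /dslope -/t /y; field; lra.
have mE : n.+1%:R = (hardy_ratio) * (n.+1%:R + 1) :> K by rewrite /hardy_ratio E; field; lra.
have yE : n.+1%:R * y = t by rewrite /y; field; lra.
have -> : n.+1%:R * slope s ^+ n * dslope s - n.+1%:R * slope s ^+ n.+2 =
   hardy_ratio ^+ n.+2 * t ^+ n.+2 * (1 + y) ^+ n * (1 + 2 * y - y * t).
  rewrite sE pE (_ : (_ * (1 + y)) ^+ n.+2 = (hardy_ratio * t * (1 + y)) ^+ n * (hardy_ratio * t * (1 + y)) ^+ 2); last first.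
    by rewrite -exprD addn2.
  rewrite -yE !exprMn !(exprS _ n.+1) !(exprS _ n) /hardy_ratio E; field; lra.
rewrite -(mulrA (hardy_ratio ^+ n.+2 * t ^+ n.+2)) ler_wpM2l//.
  by rewrite mulr_ge0// exprn_ge0// ltW// hardy_ratio_gt0.
apply: (@le_trans _ _ (1 + 2 * y - y * t)).
  have : y * t <= y by rewrite ler_piMr. lra.
have yt : y * t <= y by rewrite ler_piMr.
rewrite ler_peMl//; first lra.
by rewrite exprn_ege1//; lra.
Qed.

End profile.

(** * The regularized Hardy inequality for test functions *)

Section hardy_reg_test.
Context {K : realType}.

Lemma measurable_invr : measurable_fun [set: K] (fun x : K => x^-1).
Proof.
rewrite (_ : (fun x : K => x^-1) = (fun x => x * (x ^+ 2) `^ (-1))).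
  apply: measurable_funM => //.
  by apply: (measurableT_comp (measurable_powR (-1))); exact: exprn_measurable.
apply/funext => x; rewrite powR_inv1 ?sqr_ge0//.
have [->|x0] := eqVneq x 0; first by rewrite invr0 mul0r.
by field.
Qed.

(** Young's inequality with the exponents n + 1 and (n + 1)/n, proved by
    induction so that no real powers are involved. *)
Lemma young_exp n (a b : K) : 0 <= a -> 0 <= b ->
  n.+1%:R * a * b ^+ n <= a ^+ n.+1 + n%:R * b ^+ n.+1.
Proof.
move=> a0 b0; elim: n => [|n IH]; first by rewrite !expr1 expr0 mul0r addr0 mul1r mulr1.
rewrite -subr_ge0.
have -> : a ^+ n.+2 + n.+1%:R * b ^+ n.+2 - n.+2%:R * a * b ^+ n.+1 =
  a * (a ^+ n.+1 + n%:R * b ^+ n.+1 - n.+1%:R * a * b ^+ n) + n.+1%:R * b ^+ n * (a - b) ^+ 2.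
  rewrite -!natr1 !exprS; ring.
by rewrite addr_ge0// mulr_ge0 ?subr_ge0 ?sqr_ge0// mulr_ge0// exprn_ge0.
Qed.

(** The sum of the squares of the coordinates of |d| x - |x| d is
    2 |x| |d| (|x| |d| - x.d). *)
Lemma cauchy_schwarz m (x d : 'rV[K]_m) :
  `|\sum_i x ord0 i * d ord0 i| <= enorm x * enorm d.
Proof.
have H (y : 'rV[K]_m) : \sum_i y ord0 i * d ord0 i <= enorm y * enorm d.
  have [y0|y0] := eqVneq (enorm y) 0.
    rewrite y0 mul0r; move/eqP: y0; rewrite enorm_eq0 => /eqP ->.
    by rewrite big1// => i _; rewrite mxE mul0r.
  have [d0|d0] := eqVneq (enorm d) 0.
    rewrite d0 mulr0; move/eqP: d0; rewrite enorm_eq0 => /eqP ->.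
    by rewrite big1// => i _; rewrite mxE mulr0.
  have ya : 0 < enorm y by rewrite lt_def y0 enorm_ge0.
  have da : 0 < enorm d by rewrite lt_def d0 enorm_ge0.
  have : 0 <= \sum_i (y ord0 i * enorm d - d ord0 i * enorm y) ^+ 2.
    by apply: sumr_ge0 => i _; exact: sqr_ge0.
  under eq_bigr do rewrite sqrrB !exprMn.
  rewrite big_split sumrB /= -!mulr_suml -!sqr_enorm.
  rewrite (_ : \sum_(i < m) _ *+ 2 = 2 * (enorm y * enorm d) * \sum_i y ord0 i * d ord0 i).
    move=> h; have : 0 <= 2 * (enorm y * enorm d) * (enorm y * enorm d - \sum_i y ord0 i * d ord0 i) by lra.
    by rewrite pmulr_rge0 ?subr_ge0// !mulr_gt0.
  rewrite mulr_sumr; apply: eq_bigr => i _; rewrite -mulr_natr; ring.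
rewrite ler_norml H andbT lerNl -sumrN.
have := H (- x); rewrite (_ : enorm (- x) = enorm x).
  by under eq_bigr do rewrite mxE mulNr.
by rewrite /enorm; under eq_bigr do rewrite mxE sqrrN.
Qed.

Lemma is_derive_coord m (x : 'rV[K]_m) (i j : 'I_m) :
  is_derive x (delta_mx ord0 i : 'rV[K]_m) (fun y : 'rV[K]_m => y ord0 j) (j == i)%:R.
Proof.
apply/is_derive_line.
have d1 : is_derive (0 : K) (1 : K) (fun h : K => (j == i)%:R * h + x ord0 j) ((j == i)%:R * 1 + 0).
  apply: is_deriveDfun; apply: is_deriveZfun.
rewrite (_ : (fun h : K => _) = (fun h : K => (j == i)%:R * h + x ord0 j)).
  by apply: is_derive_eq d1 _; rewrite mulr1 addr0.
by apply/funext => h; rewrite !mxE /= mulrC.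
Qed.

Lemma is_derive_sqr_enorm m (x : 'rV[K]_m) (i : 'I_m) :
  is_derive x (delta_mx ord0 i : 'rV[K]_m) (fun y : 'rV[K]_m => enorm y ^+ 2) (2 * x ord0 i).
Proof.
have d1 := is_derive_sum (fun j => is_deriveXfun 1 (is_derive_coord x i j)).
rewrite (_ : (fun y : 'rV[K]_m => enorm y ^+ 2) = \sum_(j < m) (fun y : 'rV[K]_m => y ord0 j ^+ 2)).
  apply: is_derive_eq d1 _; rewrite (bigD1 i)//= big1 ?addr0 ?eqxx ?mulr1//.
  by move=> j /negbTE ->; rewrite mulr0.
by apply/funext => y; rewrite sqr_enorm fct_sumE.
Qed.

Variables (n : nat) (R q : K).
Hypotheses (R0 : 0 < R) (q0 : 0 < q).
Local Notation N := n.+2.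

(** At q = 0 this is c V (1 + 1/((N-1) t)), which exceeds the Hardy weight by
    the gain of [slope_riccati]. *)
Definition reg_weight (x : 'rV[K]_N) : K :=
  hardy_ratio n ^+ N * (reg_invrad q (enorm x ^+ 2) * reg_invlog R q (enorm x ^+ 2)) ^+ N *
    (1 + reg_invlog R q (enorm x ^+ 2) / n.+1%:R).

Lemma is_derive_field (x : 'rV[K]_N) (i : 'I_N) : enorm x <= R ->
  is_derive x (delta_mx ord0 i : 'rV[K]_N)
   (fun y : 'rV[K]_N => y ord0 i * field_coef n R q (enorm y ^+ 2))
   (field_coef n R q (enorm x ^+ 2) + 2 * x ord0 i ^+ 2 * dfield_coef n R q (enorm x ^+ 2)).
Proof.
move=> xR; set s := enorm x ^+ 2.
have s0 : 0 <= s by exact: sqr_ge0.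
have sR : s <= R ^+ 2 by rewrite ler_pXn2r// ?nnegrE ?enorm_ge0// ltW.
have sq : 0 < s + q by rewrite ltr_wpDl.
have t0 : reg_invlog R q s != 0 by have /andP[/lt0r_neq0] := reg_invlog_itv q0 s0 sR.
have dh := is_derive_comp (f := fun y : 'rV[K]_N => enorm y ^+ 2) (is_derive_field_coef n sq t0) (is_derive_sqr_enorm x i).
apply: is_derive_eq (is_deriveMfun (is_derive_coord x i i) dh) _.
rewrite eqxx /= -/s; ring.
Qed.

Lemma reg_invrad_enorm (x : 'rV[K]_N) : enorm x * reg_invrad q (enorm x ^+ 2) <= 1.
Proof.
have sq : 0 < enorm x ^+ 2 + q by rewrite ltr_wpDl// sqr_ge0.
rewrite -(@ler_pXn2r _ 2)// ?nnegrE ?mulr_ge0 ?enorm_ge0 ?expR_ge0//.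
rewrite exprMn expr1n /reg_invrad -expRM_natl.
rewrite (_ : 2%:R * _ = - ln (enorm x ^+ 2 + q)); last by field.
rewrite expRN lnK ?posrE//.
by rewrite mulrC ler_pdivrMl// mulr1 lerDl ltW.
Qed.

Lemma continuous_sqr_enorm m : continuous (fun y : 'rV[K]_m => enorm y ^+ 2).
Proof.
by move=> x; apply: (@cont_exp K 'rV[K]_m); exact: enorm_continuous.
Qed.

Lemma continuous_field (x : 'rV[K]_N) (i : 'I_N) : enorm x <= R ->
  {for x, continuous (fun y : 'rV[K]_N => y ord0 i * field_coef n R q (enorm y ^+ 2))} /\
  {for x, continuous (fun y : 'rV[K]_N => field_coef n R q (enorm y ^+ 2) +
      2 * y ord0 i ^+ 2 * dfield_coef n R q (enorm y ^+ 2))}.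
Proof.
move=> xR; set s := enorm x ^+ 2.
have s0 : 0 <= s by exact: sqr_ge0.
have sR : s <= R ^+ 2 by rewrite ler_pXn2r// ?nnegrE ?enorm_ge0// ltW.
have sq : 0 < s + q by rewrite ltr_wpDl.
have t0 : reg_invlog R q s != 0 by have /andP[/lt0r_neq0] := reg_invlog_itv q0 s0 sR.
pose T : topologicalType := 'rV[K]_N.
have ch : {for x, continuous (fun y : T => field_coef n R q (enorm y ^+ 2))}.
  apply: (@cont_comp K T (fun y => enorm y ^+ 2) (field_coef n R q)).
    exact: continuous_sqr_enorm.
  exact: derive_cont (is_derive_field_coef n sq t0).
have cd : {for x, continuous (fun y : T => dfield_coef n R q (enorm y ^+ 2))}.
  apply: (@cont_comp K T (fun y => enorm y ^+ 2) (dfield_coef n R q)).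
    exact: continuous_sqr_enorm.
  exact: continuous_dfield_coef.
have cc : {for x, continuous (fun y : T => y ord0 i)} by exact: coord_continuous.
split; first by apply: (@cont_mul K T).
apply: (@cont_add K T) => //; apply: (@cont_mul K T) => //.
by apply: (@cont_mul K T); [exact: cont_cst|exact: (@cont_exp K T)].
Qed.

(** Here y and d stand for the value and the gradient of a function at x; the sum
    is then the divergence of |y|^N F.  Expanding it, Young's inequality bounds
    the term with d from below by - |d|^N - (N-1) (|y| b r)^N, where r is
    [reg_invrad], and what remains is [field_div_ge] and [slope_riccati]. *)
Lemma hardy_pointwise (x d : 'rV[K]_N) (y : K) : enorm x <= R ->
  reg_weight x * `|y| ^+ N <= enorm d ^+ N +
   \sum_i (N%:R * `|y| ^+ n * y * d ord0 i * (x ord0 i * field_coef n R q (enorm x ^+ 2)) +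
     `|y| ^+ N * (field_coef n R q (enorm x ^+ 2) + 2 * x ord0 i ^+ 2 * dfield_coef n R q (enorm x ^+ 2))).
Proof.
move=> xR; set s := enorm x ^+ 2.
have s0 : 0 <= s by exact: sqr_ge0.
have sR : s <= R ^+ 2 by rewrite ler_pXn2r// ?nnegrE ?enorm_ge0// ltW.
set g := field_coef n R q s; set g' := dfield_coef n R q s.
have -> : \sum_i (N%:R * `|y| ^+ n * y * d ord0 i * (x ord0 i * g) +
     `|y| ^+ N * (g + 2 * x ord0 i ^+ 2 * g')) =
   N%:R * `|y| ^+ n * y * g * (\sum_i x ord0 i * d ord0 i) + `|y| ^+ N * (N%:R * g + 2 * s * g').
  transitivity (\sum_i (N%:R * `|y| ^+ n * y * g * (x ord0 i * d ord0 i) +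
     (`|y| ^+ N * g + `|y| ^+ N * (2 * g') * x ord0 i ^+ 2))).
    by apply: eq_bigr => i _; ring.
  rewrite big_split big_split /= sumr_const card_ord -!mulr_sumr -sqr_enorm -/s -mulr_natl; ring.
have /andP[t0 t1] := reg_invlog_itv q0 s0 sR.
have r0 : 0 <= reg_invrad q s := expR_ge0 _.
have p0 : 0 <= slope n R q s.
  by rewrite mulr_ge0 ?ltW ?hardy_ratio_gt0// addr_gt0// divr_gt0// ?exprn_gt0// ltr0n.
have A0 := enorm_ge0 d.
set p := slope n R q s in p0 *; set r := reg_invrad q s in r0 *.
have gE : g = p ^+ n.+1 * r ^+ n.+2 by [].
have H2 := field_div_ge n q0 s0 sR; rewrite -/g -/g' -/p -/r in H2.
clearbody g.
have yp0 : 0 <= `|y| * p by exact: mulr_ge0.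
have ypr0 : 0 <= `|y| * p * r by exact: mulr_ge0.
have H1 : - (enorm d ^+ N + n.+1%:R * (`|y| * p * r) ^+ N) <=
    N%:R * `|y| ^+ n * y * g * (\sum_i x ord0 i * d ord0 i).
  rewrite lerNl; apply: le_trans (ler_norm _) _; rewrite normrN.
  apply: (@le_trans _ _ (N%:R * enorm d * (`|y| * p * r) ^+ n.+1)); last first.
    exact: young_exp.
  rewrite !normrM normr_nat normrX normr_id.
  rewrite (_ : `|g| = p ^+ n.+1 * r ^+ n.+1 * r); last first.
    have g0 : 0 <= g by rewrite gE; apply: mulr_ge0; exact: exprn_ge0.
    by rewrite ger0_norm// gE (exprSr r) mulrA.
  apply: (@le_trans _ _ (N%:R * `|y| ^+ n * `|y| * (p ^+ n.+1 * r ^+ n.+1 * r) * (enorm x * enorm d))).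
    apply: ler_wpM2l (cauchy_schwarz _ _).
    by do ![apply: mulr_ge0 => //]; exact: exprn_ge0.
  rewrite [leLHS](_ : _ = N%:R * enorm d * (`|y| * p * r) ^+ n.+1 * (enorm x * r)); last first.
    clearbody p r.
    rewrite !exprMn !(exprSr _ n); ring.
  apply: ler_piMr; last exact: reg_invrad_enorm.
  by do ![apply: mulr_ge0 => //]; exact: exprn_ge0.
have H3 := slope_riccati n q0 s0 sR; rewrite -/p in H3.
have rE : reg_invrad q s = r by [].
clearbody p r.
have H4 : reg_weight x * `|y| ^+ N <= `|y| ^+ N * (N%:R * g + 2 * s * g') - n.+1%:R * (`|y| * p * r) ^+ N.
  rewrite !exprMn (_ : _ - _ = `|y| ^+ N * (N%:R * g + 2 * s * g' - n.+1%:R * p ^+ N * r ^+ N)); last by ring.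
  rewrite mulrC ler_wpM2l ?exprn_ge0//.
  rewrite lerBrDr; apply: le_trans H2; rewrite -lerBrDr.
  rewrite (_ : _ - _ = r ^+ N * (n.+1%:R * p ^+ n * dslope n R q s - n.+1%:R * p ^+ N)); last by ring.
  rewrite /reg_weight -/s rE [leLHS](_ : _ = r ^+ N * (hardy_ratio n ^+ N * reg_invlog R q s ^+ N * (1 + reg_invlog R q s / n.+1%:R))).
    by rewrite ler_wpM2l// exprn_ge0.
  by rewrite (exprMn _ r); ring.
lra.
Qed.

Lemma reg_weight_ge0 (x : 'rV[K]_N) : enorm x <= R -> 0 <= reg_weight x.
Proof.
move=> xR; set s := enorm x ^+ 2.
have s0 : 0 <= s by exact: sqr_ge0.
have sR : s <= R ^+ 2 by rewrite ler_pXn2r// ?nnegrE ?enorm_ge0// ltW.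
have /andP[t0 t1] := reg_invlog_itv q0 s0 sR.
rewrite /reg_weight -/s; apply: mulr_ge0; last by rewrite addr_ge0// divr_ge0// ltW.
apply: mulr_ge0; apply: exprn_ge0; first exact/ltW/hardy_ratio_gt0.
by apply: mulr_ge0; [exact: expR_ge0|exact: ltW].
Qed.

End hardy_reg_test.

(** * The regularized Hardy inequality in the Sobolev space *)

Section hardy_sobolev.
Context {K : realType}.
Variables (n : nat) (R : K).
Hypotheses (R0 : 0 < R).
Local Notation N := n.+2.
Local Notation mu := (lebesgue_rV (K := K) N).

Lemma measurable_reg_weight (q : K) : measurable_fun [set: 'rV[K]_N] (@reg_weight K n R q).
Proof.
have ms : measurable_fun [set: 'rV[K]_N] (fun x : 'rV[K]_N => enorm x ^+ 2).
  by apply: continuous_measurable_rV; exact: continuous_sqr_enorm.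
have ml : measurable_fun [set: 'rV[K]_N] (fun x : 'rV[K]_N => ln (enorm x ^+ 2 + q) / 2).
  apply: measurable_funM => //; apply: (measurableT_comp (@measurable_ln K)).
  exact: measurable_funD.
have mt : measurable_fun [set: 'rV[K]_N] (fun x : 'rV[K]_N => reg_invlog R q (enorm x ^+ 2)).
  by apply: (measurableT_comp (@measurable_invr K)); exact: measurable_funB.
have mr : measurable_fun [set: 'rV[K]_N] (fun x : 'rV[K]_N => reg_invrad q (enorm x ^+ 2)).
  apply: (measurableT_comp (@measurable_expR K)).
  exact: measurable_funN.
apply: measurable_funM.
  by apply: measurable_funM => //; apply: measurable_funX; exact: measurable_funM.
by apply: measurable_funD => //; exact: measurable_funM.
Qed.

Lemma continuous_grad_exp (phi : 'rV[K]_N -> K) k : smooth phi ->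
  continuous (fun x => enorm (grad phi x) ^+ k).
Proof.
move=> sp; pose T : topologicalType := 'rV[K]_N.
have cf : continuous (fun x => \sum_i partial i phi x ^+ 2).
  apply: continuous_big => [|i _]; first exact: add_continuous.
  by move=> x; apply: (@cont_exp K T); have [cp _] := sp [:: i]; exact: cp.
move=> x; apply: (@cont_exp K T (fun y => enorm (grad phi y))).
rewrite (_ : (fun y => enorm (grad phi y)) = (fun y => Num.sqrt (\sum_i partial i phi y ^+ 2))).
  apply: (@cont_comp K T (fun y => \sum_i partial i phi y ^+ 2) Num.sqrt); first exact: cf.
  exact: sqrt_continuous.
by apply/funext => y; rewrite /enorm; congr Num.sqrt; apply: eq_bigr => i _; rewrite mxE.
Qed.

Lemma grad_eq0 (phi : 'rV[K]_N -> K) x : ~ Defs.support phi x -> enorm (grad phi x) = 0.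
Proof.
move=> /near_notin_support nx; apply/eqP; rewrite enorm_eq0; apply/eqP/rowP => i.
by rewrite !mxE; exact: partial_eq0.
Qed.

(** The divergence in [hardy_pointwise] has integral 0. *)
Lemma hardy_reg_test (Om : set 'rV[K]_N) (phi : 'rV[K]_N -> K) (q : K) : 0 < q ->
  measurable Om -> (forall x, Om x -> enorm x <= R) -> test_fun Om phi ->
  (\int[mu]_(x in Om) (reg_weight R q x * `|phi x| ^+ N)%:E <=
   \int[mu]_(x in Om) (enorm (grad phi x) ^+ N)%:E)%E.
Proof.
move=> q0 mOm OmR [sphi cphi phiOm].
have supp0 x : phi x != 0 -> Defs.support phi x by move=> px; exact: subset_closure.
pose f i x := N%:R * `|phi x| ^+ n * phi x * partial i phi x * (x ord0 i * field_coef n R q (enorm x ^+ 2)) +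
     `|phi x| ^+ N * (field_coef n R q (enorm x ^+ 2) + 2 * x ord0 i ^+ 2 * dfield_coef n R q (enorm x ^+ 2)).
have Hf i : mu.-integrable setT (EFin \o f i) /\ (\int[mu]_x (f i x)%:E = 0)%E.
  apply: integral_weighted_divergence => // x /phiOm/OmR xR.
  have [c1 c2] := continuous_field R0 q0 i xR.
  by split => //; exact: is_derive_field.
pose F x := \sum_i f i x.
have FE : (EFin \o F) = (fun x => \sum_i (EFin \o f i) x)%E.
  by apply/funext => x; rewrite /= /F -sumEFin.
have intF : mu.-integrable setT (EFin \o F).
  rewrite FE; apply: integrable_sum => // i _; exact: (Hf i).1.
have F0 : (\int[mu]_x (F x)%:E = 0)%E.
  transitivity (\int[mu]_x (\sum_i (EFin \o f i) x))%E.
    by apply: eq_integral => x _; rewrite -[LHS]/((EFin \o F) x) FE.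
  rewrite integral_sum//; last by move=> i; exact: (Hf i).1.
  by rewrite big1// => i _; exact: (Hf i).2.
pose G x := enorm (grad phi x) ^+ N.
have [M HM] := support_box cphi.
have intG : mu.-integrable setT (EFin \o G).
  apply: (@integrable_bounded_support _ _ _ M); first exact: continuous_grad_exp.
  move=> x Gx; apply: HM; apply: contrapT => /grad_eq0 g0.
  by move: Gx; rewrite /G g0 exprS mul0r eqxx.
have pw x : reg_weight R q x * `|phi x| ^+ N <= G x + F x.
  have [p0|/supp0/phiOm/OmR xR] := eqVneq (phi x) 0; last first.
    have := hardy_pointwise R0 q0 (grad phi x) (phi x) xR.
    rewrite /G /F /f; move/le_trans; apply; rewrite lerD2l.
    by apply: ler_sum => i _; rewrite mxE.
  rewrite p0 normr0 [0 ^+ N]exprS mul0r mulr0 /F big1 ?addr0 ?exprn_ge0 ?enorm_ge0//.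
  by move=> i _; rewrite /f p0 normr0 [0 ^+ N]exprS !(mulr0, mul0r) addr0.
have pos x : 0 <= reg_weight R q x * `|phi x| ^+ N.
  have [->|/supp0/phiOm/OmR xR] := eqVneq (phi x) 0.
    by rewrite normr0 [0 ^+ N]exprS mul0r mulr0.
  by rewrite mulr_ge0 ?exprn_ge0// reg_weight_ge0.
have cp : continuous phi by have [] := sphi [::].
have mW : measurable_fun [set: 'rV[K]_N] (EFin \o (fun x => reg_weight R q x * `|phi x| ^+ N)).
  apply/measurable_EFinP; apply: measurable_funM; first exact: measurable_reg_weight.
  apply: measurable_funX; apply: (measurableT_comp (@normr_measurable K setT)).
  exact: continuous_measurable_rV.
apply: (@le_trans _ _ (\int[mu]_x (reg_weight R q x * `|phi x| ^+ N)%:E)%E).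
  by apply: ge0_subset_integral => //= x _; rewrite lee_fin.
apply: (@le_trans _ _ (\int[mu]_x ((EFin \o G) x + (EFin \o F) x))%E).
  apply: ge0_le_integral => //.
  - by move=> x _; rewrite lee_fin.
  - by apply: emeasurable_funD; [case/integrableP: intG|case/integrableP: intF].
  - by move=> x _; rewrite /= -EFinD lee_fin.
rewrite integralD// F0 adde0.
rewrite [leRHS]integral_mkcond; rewrite le_eqVlt; apply/orP; left; apply/eqP; apply: eq_integral => x _.
rewrite patchE; case: ifPn => // /negP nOm; rewrite /= /G grad_eq0 ?exprS ?mul0r//.
by move=> /phiOm; apply: contra_not nOm => ?; rewrite inE.
Qed.

(** The factor of the first term can be taken arbitrarily close to 1, at the
    expense of the other one: this lets the sharp constant survive an
    approximation in norm. *)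
Lemma expD_le (lam : K) : 1 < lam -> exists2 C : K, 0 <= C &
  forall a b : K, 0 <= a -> 0 <= b -> (a + b) ^+ N <= lam * a ^+ N + C * b ^+ N.
Proof.
move=> lam1; (* If b <= (r - 1) a then a + b <= r a; otherwise a <= b / (r - 1). *)
pose r := lam `^ (N%:R^-1).
have r1 : 1 < r.
  rewrite /r -[ltLHS](_ : 1 `^ (N%:R^-1) = 1); last by rewrite powR1.
  by apply: gt0_ltr_powR => //; rewrite ?invr_gt0 ?ltr0n ?nnegrE ?ler01// ltW// (lt_trans ltr01).
have rN : r ^+ N = lam.
  by rewrite -powR_mulrn ?powR_ge0// -powRrM mulVf ?pnatr_eq0// powRr1// ltW// (lt_trans ltr01).
pose eta := r - 1; have eta0 : 0 < eta by rewrite subr_gt0.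
exists ((1 + eta^-1) ^+ N); first by rewrite exprn_ge0// addr_ge0// invr_ge0 ltW.
move=> a b a0 b0; rewrite -rN -!exprMn.
have [ba|ab] := leP b (eta * a).
  apply: (@le_trans _ _ ((r * a) ^+ N)).
    have ba' : a + b <= r * a by move: ba; rewrite /eta; lra.
    by apply: lerXn2r; rewrite ?nnegrE ?addr_ge0 ?mulr_ge0// (ltW (lt_trans ltr01 r1)).
  by rewrite lerDl exprn_ge0// mulr_ge0// addr_ge0// invr_ge0 ltW.
apply: (@le_trans _ _ (((1 + eta^-1) * b) ^+ N)).
  have : a <= eta^-1 * b by rewrite ler_pdivlMl// ltW.
  have e0 := ltW eta0.
  move=> ab'; apply: lerXn2r; rewrite ?nnegrE ?addr_ge0 ?mulr_ge0 ?addr_ge0 ?invr_ge0//.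
  by rewrite mulrDl mul1r addrC lerD2l.
by rewrite lerDr exprn_ge0// mulr_ge0// (ltW (lt_trans ltr01 r1)).
Qed.

Lemma enormD m (x y : 'rV[K]_m) : enorm (x + y) <= enorm x + enorm y.
Proof.
rewrite -(@ler_pXn2r _ 2)// ?nnegrE ?addr_ge0 ?enorm_ge0// sqr_enorm sqrrD !sqr_enorm.
under eq_bigr do rewrite mxE sqrrD.
rewrite !big_split /= lerD2r lerD2l -mulr2n lerMn2r /=.
exact: le_trans (ler_norm _) (cauchy_schwarz _ _).
Qed.

Lemma measurable_grad (phi : 'rV[K]_N -> K) : smooth phi ->
  measurable_fun [set: 'rV[K]_N] (grad phi).
Proof.
move=> sp; apply/measurable_fun_rVP => i; apply: continuous_measurable_rV.
rewrite (_ : (fun t => _) = partial i phi); first by have [] := sp [:: i].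
by apply/funext => x; rewrite mxE.
Qed.

Lemma measurable_fun_rVB m (Om : set 'rV[K]_m) (f g : 'rV[K]_m -> 'rV[K]_m) :
  measurable Om -> measurable_fun Om f -> measurable_fun Om g ->
  measurable_fun Om (fun x => f x - g x).
Proof.
move=> mOm mf mg.
have restr (h : 'rV[K]_m -> 'rV[K]_m) : measurable_fun Om h ->
    forall i, measurable_fun Om (fun x => h x ord0 i).
  by move=> mh i; exact: (measurableT_comp (measurable_coord i) mh).
apply/(measurable_restrictT _ mOm)/measurable_fun_rVP => i.
rewrite (_ : (fun t => _) = (fun x => f x ord0 i - g x ord0 i) \_ Om).
  by apply/(measurable_restrictT _ mOm); apply: measurable_funB; exact: restr.
by apply/funext => x; rewrite !patchE; case: ifP; rewrite !mxE.
Qed.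

Lemma sobolev0_approx (Om : set 'rV[K]_N) (u : 'rV[K]_N -> K) (Du : 'rV[K]_N -> 'rV[K]_N) (d : K) :
  sobolev0 Om N u Du -> 0 < d -> exists phi, [/\ test_fun Om phi,
   (\int[mu]_(x in Om) (`|phi x - u x| ^+ N)%:E <= d%:E)%E &
   (\int[mu]_(x in Om) (enorm (grad phi x - Du x) ^+ N)%:E <= d%:E)%E].
Proof.
move=> [_ [phi [tphi cphi]]] d0.
have dr0 : (0 < (d `^ N%:R^-1)%:E)%E by rewrite lte_fin powR_gt0.
have [k _ /(_ k (leqnn k)) /= Hk] := cphi _ (open_ereal_lt' dr0).
pose A := (\int[mu]_(x in Om) (`|phi k x - u x| ^+ N)%:E)%E.
pose B := (\int[mu]_(x in Om) (enorm (grad (phi k) x - Du x) ^+ N)%:E)%E.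
have A0 : (0 <= A)%E by apply: integral_ge0 => x _; rewrite lee_fin exprn_ge0.
have B0 : (0 <= B)%E by apply: integral_ge0 => x _; rewrite lee_fin exprn_ge0// enorm_ge0.
have AB : (A + B <= d%:E)%E.
  rewrite leNgt; apply/negP => dAB; move: Hk; apply/negP; rewrite -leNgt.
  rewrite -poweR_EFin /sobolev_norm -/A -/B; apply: gt0_ler_poweR.
  - by rewrite invr_ge0.
  - by rewrite in_itv /= leey andbT lee_fin ltW.
  - by rewrite in_itv /= leey andbT adde_ge0.
  - exact: ltW.
exists (phi k); split => //; apply: le_trans AB; rewrite -/A -/B.
- by rewrite leeDl.
- by rewrite leeDr.
Qed.

Lemma le_integral_comb (Om : set 'rV[K]_N) (a b : K) (f g h : 'rV[K]_N -> K) :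
  measurable Om -> 0 <= a -> 0 <= b ->
  measurable_fun Om f -> measurable_fun Om g -> measurable_fun Om h ->
  (forall x, Om x -> [/\ 0 <= f x, 0 <= g x, 0 <= h x & f x <= a * g x + b * h x]) ->
  (\int[mu]_(x in Om) (f x)%:E <= a%:E * \int[mu]_(x in Om) (g x)%:E +
     b%:E * \int[mu]_(x in Om) (h x)%:E)%E.
Proof.
move=> mOm a0 b0 mf mg mh H.
rewrite -!ge0_integralZl//;
  do ?[exact/measurable_EFinP|by move=> x /H[]; rewrite lee_fin].
rewrite -ge0_integralD//; first last.
- by apply: measurable_funeM; exact/measurable_EFinP.
- by move=> x /H[_ _ h0 _]; rewrite -EFinM lee_fin mulr_ge0.
- by apply: measurable_funeM; exact/measurable_EFinP.
- by move=> x /H[_ g0 _ _]; rewrite -EFinM lee_fin mulr_ge0.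
apply: ge0_le_integral => //.
- by move=> x /H[]; rewrite lee_fin.
- exact/measurable_EFinP.
- by apply: emeasurable_funD; apply: measurable_funeM; exact/measurable_EFinP.
- by move=> x /H[_ _ _]; rewrite -!EFinM -EFinD lee_fin.
Qed.

(** For q > 0 the weight is bounded, so that convergence in L^N is enough to pass
    to the limit in the weighted integral. *)
Lemma reg_weight_le (q : K) : 0 < q -> exists2 B : K, 0 <= B &
  forall x : 'rV[K]_N, enorm x <= R -> reg_weight R q x <= B.
Proof.
move=> q0; have g0 := ltW (hardy_ratio_gt0 (K := K) n).
have e0 := expR_ge0 (- (ln q / 2)).
exists (hardy_ratio n ^+ N * expR (- (ln q / 2)) ^+ N * 2).
  by rewrite mulr_ge0// mulr_ge0// exprn_ge0.
move=> x xR; set s := enorm x ^+ 2.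
have s0 : 0 <= s by exact: sqr_ge0.
have sR : s <= R ^+ 2 by rewrite ler_pXn2r// ?nnegrE ?enorm_ge0// ltW.
have /andP[t0 t1] := reg_invlog_itv q0 s0 sR.
have r0 : 0 <= reg_invrad q s := expR_ge0 _.
have t0' := ltW t0.
rewrite /reg_weight -/s; apply: ler_pM.
- by rewrite mulr_ge0// exprn_ge0// mulr_ge0.
- by rewrite addr_ge0// divr_ge0.
- rewrite ler_wpM2l ?exprn_ge0//; apply: lerXn2r; rewrite ?nnegrE ?mulr_ge0//.
  apply: (@le_trans _ _ (reg_invrad q s)); first by rewrite ler_piMr.
  rewrite /reg_invrad ler_expR lerN2 ler_pM2r// ler_ln ?posrE ?lerDr//.
  by rewrite ltr_wpDl.
- rewrite (_ : 2 = 1 + 1 :> K)// lerD2l ler_pdivrMr ?ltr0n// mul1r.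
  by apply: le_trans t1 _; rewrite ler1n.
Qed.

(** Approximating u by a test function within d, [expD_le] compares both sides
    with those of the test function up to a factor lam and an error proportional
    to d.  Let d, then lam - 1, tend to 0. *)
Lemma hardy_reg_sobolev0 (Om : set 'rV[K]_N) (u : 'rV[K]_N -> K) (Du : 'rV[K]_N -> 'rV[K]_N) (q : K) :
  0 < q -> measurable Om -> (forall x, Om x -> enorm x <= R) -> sobolev0 Om N u Du ->
  (\int[mu]_(x in Om) (reg_weight R q x * `|u x| ^+ N)%:E <=
   \int[mu]_(x in Om) (enorm (Du x) ^+ N)%:E)%E.
Proof.
move=> q0 mOm OmR su.
have [[mfu mDu _ _] _] := su.
have [B B0 HB] := reg_weight_le q0.
set I1 := (X in (X <= _)%E); set I2 := (X in (_ <= X)%E).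
have pos x : Om x -> 0 <= reg_weight R q x * `|u x| ^+ N.
  by move=> /OmR xR; rewrite mulr_ge0 ?exprn_ge0// reg_weight_ge0.
have I10 : (0 <= I1)%E by apply: integral_ge0 => x /pos; rewrite lee_fin.
have I20 : (0 <= I2)%E by apply: integral_ge0 => x _; rewrite lee_fin exprn_ge0// enorm_ge0.
apply/lee_mul01Pr => // r /andP[r0 r1].
pose lam := Num.sqrt (r^-1).
have ri1 : 1 < r^-1 by rewrite invf_gt1.
have lam1 : 1 < lam by rewrite -sqrtr1 ltr_sqrt// invr_gt0.
have lam2 : lam ^+ 2 = r^-1 by rewrite sqr_sqrtr// invr_ge0 ltW.
have lam0 : 0 <= lam := ltW (lt_trans ltr01 lam1).
have [C C0 HC] := expD_le lam1.
pose D := C * B + lam * C.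
have D0 : 0 <= D by rewrite addr_ge0// mulr_ge0.
suff H : (I1 <= (lam ^+ 2)%:E * I2)%E.
  by rewrite -(@lee_pdivlMl _ r)// -lam2.
apply/lee_addgt0Pr => e e0.
have d0 : 0 < e / (D + 1) by rewrite divr_gt0// ltr_wpDl.
have [phi [tphi phiu phiD]] := sobolev0_approx su d0.
have [sphi cphi _] := tphi.
have cp : continuous phi by have [] := sphi [::].
have mphi : measurable_fun Om phi.
  by apply: measurable_funTS; exact: continuous_measurable_rV.
have mgphi : measurable_fun Om (grad phi) by apply: measurable_funTS; exact: measurable_grad.
have mW : measurable_fun Om (reg_weight R q) by apply: measurable_funTS; exact: measurable_reg_weight.
have mnX (f : 'rV[K]_N -> K) : measurable_fun Om f -> measurable_fun Om (fun x => `|f x| ^+ N).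
  by move=> mf; apply: measurable_funX; exact: (measurableT_comp (@normr_measurable K setT)).
have meX (f : 'rV[K]_N -> 'rV[K]_N) : measurable_fun Om f -> measurable_fun Om (fun x => enorm (f x) ^+ N).
  by move=> mf; apply: measurable_funX; exact: (measurableT_comp (@measurable_enorm K N)).
have mdiff : measurable_fun Om (fun x => grad phi x - Du x) by exact: measurable_fun_rVB.
have S1 : (I1 <= lam%:E * \int[mu]_(x in Om) (reg_weight R q x * `|phi x| ^+ N)%:E +
    (C * B)%:E * \int[mu]_(x in Om) (`|phi x - u x| ^+ N)%:E)%E.
  apply: le_integral_comb => //; first exact: mulr_ge0.
  - by apply: measurable_funM => //; exact: mnX.
  - by apply: measurable_funM => //; exact: mnX.
  - by apply: mnX; exact: measurable_funB.
  - move=> x Omx; have xR := OmR _ Omx; have W0 := reg_weight_ge0 R0 q0 xR.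
    split; [exact: pos|by apply: mulr_ge0 => //; exact: exprn_ge0|exact: exprn_ge0|].
    have h := HC `|phi x| `|phi x - u x| (normr_ge0 _) (normr_ge0 _).
    have hu : `|u x| ^+ N <= (`|phi x| + `|phi x - u x|) ^+ N.
      apply: lerXn2r; rewrite ?nnegrE ?addr_ge0//.
      by rewrite -[X in `|X| <= _](subKr (phi x)) ler_normB.
    apply: (@le_trans _ _ (reg_weight R q x * (lam * `|phi x| ^+ N + C * `|phi x - u x| ^+ N))).
      by rewrite ler_wpM2l// (le_trans hu).
    rewrite mulrDr; apply: lerD; first by rewrite mulrCA.
    by rewrite [leLHS]mulrA ler_wpM2r ?exprn_ge0// mulrC ler_wpM2l//; exact: HB.
have S2 : (\int[mu]_(x in Om) (enorm (grad phi x) ^+ N)%:E <=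
    lam%:E * I2 + C%:E * \int[mu]_(x in Om) (enorm (grad phi x - Du x) ^+ N)%:E)%E.
  apply: le_integral_comb => //; [exact: meX|exact: meX|exact: meX|].
  move=> x Omx; split; rewrite ?exprn_ge0 ?enorm_ge0//.
  apply: le_trans (HC _ _ (enorm_ge0 _) (enorm_ge0 _)).
  apply: lerXn2r; rewrite ?nnegrE ?addr_ge0 ?enorm_ge0//.
  by apply: le_trans (enormD _ _); rewrite addrC subrK.
have S3 := hardy_reg_test q0 mOm OmR tphi.
apply: (le_trans S1).
apply: (@le_trans _ _ (lam%:E * (lam%:E * I2 + C%:E * (e / (D + 1))%:E) + (C * B)%:E * (e / (D + 1))%:E)%E).
  apply: leeD; last by apply: lee_wpmul2l => //; rewrite lee_fin mulr_ge0.
  apply: lee_wpmul2l => //; apply: le_trans S3 _; apply: le_trans S2 _.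
  by rewrite leeD2l//; apply: lee_wpmul2l.
have d0' := ltW d0.
rewrite ge0_muleDr; do ?[by apply: mule_ge0; rewrite ?lee_fin].
rewrite muleA -EFinM -expr2 -addeA leeD2l// -!EFinM -EFinD lee_fin.
rewrite [leLHS](_ : _ = D * (e / (D + 1))); last by rewrite /D; ring.
rewrite mulrA ler_pdivrMr ?ltr_wpDl//.
by rewrite mulrC ler_pM2l// lerDl.
Qed.

End hardy_sobolev.

(** * The Hardy inequality with an L^N remainder *)

Section improved_hardy.
Context {K : realType}.
Variables (n : nat) (R : K).
Hypotheses (R0 : 0 < R).
Local Notation N := n.+2.
Local Notation mu := (lebesgue_rV (K := K) N).

Lemma ln_enormE (x : 'rV[K]_N) : 0 < enorm x -> ln (enorm x ^+ 2 + 0) / 2 = ln (enorm x).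
Proof. by move=> x0; rewrite addr0 lnXn// mulr2n; field. Qed.

Lemma reg_invrad0E (x : 'rV[K]_N) : 0 < enorm x -> reg_invrad 0 (enorm x ^+ 2) = (enorm x)^-1.
Proof. by move=> x0; rewrite /reg_invrad ln_enormE// expRN lnK. Qed.

Lemma reg_invlog0E (x : 'rV[K]_N) : 0 < enorm x ->
  reg_invlog R 0 (enorm x ^+ 2) = (1 + ln (R / enorm x))^-1.
Proof.
move=> x0; rewrite /reg_invlog ln_enormE// addr0 lnXn// ln_div ?posrE//; congr (_^-1).
by rewrite mulr2n; field.
Qed.

Lemma one_plus_log_ge1 (e : K) : 0 < e -> e <= R -> 1 <= 1 + ln (R / e).
Proof. by move=> e0 eR; rewrite lerDl ln_ge0// ler_pdivlMr// mul1r. Qed.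

Lemma measurable_hardy_weightV : measurable_fun [set: 'rV[K]_N] (fun x : 'rV[K]_N => (hardy_weight R x)^-1).
Proof.
apply: (measurableT_comp (@measurable_invr K)); apply: measurable_funM.
  by apply: measurable_funX; exact: measurable_enorm.
apply: measurable_funX; apply: measurable_funD => //.
apply: (measurableT_comp (@measurable_ln K)); apply: measurable_funM => //.
by apply: (measurableT_comp (@measurable_invr K)); exact: measurable_enorm.
Qed.

Lemma hardy_weightV_ge0 (x : 'rV[K]_N) : enorm x <= R -> 0 <= (hardy_weight R x)^-1.
Proof.
move=> xR; rewrite invr_ge0 /hardy_weight; have [x0|x0] := eqVneq (enorm x) 0.
  by rewrite x0 exprS !mul0r.
have e0 : 0 < enorm x by rewrite lt_def x0 enorm_ge0.
apply: mulr_ge0; apply: exprn_ge0; first exact: ltW.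
exact: le_trans ler01 (one_plus_log_ge1 e0 xR).
Qed.

Lemma reg_weight_cvg (x : 'rV[K]_N) : 0 < enorm x -> enorm x <= R ->
  reg_weight R k.+1%:R^-1 x @[k --> \oo] --> reg_weight R 0 x.
Proof.
move=> x0 xR.
suff H : {for (0 : K), continuous (fun q => reg_weight R q x)}.
  exact: (cvg_comp _ _ (@cvg_harmonic K) H).
have s0 : 0 < enorm x ^+ 2 by rewrite exprn_gt0.
have cid : {for (0 : K), continuous (fun q : K => q)} by exact: cvg_id.
have clnq (a : K) : 0 < a -> {for (0 : K), continuous (fun q => ln (a + q) / 2)}.
  move=> a0; apply: cont_mul; last exact: cont_cst.
  apply: (@cont_comp K K (fun q => a + q) (@ln K)).
    by apply: cont_add => //; exact: cont_cst.
  by rewrite addr0; exact: continuous_ln.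
have cneg (f : K -> K) : {for 0, continuous f} -> {for 0, continuous (fun q => - f q)}.
  move=> cf; rewrite (_ : (fun q => - f q) = (fun q => (-1) * f q)).
    by apply: cont_mul => //; exact: cont_cst.
  by apply/funext => q; rewrite mulN1r.
have ct : {for (0 : K), continuous (fun q => reg_invlog R q (enorm x ^+ 2))}.
  apply: cont_inv.
    have := reg_invlog0E x0; rewrite /reg_invlog => /(congr1 GRing.inv); rewrite !invrK => ->.
    by rewrite gt_eqF// (lt_le_trans ltr01)// one_plus_log_ge1.
  apply: cont_add; last by apply: cneg; exact: clnq.
  by apply: cont_add; [exact: cont_cst|apply: clnq; rewrite exprn_gt0].
have cr : {for (0 : K), continuous (fun q => reg_invrad q (enorm x ^+ 2))}.
  apply: (@cont_comp K K (fun q => - (ln (enorm x ^+ 2 + q) / 2)) expR).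
    by apply: cneg; exact: clnq.
  exact: continuous_expR.
rewrite /reg_weight; apply: cont_mul.
  by apply: cont_mul; [exact: cont_cst|apply: cont_exp; exact: cont_mul].
by apply: cont_add; [exact: cont_cst|apply: cont_mul => //; exact: cont_cst].
Qed.

(** The gain V / t is 1 / (|x|^N t^(N+1)), and |x|^N t^(N+1) is bounded on the
    ball because t^(N+1) is at most a multiple of exp t = e R / |x|. *)
Lemma reg_weight0_ge : exists2 kap : K, 0 < kap & forall x : 'rV[K]_N, 0 < enorm x -> enorm x <= R ->
  hardy_ratio n ^+ N / hardy_weight R x + kap <= reg_weight R 0 x.
Proof.
(* t^(N+1) <= (N+1)^(N+1) exp t and exp t = e R / |x|, so that M bounds
   |x|^N t^(N+1). *)
pose M : K := N.+1%:R ^+ N.+1 * expR 1 * R ^+ N.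
have M0 : 0 < M by rewrite mulr_gt0 ?exprn_gt0// mulr_gt0 ?exprn_gt0 ?expR_gt0 ?ltr0n.
have g0 := hardy_ratio_gt0 (K := K) n.
exists (hardy_ratio n ^+ N / n.+1%:R / M); first by rewrite !divr_gt0 ?ltr0n ?exprn_gt0.
move=> x x0 xR; set e := enorm x in x0 xR *.
rewrite /reg_weight reg_invrad0E// reg_invlog0E// -/e /hardy_weight -/e.
set t := 1 + ln (R / e).
have t1 : 1 <= t by exact: one_plus_log_ge1.
have t0 : 0 < t := lt_le_trans ltr01 t1.
move: (hardy_ratio n ^+ N) (exprn_gt0 N g0) => G G0.
rewrite mulrDr mulr1 -exprMn -invfM exprVn lerD2l.
rewrite -mulrA -[leRHS]mulrA ler_pM2l//.
rewrite [leRHS](_ : _ = (n.+1%:R)^-1 * ((e * t) ^+ N * t)^-1); last first.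
  by rewrite [in RHS]invfM; ring.
rewrite ler_pM2l ?invr_gt0 ?ltr0n// lef_pV2 ?posrE//; last first.
  by apply: mulr_gt0 => //; apply: exprn_gt0; exact: mulr_gt0.
have tE : expR t = expR 1 * (R / e).
  by rewrite /t expRD lnK// posrE divr_gt0.
have tle : t <= N.+1%:R * expR (t / N.+1%:R).
  have := expR_ge1Dx (t / N.+1%:R).
  have N0 : 0 < N.+1%:R :> K by rewrite ltr0n.
  by move=> h; rewrite -ler_pdivrMl// mulrC (le_trans _ h)// lerDr.
have tpow : t ^+ N.+1 <= N.+1%:R ^+ N.+1 * (expR 1 * (R / e)).
  rewrite -tE; have -> : expR t = expR (t / N.+1%:R) ^+ N.+1.
    by rewrite -expRM_natl mulrC divfK// pnatr_eq0.
  by rewrite -exprMn; apply: lerXn2r; rewrite ?nnegrE ?mulr_ge0 ?expR_ge0// ltW.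
rewrite exprMn -mulrA -exprSr.
apply: (@le_trans _ _ (e ^+ N * (N.+1%:R ^+ N.+1 * (expR 1 * (R / e))))).
  by rewrite ler_pM2l// exprn_gt0.
rewrite (_ : _ * _ = N.+1%:R ^+ N.+1 * expR 1 * (R * e ^+ n.+1)); last first.
  by rewrite (exprS e); field; rewrite gt_eqF.
rewrite /M ler_pM2l; last by rewrite mulr_gt0 ?expR_gt0// exprn_gt0// ltr0n.
by rewrite (exprS R) ler_pM2l//; apply: lerXn2r => //; rewrite ?nnegrE ltW.
Qed.

(** Fatou's lemma as the regularization q = 1/(k+1) tends to 0, away from the
    origin. *)
Lemma improved_hardy : exists2 kap : K, 0 < kap &
  forall (Om : set 'rV[K]_N) (u : 'rV[K]_N -> K) (Du : 'rV[K]_N -> 'rV[K]_N),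
  measurable Om -> (forall x, Om x -> enorm x <= R) -> sobolev0 Om N u Du ->
  ((hardy_ratio n ^+ N)%:E * hardy_integral Om R u + kap%:E * \int[mu]_(x in Om) (`|u x| ^+ N)%:E <=
   \int[mu]_(x in Om) (enorm (Du x) ^+ N)%:E)%E.
Proof.
have [kap kap0 Hkap] := reg_weight0_ge.
exists kap => // Om u Du mOm OmR su.
have [[mfu mDu _ _] _] := su.
pose D := Om `\` [set 0].
have mset0 : measurable [set (0 : 'rV[K]_N)] := @measurable_origin K N.
have mD : measurable D by exact: measurableD.
have DOm : D `<=` Om by move=> x [].
have muD : measurable_fun D u by exact: measurable_funS mfu.
have mX : measurable_fun Om (fun x => `|u x| ^+ N).
  by apply: measurable_funX; exact: (measurableT_comp (@normr_measurable K setT)).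
have mXD : measurable_fun D (fun x => `|u x| ^+ N) by exact: measurable_funS mX.
have mV := measurable_hardy_weightV.
have mH : measurable_fun Om (fun x => `|u x| ^+ N / hardy_weight R x).
  by apply: measurable_funM => //; exact: measurable_funTS.
have mHD : measurable_fun D (fun x => `|u x| ^+ N / hardy_weight R x) by exact: measurable_funS mH.
have enD x : D x -> 0 < enorm x.
  by move=> [_ /eqP x0]; rewrite lt_def enorm_ge0 andbT enorm_eq0.
have V0 x : Om x -> 0 <= (hardy_weight R x)^-1 by move=> /OmR; exact: hardy_weightV_ge0.
rewrite /hardy_integral.
rewrite (@ge0_negligible_integral _ _ _ mu Om [set 0])//; do ?[exact/measurable_EFinP|
  exact: lebesgue_rV_origin|
  by move=> x /V0 V0x; rewrite lee_fin; apply: mulr_ge0 => //; exact: exprn_ge0].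
rewrite (@ge0_negligible_integral _ _ _ mu Om [set 0] (fun x => (`|u x| ^+ N)%:E))//;
  do ?[exact/measurable_EFinP|exact: lebesgue_rV_origin|by move=> x _; rewrite lee_fin exprn_ge0].
rewrite -/D.
pose f k x := (reg_weight R (k.+1%:R^-1) x * `|u x| ^+ N)%:E.
have mf k : measurable_fun D (f k).
  apply/measurable_EFinP; apply: measurable_funM => //; apply: measurable_funTS.
  exact: measurable_reg_weight.
have f0 k x : D x -> (0 <= f k x)%E.
  by move=> /DOm/OmR xR; rewrite lee_fin mulr_ge0 ?exprn_ge0// reg_weight_ge0// invr_gt0.
have F := fatou mu mD mf f0.
apply: (@le_trans _ _ (\int[mu]_(x in D) limn_einf (f^~ x))%E); last first.
  apply: le_trans F _; rewrite limn_einf_lim; apply: lime_le; first exact: is_cvg_einfs.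
  apply: nearW => k; apply: (@le_trans _ _ (\int[mu]_(x in D) f k x)%E).
    by apply: ereal_inf_lbound; exists k => //=.
  apply: (@le_trans _ _ (\int[mu]_(x in Om) f k x)%E).
    apply: ge0_subset_integral => //.
      apply/measurable_EFinP; apply: measurable_funM => //; apply: measurable_funTS.
      exact: measurable_reg_weight.
    by move=> x /OmR xR; rewrite lee_fin mulr_ge0 ?exprn_ge0// reg_weight_ge0// invr_gt0.
  by apply: hardy_reg_sobolev0 => //; rewrite invr_gt0.
have Flim x : D x -> limn_einf (f^~ x) = (reg_weight R 0 x * `|u x| ^+ N)%:E.
  move=> Dx; have c : (fun k => reg_weight R k.+1%:R^-1 x * `|u x| ^+ N) @ \oo -->
      reg_weight R 0 x * `|u x| ^+ N.
    apply: cvgM; last exact: cvg_cst.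
    by apply: reg_weight_cvg; [exact: enD|exact/OmR/DOm].
  have c' : f^~ x @ \oo --> (reg_weight R 0 x * `|u x| ^+ N)%:E.
    by apply: cvg_EFin; [exact: nearW|exact: c].
  exact: (cvg_limn_einf_sup c').1.
rewrite [leRHS](_ : _ = \int[mu]_(x in D) (reg_weight R 0 x * `|u x| ^+ N)%:E)%E; last first.
  by apply: eq_integral => x /set_mem; exact: Flim.
have gN0 : 0 <= hardy_ratio n ^+ N :> K by rewrite exprn_ge0// ltW// hardy_ratio_gt0.
have k0 := ltW kap0.
rewrite -!ge0_integralZl//;
  do ?[exact/measurable_EFinP|by move=> x /DOm /V0 V0x; rewrite lee_fin; do ?[apply: mulr_ge0 => //]; exact: exprn_ge0].
rewrite -ge0_integralD//;
  do ?[by apply: measurable_funeM; exact/measurable_EFinP|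
       by move=> x /DOm /V0 V0x; rewrite -EFinM lee_fin; apply: mulr_ge0 => //; do ?[apply: mulr_ge0 => //]; exact: exprn_ge0].
apply: ge0_le_integral => //.
- move=> x /DOm /V0 V0x; have X0 : 0 <= `|u x| ^+ N by exact: exprn_ge0.
  by rewrite -!EFinM -EFinD lee_fin; apply: addr_ge0; apply: mulr_ge0 => //; exact: mulr_ge0.
- by apply: emeasurable_funD; apply: measurable_funeM; exact/measurable_EFinP.
- apply/measurable_EFinP; apply: measurable_funM => //; apply: measurable_funTS.
  exact: measurable_reg_weight.
- move=> x Dx; rewrite -!EFinM -EFinD lee_fin.
  rewrite [leLHS](_ : _ = (hardy_ratio n ^+ N / hardy_weight R x + kap) * `|u x| ^+ N).
    by apply: ler_wpM2r; [exact: exprn_ge0|apply: Hkap; [exact: enD|exact/OmR/DOm]].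
  by move: (hardy_ratio n ^+ N) => G; ring.
Qed.

End improved_hardy.

(** * The Hardy weight on balls *)

Section rearrangement.
Context {K : realType}.
Variables (n : nat) (R : K).
Hypotheses (R0 : 0 < R).
Local Notation N := n.+2.
Local Notation mu := (lebesgue_rV (K := K) N).

(** The integral of a nonnegative function is a supremum over simple functions
    below it, so it is monotone on measurable and non-measurable functions alike.
    This serves for the integrands that contain the symmetrization, of which only
    lower bounds are used. *)
Lemma ge0_le_integral_pointwise d (T : measurableType d) (m : {measure set T -> \bar K})
  (D : set T) (f g : T -> \bar K) :
  (forall x, D x -> 0 <= f x)%E -> (forall x, D x -> f x <= g x)%E ->
  (\int[m]_(x in D) f x <= \int[m]_(x in D) g x)%E.
Proof.
move=> f0 fg; rewrite [leLHS]integral_mkcond [leRHS]integral_mkcond.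
have fg' x : ((f \_ D) x <= (g \_ D) x)%E.
  by rewrite !patchE; case: ifPn => // /set_mem; exact: fg.
have f0' x : (0 <= (f \_ D) x)%E by rewrite !patchE; case: ifPn => // /set_mem; exact: f0.
rewrite !ge0_integralTE//; last by move=> x; exact: le_trans (f0' x) (fg' x).
apply: le_ereal_sup => _ [h hf <-].
by exists h => // x; exact: le_trans (hf x) (fg' x).
Qed.

Definition unit_ball_vol : K := fine (mu (eball 1)).

Lemma unit_ball_volE : mu (eball 1) = unit_ball_vol%:E.
Proof. by rewrite fineK// ge0_fin_numE// lebesgue_rV_eball_fin. Qed.

Lemma unit_ball_vol_gt0 : 0 < unit_ball_vol.
Proof. by rewrite fine_gt0// lebesgue_rV_eball1_gt0 lebesgue_rV_eball_fin. Qed.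

Lemma lebesgue_rV_eballE (r : K) : 0 < r -> mu (eball r) = (unit_ball_vol * r ^+ N)%:E.
Proof. by move=> r0; rewrite lebesgue_rV_eball// unit_ball_volE -EFinM mulrC. Qed.

(** The function r (1 + log (R / r)) increases on (0, R], from which the
    monotonicity of the Hardy weight follows. *)
Lemma mul_log_le (r e : K) : 0 < r -> r <= e -> e <= R ->
  r * (1 + ln (R / r)) <= e * (1 + ln (R / e)).
Proof.
move=> r0 re eR; have e0 : 0 < e := lt_le_trans r0 re.
have -> : ln (R / r) = ln (R / e) + ln (e / r).
  by rewrite -lnM ?posrE ?divr_gt0//; congr ln; field; rewrite !gt_eqF.
have h1 : 0 <= ln (R / e) by rewrite ln_ge0// ler_pdivlMr// mul1r.
have h2 : ln (e / r) <= e / r - 1.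
  have := expR_ge1Dx (ln (e / r)); rewrite lnK ?posrE ?divr_gt0//; lra.
apply: (@le_trans _ _ (r * (ln (R / e) + e / r))).
  by rewrite ler_pM2l//; lra.
rewrite mulrDr [r * (e / r)]mulrC divfK ?gt_eqF// mulrDr mulr1 addrC lerD2l.
by rewrite ler_wpM2r.
Qed.

Lemma hardy_weightV_le (x : 'rV[K]_N) (r : K) : 0 < r -> r <= enorm x -> enorm x <= R ->
  (hardy_weight R x)^-1 <= (r ^+ N * (1 + ln (R / r)) ^+ N)^-1.
Proof.
move=> r0 re eR; have e0 := lt_le_trans r0 re.
have lr := one_plus_log_ge1 r0 (le_trans re eR); have le := one_plus_log_ge1 e0 eR.
rewrite /hardy_weight -!exprMn lef_pV2 ?posrE; try (apply: exprn_gt0; apply: mulr_gt0; lra).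
by apply: lerXn2r; rewrite ?nnegrE; [apply: mulr_ge0; lra|apply: mulr_ge0; lra|exact: mul_log_le].
Qed.

Lemma hardy_weightV_ge (x : 'rV[K]_N) (r : K) : 0 < enorm x -> enorm x <= r -> r <= R ->
  (r ^+ N * (1 + ln (R / r)) ^+ N)^-1 <= (hardy_weight R x)^-1.
Proof.
move=> e0 er rR; have r0 := lt_le_trans e0 er.
have lr := one_plus_log_ge1 r0 rR; have le := one_plus_log_ge1 e0 (le_trans er rR).
rewrite /hardy_weight -!exprMn lef_pV2 ?posrE; try (apply: exprn_gt0; apply: mulr_gt0; lra).
by apply: lerXn2r; rewrite ?nnegrE; [apply: mulr_ge0; lra|apply: mulr_ge0; lra|exact: mul_log_le].
Qed.

Lemma integral_hardy_weightV_ge (A : set 'rV[K]_N) (c : K) : measurable A -> 0 <= c ->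
  (forall x, A x -> c <= (hardy_weight R x)^-1) ->
  (c%:E * mu A <= \int[mu]_(x in A) ((hardy_weight R x)^-1)%:E)%E.
Proof.
move=> mA c0 Ac; rewrite -(integral_cst mu mA); apply: ge0_le_integral => //.
- by apply/measurable_EFinP; apply: measurable_funTS; exact: measurable_hardy_weightV.
Qed.

(** On the j-th dyadic annulus below rho, t is at most 1 + log (R / rho) + J and
    |x| is at most rho / 2^j, while the annulus has at least half of the measure
    of its outer ball. *)
Lemma annulus_ge (rho : K) (j J : nat) : 0 < rho -> rho <= R -> (j < J)%N ->
  ((unit_ball_vol / 2 / (1 + ln (R / rho) + J%:R) ^+ N)%:E <=
   \int[mu]_(x in eball (rho / 2 ^+ j) `\` eball (rho / 2 ^+ j.+1)) ((hardy_weight R x)^-1)%:E)%E.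
Proof.
move=> r0 rR jJ.
have p0 i : 0 < 2 ^+ i :> K by rewrite exprn_gt0.
have p1 i : 1 <= 2 ^+ i :> K by rewrite exprn_ege1// ler1n.
pose r := rho / 2 ^+ j.
have r'0 : 0 < r by rewrite divr_gt0.
have rE : rho / 2 ^+ j.+1 = r / 2 by rewrite /r exprS; field; rewrite gt_eqF.
have rrho : r <= rho by rewrite ler_pdivrMr// ler_peMr// ltW.
rewrite -/r rE.
set T := 1 + ln (R / rho).
have T1 : 1 <= T by exact: one_plus_log_ge1.
have T0 : 0 < T + J%:R by rewrite ltr_wpDr// (lt_le_trans ltr01).
pose c := (r ^+ N * (T + J%:R) ^+ N)^-1.
have c0 : 0 <= c by rewrite invr_ge0; apply: mulr_ge0; apply: exprn_ge0; exact: ltW.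
have r20 : 0 < r / 2 by rewrite divr_gt0.
apply: (@le_trans _ _ (c%:E * mu (eball r `\` eball (r / 2)))%E).
  rewrite measureD; try exact: measurable_eball; last exact: lebesgue_rV_eball_fin.
  rewrite (_ : eball r `&` eball (r / 2) = eball (r / 2)); last first.
    apply/setIidPr => x; rewrite /eball /= => h; apply: lt_le_trans h _.
    by rewrite ler_pdivrMr// ler_peMr ?ler1n// ltW.
  have -> : (mu (eball r) - mu (eball (r / 2)) = (unit_ball_vol * r ^+ N - unit_ball_vol * (r / 2) ^+ N)%:E)%E.
    by rewrite EFinB -!lebesgue_rV_eballE.
  rewrite -EFinM lee_fin.
  have h2 : (r / 2) ^+ N <= r ^+ N / 2.
    rewrite expr_div_n ler_pM2l ?exprn_gt0// lef_pV2 ?posrE// exprS ler_peMr//.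
  rewrite (_ : unit_ball_vol / 2 / _ = c * (unit_ball_vol * (r ^+ N / 2))).
    rewrite ler_wpM2l// -mulrBr ler_pM2l ?unit_ball_vol_gt0//; lra.
  have rN0 : r ^+ N != 0 by rewrite gt_eqF// exprn_gt0.
  have TN0 : (T + J%:R) ^+ N != 0 by rewrite gt_eqF// exprn_gt0.
  rewrite /c; move: (r ^+ N) ((T + J%:R) ^+ N) rN0 TN0 => a b a0 b0.
  by field; rewrite a0 b0.
apply: integral_hardy_weightV_ge => //.
  by apply: measurableD; exact: measurable_eball.
move=> x [xr /negP]; rewrite /eball /= in xr *; rewrite -leNgt => rx.
have e0 : 0 < enorm x := lt_le_trans r20 rx.
have eR : enorm x <= R by rewrite (le_trans (ltW xr))// (le_trans rrho).
have le := one_plus_log_ge1 e0 eR.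
rewrite /c /hardy_weight -!exprMn lef_pV2 ?posrE; try (apply: exprn_gt0; apply: mulr_gt0; lra).
apply: lerXn2r; rewrite ?nnegrE; [by apply: mulr_ge0; lra|by apply: mulr_ge0; lra|].
apply: ler_pM; [exact: ltW|lra|exact: ltW|].
rewrite /T -addrA lerD2l.
apply: (@le_trans _ _ (ln (R / rho * 2 ^+ J))); last first.
  rewrite lnM ?posrE ?divr_gt0// lerD2l lnXn// -[ln 2 *+ J]mulr_natr ler_piMl//.
  have := expR_ge1Dx (ln (2 : K)); rewrite lnK ?posrE//; lra.
rewrite ler_ln ?posrE; do ?by rewrite ?mulr_gt0 ?divr_gt0 ?invr_gt0.
rewrite -mulrA ler_pM2l// -(invrK (2 ^+ J)) -invfM lef_pV2 ?posrE ?mulr_gt0 ?invr_gt0//.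
apply: le_trans rx; rewrite -rE ler_pM2l// lef_pV2 ?posrE//.
by apply: ler_weXn2l => //; rewrite ler1n.
Qed.

Lemma hardy_ball_annuli (rho : K) (J : nat) : 0 < rho -> rho <= R ->
  ((J%:R * (unit_ball_vol / 2 / (1 + ln (R / rho) + J%:R) ^+ N))%:E <=
   \int[mu]_(x in eball rho) ((hardy_weight R x)^-1)%:E)%E.
Proof.
move=> r0 rR; set c := (unit_ball_vol / 2 / _).
have mV (A : set 'rV[K]_N) : measurable_fun A (fun x : 'rV[K]_N => ((hardy_weight R x)^-1)%:E).
  by apply/measurable_EFinP; apply: measurable_funTS; exact: measurable_hardy_weightV.
have ballR (x : 'rV[K]_N) : eball rho x -> enorm x <= R.
  by rewrite /eball /= => xr; rewrite (le_trans (ltW xr)).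
have H i : (i <= J)%N -> ((i%:R * c)%:E <=
    \int[mu]_(x in eball rho `\` eball (rho / 2 ^+ i)) ((hardy_weight R x)^-1)%:E)%E.
  elim: i => [_|i IH iJ].
    rewrite mul0r; apply: integral_ge0 => x [/ballR xR _]; rewrite lee_fin; exact: hardy_weightV_ge0.
  have sub1 : eball (rho / 2 ^+ i) `<=` (eball rho : set 'rV[K]_N).
    move=> x; rewrite /eball /= => h; apply: lt_le_trans h _.
    by rewrite ler_pdivrMr ?exprn_gt0// ler_peMr ?exprn_ege1 ?ler1n// ltW.
  have sub2 : eball (rho / 2 ^+ i.+1) `<=` (eball (rho / 2 ^+ i) : set 'rV[K]_N).
    move=> x; rewrite /eball /= => h; apply: lt_le_trans h _.
    rewrite ler_pM2l// lef_pV2 ?posrE ?exprn_gt0//.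
    by apply: ler_weXn2l => //; rewrite ler1n.
  rewrite (_ : eball rho `\` eball (rho / 2 ^+ i.+1) =
     (eball rho `\` eball (rho / 2 ^+ i)) `|` (eball (rho / 2 ^+ i) `\` eball (rho / 2 ^+ i.+1))); last first.
    apply/seteqP; split=> x.
      by move=> [xr nx]; have [h|h] := pselect (eball (rho / 2 ^+ i) x); [right|left].
    by case=> [[xr nx]|[xi nx]]; split=> //; [move=> /sub2|exact: sub1].
  rewrite ge0_integral_setU//; first last.
  - apply/disj_setPS => x [[_ nx] [xi _]]; exact: nx.
  - by move=> x [[/ballR xR _]|[/sub1/ballR xR _]]; rewrite lee_fin; exact: hardy_weightV_ge0.
  - by apply: measurableD; exact: measurable_eball.
  - by apply: measurableD; exact: measurable_eball.
  rewrite -natr1 mulrDl mul1r EFinD; apply: leeD; first by apply: IH; exact: ltnW.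
  exact: annulus_ge.
apply: le_trans (H J (leqnn J)) _; apply: ge0_subset_integral => //.
- by apply: measurableD; exact: measurable_eball.
- exact: measurable_eball.
- by move=> x /ballR xR; rewrite lee_fin; exact: hardy_weightV_ge0.
Qed.

Definition hardy_ball_cst : K := unit_ball_vol / 2 / 3%:R ^+ N.

Lemma hardy_ball_cst_gt0 : 0 < hardy_ball_cst.
Proof. by rewrite !divr_gt0 ?exprn_gt0 ?unit_ball_vol_gt0. Qed.

(** With T = 1 + log (R / rho), the first J annuli contribute at least
    J / (T + J)^N up to a constant; J is chosen between T and 2 T. *)
Lemma hardy_ball_ge (rho : K) : 0 < rho -> rho <= R ->
  ((hardy_ball_cst / (1 + ln (R / rho)) ^+ n.+1)%:E <=
   \int[mu]_(x in eball rho) ((hardy_weight R x)^-1)%:E)%E.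
Proof.
move=> r0 rR; set T := 1 + ln (R / rho).
have T1 : 1 <= T by exact: one_plus_log_ge1.
have T0 := lt_le_trans ltr01 T1.
have /andP[J1 J2] := Num.Theory.truncn_itv (ltW T0).
pose J := (Num.truncn T).+1.
have TJ : T <= J%:R by exact: ltW.
have JT : J%:R <= 2 * T by rewrite /J -natr1; lra.
apply: le_trans (hardy_ball_annuli J r0 rR); rewrite lee_fin -/T.
have b0 := unit_ball_vol_gt0.
have TJ0 : 0 < T + J%:R by rewrite ltr_wpDr.
apply: (@le_trans _ _ (T * (unit_ball_vol / 2 / (3%:R * T) ^+ N))).
  rewrite exprMn /hardy_ball_cst (exprS T n.+1); move: (3 ^+ N) (exprn_gt0 N (ltr0n K 3)) => a a0.
  have := exprn_gt0 n.+1 T0; move: (T ^+ n.+1) => b bb0.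
  by rewrite [leLHS](_ : _ = T * (unit_ball_vol / 2 / (a * (T * b))))//; field; rewrite !gt_eqF.
apply: ler_pM => //; first exact: ltW.
  by apply: divr_ge0; [rewrite divr_ge0// ltW|apply: exprn_ge0; lra].
rewrite ler_pM2l ?divr_gt0// lef_pV2 ?posrE; try (apply: exprn_gt0; lra).
apply: lerXn2r; rewrite ?nnegrE; lra.
Qed.

End rearrangement.

Lemma lee_expe (K : realType) (x y : \bar K) k : (0 <= x)%E -> (x <= y)%E ->
  (x ^+ k <= y ^+ k)%E.
Proof.
move=> x0 xy; elim: k => [|k IH]; first by rewrite !expe0.
by rewrite !expeS; apply: lee_pmul => //; exact: expe_ge0.
Qed.

(** * Exponential decay of the level sets *)

Section levels.
Context {K : realType}.
Variables (n : nat) (R Rt : K).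
Local Notation N := n.+2.
Variables (Om : set 'rV[K]_N) (u : 'rV[K]_N -> K).
Hypotheses (Rt0 : 0 < Rt) (RtR : Rt <= R).
Hypotheses (mOm : measurable Om) (OmB : Om `<=` eball Rt) (mfu : measurable_fun Om u).
Local Notation mu := (lebesgue_rV (K := K) N).
Let R0 : 0 < R. Proof. exact: lt_le_trans Rt0 RtR. Qed.

Definition level (s : K) := Om `&` [set x | s < `|u x|].

Lemma measurable_level s : measurable (level s).
Proof.
have mn : measurable_fun Om (fun x => `|u x|).
  exact: (measurableT_comp (@normr_measurable K setT)).
have := measurable_fun_ltr (@measurable_cst _ _ _ _ Om s) mn mOm (Y := [set true]) I.
rewrite (_ : level s = Om `&` (fun x => s < `|u x|) @^-1` [set true])//.
Qed.

(** The distribution function is sealed behind this specification, so that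
    unification never compares the measures of two level sets by unfolding the
    iterated product. *)
Lemma distr_spec : {d : K -> K | forall s, d s = fine (mu (level s))}.
Proof. by exists (fun s => fine (mu (level s))). Qed.

Definition distr : K -> K := sval distr_spec.

Lemma mu_level_le s : (mu (level s) <= (unit_ball_vol (K := K) n * Rt ^+ N)%:E)%E.
Proof.
apply: (@le_trans _ _ (mu (eball Rt))); last by rewrite lebesgue_rV_eballE.
apply: le_measure; rewrite ?inE.
- exact: measurable_level.
- exact: measurable_eball.
- by move=> x [/OmB].
Qed.

Lemma distrE s : mu (level s) = (distr s)%:E.
Proof.
rewrite /distr (svalP distr_spec).
by rewrite fineK// ge0_fin_numE// (le_lt_trans (mu_level_le s))// ltry.
Qed.

Lemma distr_ge0 s : 0 <= distr s.
Proof. by rewrite /distr (svalP distr_spec) fine_ge0. Qed.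

Lemma distr_le s : distr s <= unit_ball_vol n * Rt ^+ N.
Proof. by rewrite -lee_fin -distrE mu_level_le. Qed.

Lemma distr_anti s s' : s <= s' -> distr s' <= distr s.
Proof.
move=> ss'; have : (mu (level s') <= mu (level s))%E; last first.
  by rewrite [leLHS]distrE [leRHS]distrE lee_fin.
apply: le_measure; rewrite ?inE.
- exact: measurable_level.
- exact: measurable_level.
- by move=> x [Ox /= h]; split => //=; exact: le_lt_trans h.
Qed.

Lemma schwarz_symmetrization_ge s (x : 'rV[K]_N) : unit_ball_vol n * enorm x ^+ N < distr s ->
  (s%:E <= schwarz_symmetrization Om u x)%E.
Proof.
move=> h; apply: le_ereal_inf_tmp => _ [s' [s'0 hs'] <-].
rewrite lee_fin leNgt; apply/negP => s's.
move: hs'; rewrite -[X in (mu X <= _)%E]/(level s') distrE unit_ball_volE -EFinM lee_fin leNgt => /negP; apply.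
by apply: lt_le_trans h _; apply: distr_anti; exact: ltW.
Qed.

Lemma schwarz_symmetrization_ge0 (x : 'rV[K]_N) : (0 <= schwarz_symmetrization Om u x)%E.
Proof. by apply: le_ereal_inf_tmp => _ [s' [s'0 _] <-]; rewrite lee_fin. Qed.

(** The radius of the centred ball that has the measure of the level set. *)
Definition level_radius (s : K) : K := (distr s / unit_ball_vol n) `^ (N%:R^-1).

Lemma level_radius_exp s : level_radius s ^+ N = distr s / unit_ball_vol n.
Proof.
have d0 : 0 <= distr s / unit_ball_vol n by rewrite divr_ge0 ?distr_ge0 ?ltW ?unit_ball_vol_gt0.
by rewrite /level_radius -powR_mulrn ?powR_ge0// -powRrM mulVf ?pnatr_eq0// powRr1.
Qed.

Lemma level_radius_ge0 s : 0 <= level_radius s.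
Proof. exact: powR_ge0. Qed.

Lemma level_radius_gt0 s : 0 < distr s -> 0 < level_radius s.
Proof. by move=> d0; rewrite powR_gt0// divr_gt0 ?unit_ball_vol_gt0. Qed.

Lemma level_radius_le s : level_radius s <= Rt.
Proof.
rewrite -(@ler_pXn2r _ N)// ?nnegrE ?level_radius_ge0 ?(ltW Rt0)//.
by rewrite level_radius_exp ler_pdivrMr ?unit_ball_vol_gt0// mulrC distr_le.
Qed.

Lemma mem_level_radius s (x : 'rV[K]_N) : eball (level_radius s) x <-> unit_ball_vol n * enorm x ^+ N < distr s.
Proof.
rewrite mulrC -ltr_pdivlMr ?unit_ball_vol_gt0// -level_radius_exp /eball /=.
by rewrite ltr_pXn2r// ?nnegrE ?level_radius_ge0 ?enorm_ge0.
Qed.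

Lemma mu_eball_level_radius s : 0 < distr s -> mu (eball (level_radius s)) = (distr s)%:E.
Proof.
move=> d0; rewrite lebesgue_rV_eballE ?level_radius_gt0// level_radius_exp; congr EFin.
by rewrite mulrC divfK// gt_eqF ?unit_ball_vol_gt0.
Qed.

Definition lorentz_int : \bar K :=
  (\int[mu]_(x in eball Rt)
      (`|schwarz_symmetrization Om u x| ^+ N * (hardy_weight R x)^-1%:E))%E.

Lemma eball_R (x : 'rV[K]_N) : eball Rt x -> enorm x <= R.
Proof. by rewrite /eball /= => /ltW/le_trans; apply. Qed.

(** The symmetrization is at least s on the ball of radius [level_radius s], and
    [hardy_ball_ge] bounds the integral of the weight over this ball. *)
Lemma lorentz_int_level s : 0 <= s -> 0 < distr s ->
  ((s ^+ N * (hardy_ball_cst n / (1 + ln (R / level_radius s)) ^+ n.+1))%:E <= lorentz_int)%E.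
Proof.
move=> s0 d0.
have r0 := level_radius_gt0 d0; have rRt := level_radius_le s; have rR := le_trans rRt RtR.
have mV (A : set 'rV[K]_N) : measurable_fun A (fun x : 'rV[K]_N => ((hardy_weight R x)^-1)%:E).
  by apply/measurable_EFinP; apply: measurable_funTS; exact: measurable_hardy_weightV.
have V0 (x : 'rV[K]_N) : eball Rt x -> (0 <= ((hardy_weight R x)^-1)%:E)%E.
  by move=> /eball_R xR; rewrite lee_fin; exact: hardy_weightV_ge0.
have sub : eball (level_radius s) `<=` (eball Rt : set 'rV[K]_N).
  by move=> x; rewrite /eball /= => h; exact: lt_le_trans rRt.
rewrite EFinM; apply: (@le_trans _ _ ((s ^+ N)%:E * \int[mu]_(x in eball (level_radius s)) ((hardy_weight R x)^-1)%:E)%E).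
  by apply: lee_wpmul2l; [rewrite lee_fin exprn_ge0|exact: hardy_ball_ge].
rewrite -ge0_integralZl//; [|exact: measurable_eball|by move=> x /sub; exact: V0|by rewrite lee_fin exprn_ge0].
rewrite integral_mkcond /lorentz_int [leRHS]integral_mkcond.
apply: ge0_le_integral_pointwise => x _; rewrite !patchE.
  case: ifPn => // /set_mem/sub/V0 h; apply: mule_ge0 => //; by rewrite lee_fin exprn_ge0.
case: ifPn => [/set_mem xs|_]; last first.
  by case: ifPn => // /set_mem/V0 h; apply: mule_ge0 => //; exact: expe_ge0.
rewrite mem_set; last exact: sub.
apply: lee_wpmul2r; first by apply: V0; exact: sub.
have h := schwarz_symmetrization_ge (iffLR (mem_level_radius s x) xs).
rewrite gee0_abs; last exact: schwarz_symmetrization_ge0.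
rewrite EFin_expe; apply: lee_expe => //; by rewrite lee_fin.
Qed.

Definition decay_rate : K := (hardy_ball_cst n) `^ (n.+1%:R^-1).

(** By [lorentz_int_level], 1 + log (R / rho) is at least a multiple of
    (s / L)^(N/(N-1)), where rho is the radius of the level; this bounds rho, and
    the measure is proportional to rho^N. *)
Lemma level_decay (L s : K) : 0 < L -> lorentz_int = (L ^+ N)%:E -> 0 <= s ->
  distr s <= unit_ball_vol n * (expR 1 * R) ^+ N *
    expR (- (N%:R * decay_rate * (s / L) `^ (N%:R / n.+1%:R))).
Proof.
move=> L0 LE s0; have b0 := unit_ball_vol_gt0 (K := K) n.
have := distr_ge0 s; rewrite le_eqVlt => /predU1P[<-|d0].
  by rewrite mulr_ge0 ?expR_ge0// mulr_ge0 ?(ltW b0)// exprn_ge0// mulr_ge0 ?expR_ge0// ltW.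
have r0 := level_radius_gt0 d0; have rR := le_trans (level_radius_le s) RtR.
have := lorentz_int_level s0 d0; rewrite LE lee_fin.
set T := 1 + ln (R / level_radius s); set z := (s / L) `^ _.
have T1 : 1 <= T by exact: one_plus_log_ge1.
have T0 := lt_le_trans ltr01 T1.
have h0 := hardy_ball_cst_gt0 (K := K) n.
have sL0 : 0 <= s / L by rewrite divr_ge0// ltW.
move=> h1.
have h2 : hardy_ball_cst n * (s / L) ^+ N <= T ^+ n.+1.
  rewrite expr_div_n mulrA ler_pdivrMr ?exprn_gt0// mulrC (mulrC (T ^+ _)).
  by move: h1; rewrite mulrA ler_pdivrMr ?exprn_gt0// mulrC.
have z0 : 0 <= z by exact: powR_ge0.
have k0 : 0 <= decay_rate by exact: powR_ge0.
have kz : decay_rate * z <= T.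
  have dE : decay_rate ^+ n.+1 = hardy_ball_cst n.
    by rewrite /decay_rate -powR_mulrn ?powR_ge0// -powRrM mulVf ?pnatr_eq0// powRr1// ltW.
  have zE : z ^+ n.+1 = (s / L) ^+ N.
    by rewrite /z -[LHS]powR_mulrn ?powR_ge0// -powRrM divfK ?pnatr_eq0// powR_mulrn.
  by rewrite -(@ler_pXn2r _ n.+1)// ?nnegrE ?(ltW T0) ?mulr_ge0// exprMn dE zE.
have rle : level_radius s <= expR 1 * R * expR (- (decay_rate * z)).
  rewrite -[leLHS](lnK (x := level_radius s)) ?posrE// -[X in _ * X * _](lnK (x := R)) ?posrE//.
  rewrite -!expRD ler_expR; move: kz; rewrite /T ln_div ?posrE//; lra.
have : distr s / unit_ball_vol n <= (expR 1 * R * expR (- (decay_rate * z))) ^+ N.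
  rewrite -level_radius_exp; apply: lerXn2r; rewrite ?nnegrE ?level_radius_ge0//.
  by rewrite mulr_ge0 ?expR_ge0// mulr_ge0 ?expR_ge0// ltW.
rewrite ler_pdivrMr// mulrC exprMn mulrA -expRM_natl.
by rewrite mulrN (mulrA N%:R).
Qed.

End levels.

(** * The Lorentz norm dominates the Hardy integral *)

Section layer_cake.
Context {K : realType}.
Variables (n : nat) (R Rt : K).
Local Notation N := n.+2.
Variables (Om : set 'rV[K]_N) (u : 'rV[K]_N -> K).
Hypotheses (Rt0 : 0 < Rt) (RtR : Rt <= R).
Hypotheses (mOm : measurable Om) (OmB : Om `<=` eball Rt) (mfu : measurable_fun Om u).
Local Notation mu := (lebesgue_rV (K := K) N).
Let R0 : 0 < R. Proof. exact: lt_le_trans Rt0 RtR. Qed.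

Let mV (A : set 'rV[K]_N) : measurable_fun A (fun x : 'rV[K]_N => ((hardy_weight R x)^-1)%:E).
Proof. by apply/measurable_EFinP; apply: measurable_funTS; exact: measurable_hardy_weightV. Qed.

Let V0 (x : 'rV[K]_N) : eball Rt x -> 0 <= (hardy_weight R x)^-1.
Proof. by move=> /(eball_R RtR) xR; exact: hardy_weightV_ge0. Qed.

(** Inside the ball the two integrands agree.  Outside it, the weight is at most
    its value v on the sphere, the level set has the measure of the ball, and the
    weight is at least v on the ball. *)
Lemma level_hardy s : (\int[mu]_(x in level Om u s) ((hardy_weight R x)^-1)%:E <=
   2%:E * \int[mu]_(x in eball (level_radius Om u s)) ((hardy_weight R x)^-1)%:E)%E.
Proof.
have mlev := measurable_level mOm mfu s.
have lR (x : 'rV[K]_N) : level Om u s x -> eball Rt x by move=> [/OmB].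
have rRt := level_radius_le Rt0 mOm OmB mfu s.
have sub : eball (level_radius Om u s) `<=` (eball Rt : set 'rV[K]_N).
  by move=> x; rewrite /eball /= => h; exact: lt_le_trans rRt.
have I0 : (0 <= \int[mu]_(x in eball (level_radius Om u s)) ((hardy_weight R x)^-1)%:E)%E.
  by apply: integral_ge0 => x /sub/V0; rewrite lee_fin.
have := distr_ge0 Om u s; rewrite le_eqVlt => /predU1P[d0|d0].
  have m0 : mu (level Om u s) = 0%E by rewrite (distrE Rt0 mOm OmB mfu) -d0.
  rewrite [leLHS](_ : _ = 0%E); first exact: mule_ge0.
  by apply: null_set_integral.
have r0 := level_radius_gt0 (Om := Om) (u := u) d0.
set r := level_radius Om u s in r0 rRt sub I0 *.
have rR := le_trans rRt RtR.
pose v := (r ^+ N * (1 + ln (R / r)) ^+ N)^-1.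
have v0 : 0 <= v.
  rewrite invr_ge0; apply: mulr_ge0; apply: exprn_ge0; first exact: ltW.
  exact: le_trans ler01 (one_plus_log_ge1 r0 rR).
have mb : measurable (eball r : set 'rV[K]_N) by exact: measurable_eball.
rewrite (_ : level Om u s = (level Om u s `&` eball r) `|` (level Om u s `\` eball r)); last first.
  by rewrite setUIDK.
rewrite ge0_integral_setU//; first last.
- by apply/disj_setPS => x [[_ h] [_ nh]]; exact: nh.
- by move=> x [[/lR/V0 h _]|[/lR/V0 h _]]; rewrite lee_fin.
- exact: measurableD.
- exact: measurableI.
rewrite (_ : 2%:E = 1 + 1)%E; last by rewrite -EFinD.
rewrite ge0_muleDl ?mul1e//.
apply: leeD.
  apply: ge0_subset_integral => //; first exact: measurableI.
  by move=> x /sub/V0 h; rewrite lee_fin.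
apply: (@le_trans _ _ (v%:E * mu (level Om u s `\` eball r))%E).
  rewrite -integral_cst; last exact: measurableD.
  apply: ge0_le_integral_pointwise => x [/lR xR /negP nr]; rewrite lee_fin; first exact: V0.
  apply: hardy_weightV_le => //; last exact: eball_R xR.
  by rewrite leNgt.
pose Z := [set (0 : 'rV[K]_N)].
(* The origin is removed because the weight there is not at least v. *)
apply: (@le_trans _ _ (v%:E * mu (eball r `\` Z))%E).
  apply: lee_wpmul2l; first by rewrite lee_fin.
  rewrite (measureD mb (@measurable_origin K N)) -/Z; last exact: lebesgue_rV_eball_fin.
  rewrite [X in (_ - X)%E](_ : _ = 0%E); last first.
    apply: (@subset_measure0 _ _ _ mu _ Z).
    - by apply: measurableI => //; exact: measurable_origin.
    - exact: measurable_origin.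
    - exact: subIsetr.
    - exact: lebesgue_rV_origin.
  rewrite sube0 [leRHS]mu_eball_level_radius// -(distrE Rt0 mOm OmB mfu).
  apply: le_measure; rewrite ?inE; [exact: measurableD|exact: mlev|exact: subDsetl].
apply: (@le_trans _ _ (\int[mu]_(x in eball r `\` Z) ((hardy_weight R x)^-1)%:E)%E).
  apply: integral_hardy_weightV_ge => //; first by apply: measurableD => //; exact: measurable_origin.
  move=> x [xr /eqP x0]; apply: hardy_weightV_ge => //; last exact: ltW.
  by rewrite lt_def enorm_ge0 andbT enorm_eq0.
apply: ge0_subset_integral => //; first by apply: measurableD => //; exact: measurable_origin.
by move=> x /sub/V0 h; rewrite lee_fin.
Qed.

(* The maximum with 0 makes the root monotone on the whole line, hence
   measurable. *)
Let root (t : K) : K := (Num.max t 0) `^ (N%:R^-1).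

Let root_mono t t' : t <= t' -> root t <= root t'.
Proof.
move=> tt'; apply: ge0_ler_powR; rewrite ?invr_ge0 ?nnegrE//; try by rewrite le_max lexx orbT.
by rewrite ge_max !le_max tt' lexx orbT.
Qed.

Let root_exp (t : K) : 0 <= t -> root t ^+ N = t.
Proof.
move=> t0; rewrite /root max_l// -powR_mulrn ?powR_ge0// -powRrM mulVf ?pnatr_eq0//.
by rewrite powRr1.
Qed.

Let root_ge0 (t : K) : 0 <= root t. Proof. exact: powR_ge0. Qed.

Let root_lt (t y : K) : 0 <= t -> (t < `|y| ^+ N) = (root t < `|y|).
Proof. by move=> t0; rewrite -[in LHS](root_exp t0) ltr_pXn2r// nnegrE. Qed.

Let KT := measurableTypeR K.
(** The region below the graph of |u|^N, and the corresponding region for the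
    symmetrization: [root] is the N-th root, so the second conditions say
    t < |u|^N and |x| < [level_radius (root t)]. *)
Let B : set ('rV[K]_N * KT) := [set z | [/\ Om z.1, 0 <= z.2 & root z.2 < `|(u \_ Om) z.1|]].
Let B' : set ('rV[K]_N * KT) := [set z | [/\ eball Rt z.1, 0 <= z.2 &
   unit_ball_vol n * enorm z.1 ^+ N < distr Om u (root z.2)]].

Let measurable_root : measurable_fun [set: KT] (root : KT -> KT).
Proof. by apply: nondecreasing_measurable => // x y; exact: root_mono. Qed.

Let mfst (A : set 'rV[K]_N) : measurable A -> measurable [set z : 'rV[K]_N * KT | A z.1].
Proof.
move=> mA; rewrite -[X in measurable X]setTI.
by have := @measurable_fst _ _ 'rV[K]_N KT measurableT A mA.
Qed.

Let mge0 : measurable [set z : 'rV[K]_N * KT | 0 <= z.2].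
Proof.
have := measurable_fun_ler (measurable_cst (0 : K)) (@measurable_snd _ _ 'rV[K]_N KT).
by move=> /(_ measurableT [set true] I); rewrite setTI.
Qed.

Let measurable_B : measurable B.
Proof.
rewrite (_ : B = [set z | Om z.1] `&` ([set z | 0 <= z.2] `&` [set z | root z.2 < `|(u \_ Om) z.1|])); last first.
  by apply/seteqP; split=> z /= [a b]; [split|case: b].
apply: measurableI; first exact: mfst.
apply: measurableI => //.
have m1 : measurable_fun [set: 'rV[K]_N * KT] (fun z => root z.2).
  by apply: (measurableT_comp measurable_root); exact: measurable_snd.
have m2 : measurable_fun [set: 'rV[K]_N * KT] (fun z => `|(u \_ Om) z.1|).
  apply: (measurableT_comp (@normr_measurable K setT)).
  apply: (measurableT_comp (f := u \_ Om)); last exact: measurable_fst.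
  exact/(measurable_restrictT _ mOm).
by have := measurable_fun_ltr m1 m2 measurableT (Y := [set true]) I; rewrite setTI.
Qed.

Let measurable_B' : measurable B'.
Proof.
rewrite (_ : B' = [set z | eball Rt z.1] `&` ([set z | 0 <= z.2] `&`
    [set z | unit_ball_vol n * enorm z.1 ^+ N < distr Om u (root z.2)])); last first.
  by apply/seteqP; split=> z /= [a b]; [split|case: b].
apply: measurableI; first by apply: mfst; exact: measurable_eball.
apply: measurableI => //.
have m1 : measurable_fun [set: 'rV[K]_N * KT] (fun z => distr Om u (root z.2)).
  have mr : measurable_fun [set: KT] (fun t : KT => distr Om u (root t) : KT).
    apply: nonincreasing_measurable => // x y xy.
    by apply: (distr_anti Rt0 mOm OmB mfu); exact: root_mono.
  by apply: (measurableT_comp mr); exact: measurable_snd.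
have m2 : measurable_fun [set: 'rV[K]_N * KT] (fun z => unit_ball_vol n * enorm z.1 ^+ N).
  apply: measurable_funM => //; apply: measurable_funX.
  by apply: (measurableT_comp (@measurable_enorm K N)); exact: measurable_fst.
by have := measurable_fun_ltr m2 m1 measurableT (Y := [set true]) I; rewrite setTI.
Qed.

Let mVind (A : set ('rV[K]_N * KT)) : measurable A ->
  measurable_fun setT (fun z => ((hardy_weight R z.1)^-1 * \1_A z)%:E).
Proof.
move=> mA; apply/measurable_EFinP; apply: measurable_funM => //.
by apply: (measurableT_comp (@measurable_hardy_weightV K n R)); exact: measurable_fst.
Qed.

Let pos (A : set ('rV[K]_N * KT)) z : (A z -> eball Rt z.1) ->
  (0 <= ((hardy_weight R z.1)^-1 * \1_A z)%:E)%E.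
Proof.
move=> AR; rewrite lee_fin indicE; case: (boolP (z \in A)) => [/set_mem/AR/V0 h|_].
  by rewrite mulr1.
by rewrite mulr0.
Qed.

Lemma integral_indic_itv (b : K -> itv_bound K) (a : K) : 0 <= a ->
  b = BLeft \/ b = BRight ->
  (\int[lebesgue_measure]_t (\1_([set` Interval (BLeft 0%R) (b a)] : set KT) t)%:E = a%:E)%E.
Proof.
move=> a0 bE; transitivity (lebesgue_measure ([set` Interval (BLeft 0%R) (b a)] : set KT)).
  by rewrite integral_indic// setIT.
rewrite lebesgue_measure_itv /=.
by case: bE => ->; move: a0; rewrite le_eqVlt lte_fin => /predU1P[<-|h]; rewrite ?ltxx ?h ?sube0.
Qed.

(** Tonelli: both integrals are integrals over t of the weight of the section at
    height t, of |u|^N for the left-hand side and of the N-th power of the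
    symmetrization for the right-hand side.  The sections are compared by
    [level_hardy]. *)
Lemma hardy_le_lorentz : (hardy_integral Om R u <= 2%:E * lorentz_int R Rt Om u)%E.
Proof.
pose f (z : 'rV[K]_N * KT) := ((hardy_weight R z.1)^-1 * \1_B z)%:E.
pose g (z : 'rV[K]_N * KT) := ((hardy_weight R z.1)^-1 * \1_B' z)%:E.
have mf : measurable_fun setT f by exact: mVind.
have mg : measurable_fun setT g by exact: mVind.
have f0 z : (0 <= f z)%E by apply: pos => -[/OmB].
have g0 z : (0 <= g z)%E by apply: pos => -[].
have E1 : hardy_integral Om R u = (\int[mu]_x \int[lebesgue_measure]_t f (x, t))%E.
  rewrite /hardy_integral integral_mkcond; apply: eq_integral => x _.
  rewrite patchE; case: ifPn => [/set_mem Ox|nO]; last first.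
    rewrite integral0_eq// => t _; rewrite /f indicE memNset ?mulr0// => -[] /= Ox.
    by move: nO; rewrite mem_set.
  have x0 := V0 (OmB Ox).
  transitivity (\int[lebesgue_measure]_t (((hardy_weight R x)^-1)%:E * (\1_([set` Interval (BLeft 0%R) (BLeft (`|u x| ^+ N)%R)] : set KT) t)%:E))%E.
    rewrite ge0_integralZl//; last by apply/measurable_EFinP.
    rewrite (integral_indic_itv (exprn_ge0 N (normr_ge0 (u x))) (or_introl erefl)).
    by rewrite -EFinM mulrC.
  apply: eq_integral => t _; rewrite -EFinM /f /=; congr (_ * _)%:E.
  rewrite !indicE; congr ((nat_of_bool _)%:R); apply/idP/idP => /set_mem h; apply/mem_set.
    move: h; rewrite /= in_itv /= => /andP[t0]; rewrite root_lt// => h.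
    by split => //=; rewrite patchE mem_set.
  by move: h => -[/= _ t0]; rewrite patchE mem_set// in_itv /= t0 root_lt.
have E2 t : (\int[mu]_x f (x, t) <= 2%:E * \int[mu]_x g (x, t))%E.
  have [t0|t0] := leP 0 t; last first.
    rewrite integral0_eq; last first.
      move=> x _; rewrite /f indicE memNset ?mulr0// => -[/= _]; by rewrite leNgt t0.
    by apply: mule_ge0 => //; apply: integral_ge0 => x _.
  have -> : (\int[mu]_x f (x, t) = \int[mu]_(x in level Om u (root t)) ((hardy_weight R x)^-1)%:E)%E.
    rewrite [RHS]integral_mkcond; apply: eq_integral => x _; rewrite patchE /f indicE.
    case: ifPn => [/set_mem [Ox xl]|/negP nl].
      rewrite mem_set ?mulr1//; split => //=; by rewrite patchE mem_set.
    rewrite memNset ?mulr0// => -[/= Ox _ xl]; apply: nl; apply/mem_set; split => //=.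
    by move: xl; rewrite patchE mem_set.
  apply: le_trans (level_hardy (root t)) _; apply: lee_wpmul2l => //.
  rewrite integral_mkcond; apply: ge0_le_integral_pointwise => x _; rewrite patchE.
    case: ifPn => // /set_mem xr; rewrite lee_fin; apply: V0.
    by move: xr; rewrite /eball /= => h; apply: lt_le_trans h _; exact: level_radius_le.
  case: ifPn => [/set_mem xr|_]; last exact: g0.
  rewrite /g indicE mem_set ?mulr1//; split => //=.
    by move: xr; rewrite /eball /= => h; apply: lt_le_trans h _; exact: level_radius_le.
  exact/mem_level_radius.
rewrite E1 (fubini_tonelli f)//.
apply: (@le_trans _ _ (\int[lebesgue_measure]_t (2%:E * \int[mu]_x g (x, t)))%E).
  apply: ge0_le_integral_pointwise => t _; last exact: E2.
  by apply: integral_ge0 => x _.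
rewrite ge0_integralZl//; last first.
- by move=> t _; apply: integral_ge0 => x _.
- exact: (measurable_fun_fubini_tonelli_G g).
apply: lee_wpmul2l => //.
rewrite -(fubini_tonelli g)//.
rewrite /lorentz_int [leRHS]integral_mkcond.
apply: ge0_le_integral_pointwise => x _; first by apply: integral_ge0 => t _.
rewrite patchE; case: ifPn => [/set_mem xR|nR]; last first.
  rewrite integral0_eq// => t _; rewrite /g indicE memNset ?mulr0// => -[/= xR].
  by move: nR; rewrite mem_set.
have x0 := V0 xR.
have S0 := schwarz_symmetrization_ge0 Om u x.
rewrite gee0_abs//.
have Hs t : B' (x, t) -> ((root t)%:E <= schwarz_symmetrization Om u x)%E.
  by move=> [/= _ _]; exact: (schwarz_symmetrization_ge Rt0 mOm OmB mfu).
move: S0 Hs; case: (schwarz_symmetrization Om u x) => [a|_ _|//].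
- rewrite lee_fin => a0 Hs.
  apply: (@le_trans _ _ (\int[lebesgue_measure]_t (((hardy_weight R x)^-1)%:E * (\1_([set` Interval (BLeft 0%R) (BRight (a ^+ N)%R)] : set KT) t)%:E))%E).
    apply: ge0_le_integral_pointwise => t _; first exact: g0.
    rewrite -EFinM lee_fin /=; apply: ler_wpM2l => //; rewrite !indicE ler_nat.
    case: (boolP ((x, t) \in B')) => // /set_mem Bt; rewrite mem_set//= in_itv/=.
    have := Hs _ Bt; rewrite lee_fin => h; case: Bt => /= _ t0 _; rewrite t0 /=.
    by rewrite -(root_exp t0); apply: lerXn2r; rewrite ?nnegrE.
  rewrite ge0_integralZl//; last by apply/measurable_EFinP.
  by rewrite (integral_indic_itv (exprn_ge0 N a0) (or_intror erefl)) EFin_expe muleC.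
- have yN k : (+oo ^+ k.+1 = +oo :> \bar K)%E.
    by elim: k => [|k IH]; [rewrite expeS expe0 mule1|rewrite expeS IH mulyy].
  rewrite yN; move: x0; rewrite le_eqVlt => /predU1P[V00|Vp].
    by rewrite integral0_eq ?mule_ge0 -?V00// => t _; rewrite /g /= -V00 mul0r.
  by rewrite gt0_mulye ?leey.
Qed.

End layer_cake.

(** * Exponential integrability and elementary inequalities *)

Section exponential.
Context {K : realType}.

(** Where z lies between k + 1 and k + 2, exp (th z) is at most
    exp (th (k + 2)), and this set has measure at most K1 exp (- 2 th k): the
    contributions form a geometric series of ratio exp (- th). *)
Lemma exp_integral_le d (T : measurableType d) (m : {measure set T -> \bar K}) (D : set T)
  (z : T -> K) (th K0 K1 : K) : measurable D -> measurable_fun D z -> (forall x, D x -> 0 <= z x) ->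
  0 < th -> 0 <= K1 -> (m D <= K0%:E)%E ->
  (forall k : nat, (m (D `&` [set x | (k%:R < z x)%R]) <= (K1 * expR (- (2 * th * k%:R)))%:E)%E) ->
  (\int[m]_(x in D) (expR (th * z x))%:E <=
     (expR th * K0 + K1 * expR (2 * th) / (1 - expR (- th)))%:E)%E.
Proof.
move=> mD mz z0 th0 K10 mDK mk.
pose L k := D `&` [set x | k%:R < z x].
have mL k : measurable (L k).
  have := measurable_fun_ltr (@measurable_cst _ _ _ _ D (k%:R : K)) mz mD (Y := [set true]) I.
  by rewrite (_ : L k = D `&` (fun x => k%:R < z x) @^-1` [set true]).
pose f k x := (expR (th * k.+2%:R) * \1_(L k) x)%:E.
have f0 k x : (0 <= f k x)%E by rewrite lee_fin mulr_ge0// expR_ge0.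
have mf k : measurable_fun D (f k).
  by apply/measurable_EFinP; apply: measurable_funM => //; exact: measurable_indic.
have pw x : D x -> ((expR (th * z x))%:E <= (expR th)%:E + \sum_(0 <= k <oo) f k x)%E.
  move=> Dx; have /andP[t1 t2] := Num.Theory.truncn_itv (z0 _ Dx).
  case E : (Num.truncn (z x)) t1 t2 => [|k] t1 t2.
    apply: (@le_trans _ _ (expR th)%:E); last by rewrite leeDl// nneseries_ge0.
    by rewrite lee_fin ler_expR ler_piMr// ltW.
  apply: (@le_trans _ _ (\sum_(0 <= k <oo) f k x)%E); last first.
    by rewrite leeDr// lee_fin expR_ge0.
  apply: (@le_trans _ _ (f k x)).
    rewrite lee_fin indicE mem_set ?mulr1; last first.
      by split => //=; apply: lt_le_trans t1; rewrite ltr_nat.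
    by rewrite ler_expR ler_pM2l// ltW.
  apply: le_trans (nneseries_lim_ge k.+1 _) => //.
  by rewrite big_nat_recr//= leeDr// sume_ge0.
apply: (@le_trans _ _ (\int[m]_(x in D) ((expR th)%:E + \sum_(0 <= k <oo) f k x))%E).
  by apply: ge0_le_integral_pointwise => x Dx; [rewrite lee_fin expR_ge0|exact: pw].
rewrite ge0_integralD//; do ?[exact: ge0_emeasurable_sum|
  by move=> x _; apply: nneseries_ge0|by move=> x _; rewrite lee_fin expR_ge0].
rewrite integral_cst// EFinD; apply: leeD.
  by rewrite EFinM lee_wpmul2l// lee_fin expR_ge0.
rewrite integral_nneseries//.
have q1 : expR (- th) < 1 by rewrite expR_lt1; lra.
have q0 := expR_gt0 (- th).
apply: lime_le; first by apply: is_cvg_nneseries => k _ _; apply: integral_ge0.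
apply: nearW => M.
apply: (@le_trans _ _ (\sum_(0 <= k < M) (K1 * expR (2 * th) * expR (- th) ^+ k)%:E)%E).
  apply: lee_sum => k _; rewrite /f.
  under eq_integral do rewrite EFinM.
  rewrite ge0_integralZl//; do ?[by apply/measurable_EFinP; exact: measurable_indic|
    by move=> x _; rewrite lee_fin|by rewrite lee_fin expR_ge0].
  rewrite integral_indic//.
  have -> : L k `&` D = L k by apply/setIidPl => x [].
  apply: (@le_trans _ _ ((expR (th * k.+2%:R))%:E * (K1 * expR (- (2 * th * k%:R)))%:E)%E).
    by apply: lee_wpmul2l; [rewrite lee_fin expR_ge0|exact: mk].
  rewrite -EFinM lee_fin mulrCA -[leRHS]mulrA ler_wpM2l//.
  rewrite -expRM_natl -!expRD ler_expR -!natr1; lra.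
rewrite sumEFin lee_fin.
have := @geometric_le_lim K M (K1 * expR (2 * th)) (expR (- th)).
rewrite /series /= /geometric /=; apply => //.
  by rewrite mulr_ge0// expR_ge0.
by rewrite ger0_norm// ltW.
Qed.

(** First exp w - 1 <= w exp w.  Then z = y y^(1/(n+1)) <= y (1 + z), which
    exhibits the factor y that is needed to compare with the L^N norm. *)
Lemma expR_sub1_le n (eta C y : K) : 0 < eta -> 0 <= C -> C <= eta -> 0 <= y ->
  let z := y `^ (n.+2%:R / n.+1%:R) in
  expR (C * z) - 1 <= C * (1 + eta^-1) * (y * expR (2 * eta * z)).
Proof.
move=> eta0 C0 Ceta y0 /=; set z := y `^ _.
have z0 : 0 <= z by exact: powR_ge0.
have e0 := ltW eta0.
apply: (@le_trans _ _ (C * z * expR (C * z))).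
  have := expR_ge1Dx (- (C * z)); rewrite expRN => h.
  have E := expR_gt0 (C * z).
  have : (1 - C * z) * expR (C * z) <= 1.
    by rewrite -ler_pdivlMr// mul1r.
  lra.
have zy : z <= y * (1 + z).
  rewrite {1}/z (_ : n.+2%:R / n.+1%:R = 1 + n.+1%:R^-1); last first.
    by rewrite -natr1 mulrDl divff ?pnatr_eq0// mul1r.
  rewrite powRD; last by rewrite gt_eqF// addr_gt0// invr_gt0.
  rewrite powRr1// ler_wpM2l//.
  have [y1|y1] := leP y 1.
    apply: (@le_trans _ _ 1); last by rewrite lerDl.
    have : y `^ n.+1%:R^-1 <= 1 `^ n.+1%:R^-1.
      by apply: ge0_ler_powR; rewrite ?nnegrE// invr_ge0.
    by rewrite powR1.
  apply: (@le_trans _ _ z); last by rewrite lerDr.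
  by apply: ler_powR; [exact: ltW|rewrite -[leLHS]mul1r ler_pM2r ?invr_gt0// ler1n].
have z1 : 1 + z <= (1 + eta^-1) * expR (eta * z).
  apply: (@le_trans _ _ ((1 + eta^-1) * (1 + eta * z))).
    rewrite mulrDl mul1r !mulrDr mulr1 mulKf ?gt_eqF//.
    have : 0 <= eta^-1 by rewrite invr_ge0.
    have : 0 <= eta * z by rewrite mulr_ge0.
    lra.
  by rewrite ler_wpM2l ?expR_ge1Dx// addr_ge0// invr_ge0.
rewrite -!mulrA ler_wpM2l//.
apply: (@le_trans _ _ (y * ((1 + eta^-1) * expR (eta * z)) * expR (eta * z))).
  apply: ler_pM => //; rewrite ?expR_ge0//.
    by apply: le_trans zy _; rewrite ler_wpM2l.
  by rewrite ler_expR ler_wpM2r.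
rewrite (_ : 2 * (eta * z) = eta * z + eta * z); last by ring.
rewrite expRD le_eqVlt; apply/orP; left; apply/eqP; ring.
Qed.

(** The parameter lam will be optimized after integration, which replaces
    Hoelder's inequality. *)
Lemma young_scaled n (lam y b : K) : 0 < lam -> 0 <= y -> 0 <= b ->
  y * b ^+ n.+1 <= lam ^+ n.+1 * y ^+ n.+2 + lam^-1 * b ^+ n.+2.
Proof.
move=> l0 y0 b0.
have := young_exp n.+1 (mulr_ge0 (ltW l0) y0) b0.
have N0 : 0 < n.+2%:R :> K by rewrite ltr0n.
have bN : 0 <= b ^+ n.+2 by rewrite exprn_ge0.
have yN : 0 <= lam ^+ n.+2 * y ^+ n.+2.
  by apply: mulr_ge0; apply: exprn_ge0 => //; exact: ltW.
rewrite exprMn => h.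
have h2 : n.+2%:R * (lam * (y * b ^+ n.+1)) <= n.+2%:R * (lam ^+ n.+2 * y ^+ n.+2 + b ^+ n.+2).
  rewrite [leLHS](_ : _ = n.+2%:R * (lam * y) * b ^+ n.+1); last by rewrite !mulrA.
  apply: (le_trans h).
  rewrite mulrDr; apply: lerD.
    by rewrite ler_peMl// ler1n.
  by rewrite ler_wpM2r// ler_nat.
move: h2; rewrite ler_pM2l// => h2.
rewrite -(ler_pM2l l0); apply: (le_trans h2).
by rewrite mulrDr mulVKf ?gt_eqF// lerD2r (exprS lam n.+1) -mulrA lexx.
Qed.

(** The optimal parameter is lam = X^(- 1/(n+2)); when X = 0, let lam tend to
    infinity. *)
Lemma le_of_scaled_bounds n (A D X K2 : K) : 0 <= A -> 0 <= X -> 0 <= K2 -> 0 <= D ->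
  (forall lam, 0 < lam -> D <= A * (lam ^+ n.+1 * X + lam^-1 * K2)) ->
  D ^+ n.+2 <= (A * (1 + K2)) ^+ n.+2 * X.
Proof.
move=> A0 X0 K20 D0 H.
move: X0; rewrite le_eqVlt => /predU1P[X0|X0].
  have D00 : D <= 0.
    apply/ler_addgt0Pr => e e0; rewrite add0r.
    have l0 : 0 < (A * K2 + 1) / e by rewrite divr_gt0// ltr_wpDl// mulr_ge0.
    apply: le_trans (H _ l0) _; rewrite -X0 mulr0 add0r invf_div mulrCA mulrAC.
    rewrite ler_pdivrMr; last by rewrite ltr_wpDl// mulr_ge0.
    by rewrite ler_pM2l// lerDl.
  have -> : D = 0 by apply/eqP; rewrite eq_le D00.
  by rewrite -X0 mulr0 exprS mul0r.
pose r := X `^ (n.+2%:R^-1).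
have r0 : 0 < r by rewrite powR_gt0.
have rN : r ^+ n.+2 = X.
  by rewrite /r -powR_mulrn ?powR_ge0// -powRrM mulVf ?pnatr_eq0// powRr1// ltW.
have ri0 : 0 < r^-1 by rewrite invr_gt0.
have h := H _ ri0.
have h2 : D <= A * (1 + K2) * r.
  apply: le_trans h _; rewrite -mulrA ler_wpM2l// invrK -rN (exprSr r n.+1) mulrA -exprMn.
  by rewrite mulVf ?gt_eqF// expr1n mulrDl mul1r (mulrC r).
rewrite -rN -exprMn; apply: lerXn2r; rewrite ?nnegrE//.
by apply: mulr_ge0; [apply: mulr_ge0 => //; rewrite addr_ge0|exact: ltW].
Qed.

End exponential.

(** * The distance to the virtual extremizers *)

Section final.
Context {K : realType}.

(** An open set contains points slightly further from the origin than x, so its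
    outer radius is not attained. *)
Lemma enorm_lt_outer m (Om : set 'rV[K]_m.+1) x : open Om -> bounded_set Om -> Om x ->
  enorm x < outer_radius Om.
Proof.
move=> oOm [M [_ bM]] Ox.
have ub : has_sup [set enorm y | y in Om].
  split; first by exists (enorm x); exists x.
  exists (m.+1%:R * (`|M| + 1)) => _ [y Oy <-].
  apply: le_trans (enorm_le_sum y) _.
  apply: (@le_trans _ _ (\sum_(i < m.+1) (`|M| + 1))); last first.
    by rewrite sumr_const card_ord mulr_natl.
  apply: ler_sum => j _.
  have yM : `|y| <= `|M| + 1 by apply: bM => //; rewrite ltr_pwDr// ler_norm.
  exact: le_trans (coord_le_norm y j) yM.
(* A direction that leads away from the origin. *)
pose v : 'rV[K]_m.+1 := if x == 0 then delta_mx ord0 ord0 else x.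
have ev t : 0 < t -> enorm x < enorm (t *: v + x).
  move=> t0; rewrite /v; case: eqVneq => [->|x0].
    rewrite addr0 enormZ ?ltW// (_ : enorm 0 = 0); last by apply/eqP; rewrite enorm_eq0.
    rewrite mulr_gt0// lt_def enorm_ge0 andbT enorm_eq0; apply/eqP => /rowP/(_ ord0).
    by rewrite !mxE !eqxx /=; apply/eqP; exact: oner_neq0.
  have ex : 0 < enorm x by rewrite lt_def enorm_ge0 andbT enorm_eq0.
  rewrite -[X in _ + X]scale1r -scalerDl enormZ ?addr_ge0 ?(ltW t0)//.
  by rewrite ltr_pMl// ltrDr.
have nO : nbhs x Om by apply: open_nbhs_nbhs; split.
have /nbhs_ballP[e /= e0 be] := cvg_line v nO.
have Ot : Om ((e / 2) *: v + x).
  by apply: be; rewrite /ball /= sub0r normrN gtr0_norm ?divr_gt0//; lra.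
apply: lt_le_trans (ev _ (divr_gt0 e0 (ltr0n K 2))) _.
by apply: ub_le_sup => //; [case: ub|exists ((e / 2) *: v + x)].
Qed.

Variables (n : nat) (R : K).
Hypothesis R0 : 0 < R.
Local Notation N := n.+2.
Local Notation mu := (lebesgue_rV (K := K) N).

Lemma decay_rate_gt0 : 0 < decay_rate n :> K.
Proof. by rewrite powR_gt0// hardy_ball_cst_gt0. Qed.

(** The decay rate of the level sets is split in two halves, one for the
    exponential in the integrand and one for the convergence of the series. *)
Lemma exp_level_bound : exists th K2 : K, [/\ 0 < th, 0 <= K2 &
  forall (Rt : K) (Om : set 'rV[K]_N) (u : 'rV[K]_N -> K) (L : K),
  0 < Rt -> Rt <= R -> measurable Om -> Om `<=` eball Rt -> measurable_fun Om u ->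
  0 < L -> lorentz_int R Rt Om u = (L ^+ N)%:E ->
  (\int[mu]_(x in Om) (expR (th * (`|u x| / L) `^ (N%:R / n.+1%:R)))%:E <= K2%:E)%E].
Proof.
pose be : K := N%:R * decay_rate n.
have be0 : 0 < be by rewrite mulr_gt0 ?ltr0n ?decay_rate_gt0.
pose th := be / 2.
have th0 : 0 < th by rewrite divr_gt0.
pose K1 : K := unit_ball_vol n * (expR 1 * R) ^+ N.
have b0 := ltW (unit_ball_vol_gt0 (K := K) n).
have K10 : 0 <= K1.
  by apply: mulr_ge0 => //; apply: exprn_ge0; apply: mulr_ge0; [exact: expR_ge0|exact: ltW].
have q1 : expR (- th) < 1 by rewrite expR_lt1; lra.
exists th, (expR th * (unit_ball_vol n * R ^+ N) + K1 * expR (2 * th) / (1 - expR (- th))); split => //.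
  apply: addr_ge0.
    by apply: mulr_ge0; [exact: expR_ge0|apply: mulr_ge0 => //; apply: exprn_ge0; exact: ltW].
  apply: divr_ge0; last lra.
  by apply: mulr_ge0 => //; exact: expR_ge0.
move=> Rt Om u L Rt0 RtR mOm OmB mfu L0 LE.
have e0 : 0 < N%:R / n.+1%:R :> K by rewrite divr_gt0 ?ltr0n.
have my : measurable_fun Om (fun x => `|u x| / L).
  by apply: measurable_funM => //; exact: (measurableT_comp (@normr_measurable K setT)).
apply: exp_integral_le => //.
- exact: (measurableT_comp (measurable_powR (N%:R / n.+1%:R))).
- by move=> x _; exact: powR_ge0.
- apply: (@le_trans _ _ (mu (eball Rt))).
    by apply: le_measure; rewrite ?inE//; exact: measurable_eball.
  rewrite lebesgue_rV_eballE// lee_fin ler_wpM2l//; apply: lerXn2r => //; rewrite ?nnegrE; exact: ltW.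
(* The level s of |u| corresponds to the level k of (|u| / L)^(N/(N-1)). *)
move=> k; pose s : K := L * k%:R `^ (n.+1%:R / N%:R).
have s0 : 0 <= s by rewrite mulr_ge0 ?powR_ge0// ltW.
have sL : s / L = k%:R `^ (n.+1%:R / N%:R) by rewrite /s mulrC mulKf// gt_eqF.
apply: (@le_trans _ _ (mu (level Om u s))).
  apply: le_measure; rewrite ?inE.
  - have mz : measurable_fun Om (fun x => (`|u x| / L) `^ (N%:R / n.+1%:R)).
      exact: (measurableT_comp (measurable_powR (N%:R / n.+1%:R))).
    exact: (measurable_fun_ltr (@measurable_cst _ _ _ _ Om (k%:R : K)) mz mOm (Y := [set true]) I).
  - exact: measurable_level.
  move=> x [Ox /= kx]; split => //=; rewrite ltNge; apply/negP => us; move: kx; apply/negP.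
  rewrite -leNgt.
  have : `|u x| / L <= k%:R `^ (n.+1%:R / N%:R) by rewrite -sL ler_pM2r ?invr_gt0.
  move=> /(ge0_ler_powR (ltW e0)); rewrite !nnegrE powR_ge0 divr_ge0 ?(ltW L0)// => /(_ erefl erefl).
  rewrite -powRrM (_ : n.+1%:R / N%:R * _ = 1) ?powRr1//.
  by rewrite mulrA divfK ?pnatr_eq0// divff// pnatr_eq0.
rewrite (distrE Rt0 mOm OmB mfu) lee_fin.
apply: le_trans (level_decay Rt0 RtR mOm OmB mfu L0 LE s0) _.
rewrite -/K1 sL -powRrM (_ : n.+1%:R / N%:R * _ = 1); last first.
  by rewrite mulrA divfK ?pnatr_eq0// divff// pnatr_eq0.
by rewrite powRr1// ler_wpM2l// ler_expR /th /be; lra.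
Qed.

(** The exponential of [expR_sub1_le], raised to the power N, is the one that
    [exp_level_bound] controls: this fixes eta = th / (2 N). *)
Lemma exp_dist_bound : exists eta K4 : K, [/\ 0 < eta, 0 < K4 &
  forall (C Rt : K) (Om : set 'rV[K]_N) (u : 'rV[K]_N -> K) (L w : K),
  0 <= C -> C <= eta ->
  0 < Rt -> Rt <= R -> measurable Om -> Om `<=` eball Rt -> measurable_fun Om u ->
  0 < L -> lorentz_int R Rt Om u = (L ^+ N)%:E ->
  (\int[mu]_(x in Om) (`|u x| ^+ N)%:E = w%:E)%E ->
  exists2 d : K, 0 <= d &
   (\int[mu]_(x in Om) (expR (C * (`|u x| / L) `^ (N%:R / n.+1%:R)) - 1)%:E = d%:E)%E /\
   d ^+ N <= (C * K4) ^+ N * (w / L ^+ N)].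
Proof.
have [th [K2 [th0 K20 HK2]]] := exp_level_bound.
pose eta := th / (2 * N%:R).
have eta0 : 0 < eta by rewrite divr_gt0// mulr_gt0 ?ltr0n.
pose K3 := 1 + eta^-1.
have K30 : 0 < K3 by rewrite addr_gt0// invr_gt0.
exists eta, (K3 * (1 + K2)); split => //; first by rewrite mulr_gt0// ltr_wpDr.
move=> C Rt Om u L w C0 Ceta Rt0 RtR mOm OmB mfu L0 LE wE.
have L0' := ltW L0.
pose z x := (`|u x| / L) `^ (N%:R / n.+1%:R).
have z0 x : 0 <= z x by exact: powR_ge0.
have my : measurable_fun Om (fun x => `|u x| / L).
  by apply: measurable_funM => //; exact: (measurableT_comp (@normr_measurable K setT)).
have mz : measurable_fun Om z by exact: (measurableT_comp (measurable_powR (N%:R / n.+1%:R))).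
have me c : measurable_fun Om (fun x => expR (c * z x)).
  apply: (measurableT_comp (@measurable_expR K)); exact: measurable_funM.
have LN0 : 0 < L ^+ N by rewrite exprn_gt0.
have w0 : 0 <= w by rewrite -lee_fin -wE; apply: integral_ge0 => x _; rewrite lee_fin exprn_ge0.
have yE : (\int[mu]_(x in Om) ((`|u x| / L) ^+ N)%:E = (w / L ^+ N)%:E)%E.
  transitivity (\int[mu]_(x in Om) (((L ^+ N)^-1)%:E * (`|u x| ^+ N)%:E))%E.
    by apply: eq_integral => x _; rewrite -EFinM expr_div_n mulrC.
  rewrite ge0_integralZl//.
  - by rewrite wE -EFinM mulrC.
  - apply/measurable_EFinP; apply: measurable_funX.
    exact: (measurableT_comp (@normr_measurable K setT)).
  - by rewrite lee_fin invr_ge0 ltW.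
have d0 : (0 <= \int[mu]_(x in Om) (expR (C * z x) - 1)%:E)%E.
  by apply: integral_ge0 => x _; rewrite lee_fin subr_ge0 -expR0 ler_expR mulr_ge0.
have H lam : 0 < lam -> (\int[mu]_(x in Om) (expR (C * z x) - 1)%:E <=
    (C * K3 * (lam ^+ n.+1 * (w / L ^+ N) + lam^-1 * K2))%:E)%E.
  move=> l0.
  have CK0 : 0 <= C * K3 by rewrite mulr_ge0// ltW.
  have a0 : 0 <= C * K3 * lam ^+ n.+1 by rewrite mulr_ge0// exprn_ge0// ltW.
  have b0 : 0 <= C * K3 * lam^-1 by rewrite mulr_ge0// invr_ge0 ltW.
  apply: (@le_trans _ _ ((C * K3 * lam ^+ n.+1)%:E * \int[mu]_(x in Om) ((`|u x| / L) ^+ N)%:E +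
      (C * K3 * lam^-1)%:E * \int[mu]_(x in Om) (expR (th * z x))%:E)%E).
    apply: le_integral_comb => //.
    - by apply: measurable_funB.
    - exact: measurable_funX.
    move=> x Ox; split.
    - by rewrite subr_ge0 -expR0 ler_expR mulr_ge0.
    - by rewrite exprn_ge0// divr_ge0.
    - exact: expR_ge0.
    have y0 : 0 <= `|u x| / L by rewrite divr_ge0.
    have := expR_sub1_le n eta0 C0 Ceta y0; cbv zeta; rewrite -/(z x) -/K3 => h1.
    have h2 := young_scaled n l0 y0 (expR_ge0 (2 * eta * z x)).
    apply: (le_trans h1).
    apply: (@le_trans _ _ (C * K3 * (lam ^+ n.+1 * (`|u x| / L) ^+ N + lam^-1 * expR (th * z x)))); last first.
      by rewrite le_eqVlt; apply/orP; left; apply/eqP; rewrite mulrDr !mulrA.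
    rewrite ler_wpM2l//.
    have -> : expR (th * z x) = expR (2 * eta * z x) ^+ N.
      rewrite -expRM_natl; congr expR; rewrite /eta.
      have : 0 < N%:R :> K by rewrite ltr0n.
      by move: (N%:R) => m m0; field; rewrite gt_eqF.
    apply: le_trans h2; rewrite ler_wpM2l// -[leLHS]expr1; apply: ler_weXn2l => //.
    by rewrite -expR0 ler_expR; apply: mulr_ge0 => //; apply: mulr_ge0 => //; exact: ltW.
  have -> : C * K3 * (lam ^+ n.+1 * (w / L ^+ N) + lam^-1 * K2) =
      C * K3 * lam ^+ n.+1 * (w / L ^+ N) + C * K3 * lam^-1 * K2.
    by rewrite [LHS]mulrDr !mulrA.
  rewrite yE EFinD; apply: leeD; first by rewrite -EFinM.
  rewrite [leRHS]EFinM; apply: lee_wpmul2l; first by rewrite lee_fin.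
  exact: (HK2 _ _ _ _ Rt0 RtR mOm OmB mfu L0 LE).
have dfin : (\int[mu]_(x in Om) (expR (C * z x) - 1)%:E)%E \is a fin_num.
  by rewrite ge0_fin_numE// (le_lt_trans (H 1 ltr01))// ltry.
exists (fine (\int[mu]_(x in Om) (expR (C * z x) - 1)%:E)%E); first by rewrite fine_ge0.
split; first by rewrite fineK.
rewrite (mulrA C K3); apply: le_of_scaled_bounds => //.
- by rewrite mulr_ge0// ltW.
- by rewrite divr_ge0// ltW.
- by rewrite fine_ge0.
- by move=> lam l0; rewrite -lee_fin fineK//; exact: H.
Qed.

End final.

Lemma sobolev0_energy_lty (K : realType) (n : nat) (Om : set 'rV[K]_n.+2) u Du :
  sobolev0 Om n.+2 u Du ->
  (\int[lebesgue_rV n.+2]_(x in Om) (enorm (Du x) ^+ n.+2)%:E < +oo)%E.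
Proof.
move=> [[_ _ _ su] _].
have Ni : n.+2%:R^-1 != 0 :> K by rewrite invr_eq0 pnatr_eq0.
apply: le_lt_trans (lty_poweRy Ni su); rewrite leeDr//.
by apply: integral_ge0 => x _; rewrite lee_fin exprn_ge0.
Qed.

Theorem theorem1p2 (K : realType) (N : nat) (R Rt : K)
    (N_ge2 : (2 <= N)%N) (Rt_le_R : Rt <= R) :
  exists2 C : K, 0 < C &
    forall Om : set 'rV[K]_N,
      open Om -> bounded_set Om -> Om 0 -> outer_radius Om = Rt ->
    forall (u : 'rV[K]_N -> K) (Du : 'rV[K]_N -> 'rV[K]_N),
      sobolev0 Om N u Du ->
      (\int[lebesgue_rV N]_(x in Om) (enorm (Du x) ^+ N)%:E
         - (((N%:R - 1) / N%:R) ^+ N)%:E * hardy_integral Om R u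
       >= (((N%:R - 1) / N%:R) ^+ N)%:E * hardy_integral Om R u
            * extremizer_dist Om R C u ^+ N)%E.
Proof.
case: N N_ge2 => [|[|n]]// _.
(* If R <= 0 then no open set containing the origin has outer radius Rt. *)
have [R0|R0] := ltP 0 R; last first.
  exists 1 => // Om oOm bOm O0 RtE; exfalso.
  have := enorm_lt_outer oOm bOm O0; rewrite RtE => h.
  by have := le_lt_trans (enorm_ge0 _) h; rewrite ltNge (le_trans Rt_le_R).
have cE : (n.+2%:R - 1) / n.+2%:R = hardy_ratio n :> K by rewrite /hardy_ratio -natr1 addrK.
have eE : n.+2%:R / (n.+2%:R - 1) = n.+2%:R / n.+1%:R :> K by rewrite -{2}natr1 addrK.
have [kap kap0 Hkap] := improved_hardy n R0.
rewrite cE; set c := hardy_ratio n ^+ n.+2 in Hkap *.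
have c0 : 0 < c by apply: exprn_gt0; exact: hardy_ratio_gt0.
clearbody c.
have [eta [K4 [eta0 K40 HK4]]] := exp_dist_bound n R0.
(* The second bound gives (C K4)^N <= C K4, and the third one lets the remainder
   kap absorb 2 c C K4. *)
pose C := Num.min eta (Num.min (K4^-1) (kap / (2 * c * K4))).
have C0 : 0 < C by rewrite !lt_min eta0 invr_gt0 K40 divr_gt0// mulr_gt0// mulr_gt0.
have Ceta : C <= eta by rewrite ge_min lexx.
have CK1 : C * K4 <= 1.
  by rewrite -ler_pdivlMr// mul1r; rewrite /C !ge_min lexx !orbT.
have CK2 : 2 * c * (C * K4) <= kap.
  have : C <= kap / (2 * c * K4) by rewrite /C !ge_min lexx !orbT.
  by rewrite ler_pdivlMr ?mulr_gt0// => h; apply: le_trans h; rewrite le_eqVlt; apply/orP; left; apply/eqP; ring.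
exists C => // Om oOm bOm O0 RtE u Du su.
have OmB : Om `<=` eball Rt by move=> x Ox; rewrite /eball/= -RtE; exact: enorm_lt_outer.
have Rt0 : 0 < Rt by apply: le_lt_trans (enorm_ge0 _) (OmB _ O0).
have mOm : measurable Om by exact: open_measurable_rV.
have OmR x : Om x -> enorm x <= R by move=> /OmB; exact: eball_R.
have [[mfu mDu _ _] _] := su.
have := Hkap Om u Du mOm OmR su.
have Afin := sobolev0_energy_lty su.
set A := (\int[_]_(x in Om) (enorm _ ^+ _)%:E)%E in Afin *.
set H := hardy_integral Om R u; set U := (\int[_]_(x in Om) (`|u x| ^+ _)%:E)%E.
have A0 : (0 <= A)%E by apply: integral_ge0 => x _; rewrite lee_fin exprn_ge0// enorm_ge0.
have H0 : (0 <= H)%E.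
  apply: integral_ge0 => x /OmR xR; rewrite lee_fin; apply: mulr_ge0; first exact: exprn_ge0.
  exact: hardy_weightV_ge0.
have U0 : (0 <= U)%E by apply: integral_ge0 => x _; rewrite lee_fin exprn_ge0.
move=> main.
have kU0 : (0 <= kap%:E * U)%E by rewrite mule_ge0// lee_fin ltW.
have cH0 : (0 <= c%:E * H)%E by rewrite mule_ge0// lee_fin ltW.
have Hfin : H \is a fin_num.
  rewrite ge0_fin_numE//; move: main; case: (H) H0 => [r _ _|_|//]; first by rewrite ltry.
  by rewrite gt0_muley ?lte_fin// addye ?leye_eq; [move/eqP => AE; rewrite AE in Afin|rewrite -ltNye (lt_le_trans _ kU0)].
have Ufin : U \is a fin_num.
  rewrite ge0_fin_numE//; move: main; case: (U) U0 => [r _ _|_|//]; first by rewrite ltry.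
  by rewrite gt0_muley ?lte_fin// addey ?leye_eq; [move/eqP => AE; rewrite AE in Afin|rewrite -ltNye (lt_le_trans _ cH0)].
have Af : A \is a fin_num by rewrite ge0_fin_numE.
pose L := fine (log_lorentz_norm Om R u).
have L0 : 0 <= L by rewrite fine_ge0// poweR_ge0.
pose D a := (\int[lebesgue_rV n.+2]_(x in Om)
      (expR (C * `|u x - a * virtual_extremizer R x| `^ (n.+2%:R / (n.+2%:R - 1)) /
             L `^ (n.+2%:R / (n.+2%:R - 1))) - 1)%:E)%E.
have dist0 : (0 <= extremizer_dist Om R C u)%E.
  apply: le_ereal_inf_tmp => _ [a _ <-]; apply: integral_ge0 => x _.
  rewrite lee_fin subr_ge0 -expR0 ler_expR; apply: divr_ge0; last exact: powR_ge0.
  by apply: mulr_ge0; [exact: ltW|exact: powR_ge0].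
have distD : (extremizer_dist Om R C u <= D 0%R)%E.
  by apply: ereal_inf_lbound; exists 0.
(* All the terms are finite, so it remains to bound c H d^N by the remainder. *)
suff [d d0 [Dd dle]] : exists2 d : K, 0 <= d & D 0 = d%:E /\
    c * fine H * d ^+ n.+2 <= kap * fine U.
  apply: (@le_trans _ _ (c%:E * H * d%:E ^+ n.+2)%E).
    apply: lee_wpmul2l => //; apply: lee_expe => //; by rewrite -Dd.
  rewrite leeBrDr; last by rewrite fin_numM.
  apply: le_trans main; rewrite addeC leeD2l//.
  by rewrite -(fineK Hfin) -(fineK Ufin) -EFin_expe -!EFinM lee_fin.
(* L is the real part of the norm, hence also 0 when the norm is infinite; the
   exponent of the exponential is then 0. *)
have [L00|L1] := eqVneq L 0.
  exists 0 => //; split; last by rewrite exprS mul0r mulr0 mulr_ge0 ?fine_ge0// ltW.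
  apply: integral0_eq => x _.
  rewrite L00 powR0; last by rewrite eE gt_eqF// divr_gt0 ?ltr0n.
  by rewrite invr0 mulr0 expR0 subrr.
have Lp : 0 < L by rewrite lt_def L1.
have LE : lorentz_int R Rt Om u = (L ^+ n.+2)%:E.
  have lfin : log_lorentz_norm Om R u = L%:E.
    by rewrite fineK//; move: L1; rewrite /L; case: (log_lorentz_norm Om R u); rewrite //= eqxx.
  have I0 : (0 <= lorentz_int R Rt Om u)%E.
    apply: integral_ge0 => x /(eball_R Rt_le_R) xR.
    by apply: mule_ge0; [exact: expe_ge0|rewrite lee_fin; exact: hardy_weightV_ge0].
  have : log_lorentz_norm Om R u = (lorentz_int R Rt Om u `^ n.+2%:R^-1)%E.
    by rewrite /log_lorentz_norm RtE.
  rewrite lfin => /(congr1 (fun t => (t `^ n.+2%:R)%E)).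
  by rewrite -poweRrM mulVf ?pnatr_eq0// poweRe1// poweR_EFin powR_mulrn.
have [d d0 [dE dle]] := HK4 C Rt Om u L (fine U) (ltW C0) Ceta Rt0 Rt_le_R mOm OmB mfu Lp LE (esym (fineK Ufin)).
exists d => //; split.
  rewrite -dE; apply: eq_integral => x _; rewrite mul0r subr0 eE; congr (expR _ - 1)%:E.
  rewrite -mulrA; congr (_ * _); set e := (_ / _).
  have y0 : 0 <= `|u x| / L by rewrite divr_ge0.
  have -> : `|u x| `^ e = (`|u x| / L) `^ e * L `^ e by rewrite -powRM// divfK.
  by rewrite mulfK// gt_eqF// powR_gt0.
have HL : fine H <= 2 * L ^+ n.+2.
  have := hardy_le_lorentz Rt0 Rt_le_R mOm OmB mfu.
  by rewrite LE -/H -(fineK Hfin) -EFinM lee_fin.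
have LN0 : 0 < L ^+ n.+2 by rewrite exprn_gt0.
have h0 : 0 <= fine H by rewrite fine_ge0.
have w0 : 0 <= fine U by rewrite fine_ge0.
have CKN : (C * K4) ^+ n.+2 <= C * K4.
  have CK0 : 0 <= C * K4 by rewrite mulr_ge0 ?ltW.
  by rewrite exprS ler_piMr// exprn_ile1.
apply: (@le_trans _ _ (c * (2 * L ^+ n.+2) * ((C * K4) * (fine U / L ^+ n.+2)))).
  apply: ler_pM.
  - by apply: mulr_ge0 => //; exact: ltW.
  - exact: exprn_ge0.
  - by rewrite ler_pM2l.
  - by apply: (le_trans dle); rewrite ler_wpM2r// divr_ge0// ltW.
rewrite [leLHS](_ : _ = 2 * c * (C * K4) * fine U); last first.
  by move: (L ^+ n.+2) LN0 => l l0; field; rewrite gt_eqF.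
by rewrite ler_wpM2r.
Qed.
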